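(* Let $\mathcal X=(-\infty,\infty)$ and $\mathcal F=\{f:0\le f(x)\le(Mg_0(x))^{1/(1-\gamma)}\ \forall x\in\mathcal X,\ f\text{ is unimodal about }c\text{ on }\mathcal X\}$, where $M>0$, $\gamma\in(0,1)$, $c\in\mathbb R$, and $g_0$ is a positive unimodal (about $c$) probability density on $\mathcal X$ with $g_0(c)<\infty$. Let $g_0$ be the sampling distribution. Suppose $\|\phi_j\|_{2+\delta}<\infty$ for $j=0,\ldots,l$ and some $\delta>0$, and that there exists $L_0\in\mathcal L$ such that $\mathbb E_{g_0}[\phi_j(X)L_0(X)]<\mu_j$ for $j=1,\ldots,m$ and $\mathbb E_{g_0}[\phi_j(X)L_0(X)]=\mu_j$ for $j=m+1,\ldots,l$, with moreover $(\mu_{m+1},\ldots,\mu_l)$ an interior point of $\{(\mathbb E_{g_0}[\phi_{m+1}(X)L(X)],\ldots,\mathbb E_{g_0}[\phi_l(X)L(X)]):L\in\mathcal L\}$. Then the problem $(\mathcal P_n)$ is equivalent to the linear program $(\mathcal P_n')$ (i.e. $(\mathcal P_n)$ is finite-dimensionally reducible) with the discrete shape constraint: for $i=1,\ldots,n$, $$L(X_{(i-1)})g_0(X_{(i-1)})\le L(X_{(i)})g_0(X_{(i)})\ \text{ if }X_{(i)}\le c,\qquad L(X_{(i+1)})g_0(X_{(i+1)})\le L(X_{(i)})g_0(X_{(i)})\ \text{ if }X_{(i)}\ge c,$$ $$0\le L(X_i)g_0(X_i)\le(Mg_0(X_i))^{1/(1-\gamma)},$$ where $X_{(1)}\le\cdots\le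 X_{(n)}$ are the order statistics of $X_1,\ldots,X_n$ and the terms $L(X_{(0)})g_0(X_{(0)})$ and $L(X_{(n+1)})g_0(X_{(n+1)})$ are taken to be $0$. Additionally, $|val(\mathcal P_n)-val(\mathcal P)|\overset{\text{a.s.*}}{\to}0$ and $\sqrt n\,(val(\mathcal P_n)-val(\mathcal P))=O_{\mathbb P^*}(1)$.
   Context: Setting. $\phi_0,\ldots,\phi_l:\mathcal X\to\mathbb R$ are known functions, $0\le m\le l$, $\mu_1,\ldots,\mu_l\in\mathbb R$, and one of $\phi_1,\ldots,\phi_l$ is the indicator $I(x\in\mathcal X)$ (total mass constraint). $X,X_1,X_2,\ldots$ are i.i.d. with density $g_0$, $\mathbb E_{g_0}$ is expectation under $g_0$, $\|h\|_p=(\mathbb E_{g_0}|h(X)|^p)^{1/p}$, and $\mathcal L=\{f/g_0:f\in\mathcal F\}$. Since $g_0$ is a density, the $X_i$ are almost surely distinct; the equivalence is understood on that event. A function $f$ is unimodal about $c$ if it is non-decreasing for $x\le c$ and non-increasing for $x\ge c$. Problem $(\mathcal P)$: $\sup_{L\in\mathcal L}\mathbb E_{g_0}[\phi_0(X)L(X)]$ subject to $\mathbb E_{g_0}[\phi_j(X)L(X)]\le\mu_j$ for $j=1,\ldots,m$ and $\mathbb E_{g_0}[\phi_j(X)L(X)]=\mu_j$ for $j=m+1,\ldots,l$. Problem $(\mathcal P_n)$ (the IW-SAA problem): $\sup_{L\in\mathcal L}\frac1n\sum_{i=1}^n\phi_0(X_i)L(X_i)$ subject to $\frac1n\sum_{i=1}^n\phi_j(X_i)L(X_i)\le\mu_j$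 for $j=1,\ldots,m$ and $\frac1n\sum_{i=1}^n\phi_j(X_i)L(X_i)=\mu_j$ for $j=m+1,\ldots,l$. Problem $(\mathcal P_n')$: the same objective and moment constraints as $(\mathcal P_n)$, but with the real numbers $L(X_1),\ldots,L(X_n)$ as decision variables and with $L\in\mathcal L$ replaced by the stated discrete shape constraint. ''Equivalent'' / ''finite-dimensionally reducible'' means: the values at $X_1,\ldots,X_n$ of any $L\in\mathcal L$ satisfy the discrete shape constraint, and conversely any real numbers $L(X_1),\ldots,L(X_n)$ satisfying it are the values at $X_1,\ldots,X_n$ of some $L\in\mathcal L$; in particular $val(\mathcal P_n)=val(\mathcal P_n')$. $val(\cdot)$ is the optimal value in $[-\infty,\infty]$ ($\sup\emptyset=-\infty$). If $l=m$ the interior point condition is vacuous. Outer convergence. On $(\Omega,\mathcal G,\mathbb P)$, $\mathbb P^*(B)=\inf\{\mathbb P(A):A\supset B,A\in\mathcal G\}$. $T^*$ is the minimal measurable majorant of a map $T:\Omega\to[-\infty,\infty]$ (measurable, $T^*\ge T$, and $T^*\le U$ a.s. for every measurable $U\ge T$ a.s.). $Z_n\overset{\text{a.s.*}}{\to}Z$ means $|Z_n-Z|^*\to0$ a.s. $Z_n=O_{\mathbb P^*}(1)$ means: for every $\varepsilon>0$ there is $K>0$ with $\limsup_n\mathbb P^*(|Z_n|\ge K)\le\varepsilon$. *)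

(* Defs.v *)
From HB Require Import structures.
From mathcomp Require Import all_boot all_order all_algebra.
From mathcomp Require Import all_classical all_reals all_analysis measurable_realfun.

Set Implicit Arguments.
Unset Strict Implicit.
Unset Printing Implicit Defensive.

Import Order.TTheory GRing.Theory Num.Theory.
Import numFieldNormedType.Exports.

Local Open Scope classical_set_scope.
Local Open Scope ring_scope.

Definition unimodal (R : realType) (c : R) (f : R -> R) : Prop :=
  (forall x y, x <= y -> y <= c -> f x <= f y) /\
  (forall x y, c <= x -> x <= y -> f y <= f x).

Definition positive_density (R : realType) (g : R -> R) : Prop :=
  [/\ measurable_fun setT g, forall x, 0 < g x
    & (\int[lebesgue_measure]_x (g x)%:E = 1)%E].

(* E_g[h(X)] for X with density g *)
Definition expect_dens (R : realType) (g h : R -> R) : \bar R :=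
  (\int[lebesgue_measure]_x (h x * g x)%:E)%E.

Definition norm_dens (R : realType) (g : R -> R) (p : R) (h : R -> R) : \bar R :=
  (expect_dens g (fun x => `|h x| `^ p)%R `^ p^-1)%E.

Definition has_density d (T : measurableType d) (R : realType)
    (P : probability T R) (Y : {RV P >-> R}) (g : R -> R) : Prop :=
  forall A : set R, measurable A ->
    (distribution P Y A = \int[lebesgue_measure]_(x in A) (g x)%:E)%E.

Definition mutually_independent d (T : measurableType d) (R : realType)
    (P : probability T R) (X : nat -> {RV P >-> R}) : Prop :=
  forall (J : seq nat) (A : nat -> set R), uniq J ->
    (forall i, measurable (A i)) ->
    (P (\bigcap_(i in [set` J]) (X i @^-1` A i))
     = \prod_(i <- J) P (X i @^-1` A i))%E.

Definition shape_class (R : realType) (M gamma c : R) (g0 : R -> R) :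
    set (R -> R) :=
  [set f | (forall x, 0 <= f x <= (M * g0 x) `^ (1 - gamma)^-1) /\
           unimodal c f].

Definition likelihood_class (R : realType) (M gamma c : R) (g0 : R -> R) :
    set (R -> R) :=
  [set (fun x => f x / g0 x) | f in shape_class M gamma c g0].

(* [E j] is the j-th moment; the constraints are numbered 1, ..., l, the first
   m of them being inequalities. *)
Definition moment_constraints (R : realType) (m l : nat) (mu : nat -> R)
    (E : nat -> \bar R) : Prop :=
  (forall j, (1 <= j <= m)%N -> (E j <= (mu j)%:E)%E) /\
  (forall j, (m < j <= l)%N -> E j = (mu j)%:E).

Definition val_P (R : realType) (M gamma c : R) (g0 : R -> R) (m l : nat)
    (phi : nat -> R -> R) (mu : nat -> R) : \bar R :=
  let mom (L : R -> R) j := expect_dens g0 (fun x => phi j x * L x) in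
  ereal_sup [set mom L 0%N | L in
    [set L | likelihood_class M gamma c g0 L /\
             moment_constraints m l mu (mom L)]].

(* (1/n) sum_i phi_j(x_i) v_i, where v_i is the value attached to the i-th
   sample point *)
Definition sample_moment (R : realType) (n : nat) (phi : nat -> R -> R)
    (x v : 'I_n -> R) (j : nat) : \bar R :=
  (n%:R^-1 * \sum_(i < n) phi j (x i) * v i)%:E.

Definition val_Pn (R : realType) (M gamma c : R) (g0 : R -> R) (m l : nat)
    (phi : nat -> R -> R) (mu : nat -> R) (n : nat) (x : 'I_n -> R) : \bar R :=
  let mom (L : R -> R) := sample_moment phi x (fun i => L (x i)) in
  ereal_sup [set mom L 0%N | L in
    [set L | likelihood_class M gamma c g0 L /\
             moment_constraints m l mu (mom L)]].

(* Indices of the sample points listed by increasing value: when the sample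
   points are distinct, the k-th entry (counting from 1) is the index i with
   X_i = X_(k). *)
Definition order_indices (R : realType) (n : nat) (x : 'I_n -> R) : seq 'I_n :=
  sort (fun i j => x i <= x j) (enum 'I_n).

(* The order statistic X_(k), for 1 <= k <= n. *)
Definition order_stat (R : realType) (n : nat) (x : 'I_n -> R) (k : nat) : R :=
  nth 0 [seq x i | i <- order_indices x] k.-1.

(* L(X_(k)) g0(X_(k)) for 1 <= k <= n, where L(X_i) = v i; it is 0 for k = 0
   and, by the default value of [nth], for k = n + 1. *)
Definition order_weight (R : realType) (g0 : R -> R) (n : nat)
    (x v : 'I_n -> R) (k : nat) : R :=
  nth 0 (0 :: [seq v i * g0 (x i) | i <- order_indices x]) k.

Definition discrete_shape (R : realType) (M gamma c : R) (g0 : R -> R)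
    (n : nat) (x v : 'I_n -> R) : Prop :=
  (forall k, (1 <= k <= n)%N ->
     (order_stat x k <= c ->
        order_weight g0 x v k.-1 <= order_weight g0 x v k) /\
     (c <= order_stat x k ->
        order_weight g0 x v k.+1 <= order_weight g0 x v k)) /\
  (forall i : 'I_n,
     0 <= v i * g0 (x i) <= (M * g0 (x i)) `^ (1 - gamma)^-1).

Definition val_Pn' (R : realType) (M gamma c : R) (g0 : R -> R) (m l : nat)
    (phi : nat -> R -> R) (mu : nat -> R) (n : nat) (x : 'I_n -> R) : \bar R :=
  ereal_sup [set sample_moment phi x v 0%N | v in
    [set v : 'I_n -> R | discrete_shape M gamma c g0 x v /\
       moment_constraints m l mu (sample_moment phi x v)]].

Definition finite_dim_reducible (R : realType) (M gamma c : R) (g0 : R -> R)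
    (m l : nat) (phi : nat -> R -> R) (mu : nat -> R) (n : nat)
    (x : 'I_n -> R) : Prop :=
  [/\ forall L, likelihood_class M gamma c g0 L ->
        discrete_shape M gamma c g0 x (fun i => L (x i)),
      forall v : 'I_n -> R, discrete_shape M gamma c g0 x v ->
        exists2 L, likelihood_class M gamma c g0 L & forall i, L (x i) = v i
    & val_Pn M gamma c g0 m l phi mu x = val_Pn' M gamma c g0 m l phi mu x].

(* Vectors (E[phi_(m+1) L], ..., E[phi_l L]), L ranging over the class. *)
Definition equality_moment_range (R : realType) (M gamma c : R) (g0 : R -> R)
    (m l : nat) (phi : nat -> R -> R) : set 'rV[R]_(l - m) :=
  [set z | exists2 L, likelihood_class M gamma c g0 L &
     forall k : 'I_(l - m),
       expect_dens g0 (fun x => phi (m + k.+1)%N x * L x) = (z ord0 k)%:E].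
Arguments equality_moment_range {R} M gamma c g0 m l phi.

Definition outer_prob d (T : measurableType d) (R : realType)
    (P : probability T R) (B : set T) : \bar R :=
  ereal_inf [set P A | A in [set A | measurable A /\ B `<=` A]].

Definition minimal_majorant d (T : measurableType d) (R : realType)
    (P : probability T R) (Z U : T -> \bar R) : Prop :=
  [/\ measurable_fun setT U, forall w, (Z w <= U w)%E
    & forall V : T -> \bar R, measurable_fun setT V ->
        {ae P, forall w, (Z w <= V w)%E} -> {ae P, forall w, (U w <= V w)%E}].

(* Minimal majorants are unique only up to null sets, whence the choice [U]. *)
Definition cvg_as_outer d (T : measurableType d) (R : realType)
    (P : probability T R) (Z : nat -> T -> \bar R) (Zlim : T -> \bar R) : Prop :=
  exists U : nat -> T -> \bar R,
    (forall n, minimal_majorant P (fun w => `|Z n w - Zlim w|%E) (U n)) /\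
    {ae P, forall w, U ^~ w @ \oo --> 0%E}.

Definition bigO_outer_prob d (T : measurableType d) (R : realType)
    (P : probability T R) (Z : nat -> T -> \bar R) : Prop :=
  forall eps : R, 0 < eps -> exists2 K : R, 0 < K &
    (limn_esup (fun n => outer_prob P [set w | K%:E <= `|Z n w|]) <= eps%:E)%E.

(* The first n observations X_1, ..., X_n, stored as X 0, ..., X n.-1. *)
Definition sample d (T : measurableType d) (R : realType)
    (P : probability T R) (X : nat -> {RV P >-> R}) (n : nat) (w : T) :
    'I_n -> R := fun i => X i w.
Arguments sample {d T R P} X n w.

(* Main.v *)
(* Put p = gamma / (1 - gamma) and E = (M g0)^(1/(1-gamma)) / g0. For every L in
   the class, L + E/p and E/p are both bounded and unimodal about c, so by the
   layer-cake formula the deviation of the empirical mean of phi_j L from its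
   expectation is controlled, uniformly in L, by the deviations of phi_j and of
   phi_j 1_A for A ranging over the rays (-oo, s], s < c, and [s, +oo), s > c.

   Along a chain of such rays, subtracting from phi_j(X) 1_A(X) its compensator
   for the filtration that reveals X once it has entered the ray leaves a
   martingale; Doob's inequality bounds its maximum, and the compensator is
   small because the complements of the rays keep a positive mass. Hence the
   uniform deviation of the sums over n observations has second moment O(n).

   The value of a convex program satisfying the Slater and interior point
   conditions is Lipschitz under small uniform perturbations of its moments,
   which yields the rate. Almost sure convergence follows along n = k^2 by
   summability of the second moments, and the increments between consecutive
   squares are also of summable second moment after rescaling. *)

(* The members L = f / g0 of the class need not be unimodal: away from the mode L can grow by a
   factor up to q, the ratio of the values of g0. The envelope, proportional to g0^p, shrinks by q^p
   at the same time, and q^p >= 1 + p (1 - 1/q) shows that the loss of E/p covers the gain of L.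
   This is where the multiple 1/p comes from. The [phi j] are unbounded, with moments only slightly
   above the second, and the supremum over the class need not be measurable. Hence only second
   moments are used, and only countable families of rays, with thresholds dense below the mode;
   dominated convergence reaches all other rays. The thresholds stay strictly short of c, so the
   complement of every ray contains the opposite half-line, whose mass is positive because g0 > 0.
   This keeps the denominators of the compensator away from 0. The perturbation estimate is
   deterministic, for one fixed sample with small deviations. Outer probability enters only at the
   end, through measurable majorants of the deviations. *)
Require Import Defs.
From HB Require Import structures.
From mathcomp Require Import all_boot all_order all_algebra.
From mathcomp Require Import all_classical all_reals all_analysis measurable_realfun.
From mathcomp Require Import zify ring lra.

Set Implicit Arguments.
Unset Strict Implicit.
Unset Printing Implicit Defensive.

Import Order.TTheory GRing.Theory Num.Theory.
Import numFieldNormedType.Exports.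

Local Open Scope classical_set_scope.
Local Open Scope ring_scope.

(** * Square integrability and independence *)

Section square_integrable.
Context d (T : measurableType d) (R : realType) (P : probability T R).
Implicit Types f g : T -> R.

Definition L1 f := P.-integrable setT (EFin \o f).

(** Measurability of [f] is asked separately, because that of its square forgets the sign. *)
Definition L2 f := measurable_fun setT f /\ L1 (fun x => f x ^+ 2).

Lemma L1_measurable f : L1 f -> measurable_fun setT f.
Proof. by move=> /measurable_int/measurable_EFinP. Qed.

Lemma L1_le f g : measurable_fun setT f -> (forall x, `|f x| <= g x) ->
  L1 g -> L1 f.
Proof.
move=> mf fg; apply: le_integrable => //; first exact/measurable_EFinP.
by move=> x _ /=; rewrite lee_fin (le_trans (fg x))// ler_norm.
Qed.

Lemma L1D f g : L1 f -> L1 g -> L1 (fun x => f x + g x).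
Proof. by move=> hf hg; exact: (integrableD measurableT hf hg). Qed.

Lemma L1Z k f : L1 f -> L1 (fun x => k * f x).
Proof. by move=> hf; exact: (integrableZl measurableT k hf). Qed.

Lemma L1B f g : L1 f -> L1 g -> L1 (fun x => f x - g x).
Proof. by move=> hf hg; exact: (integrableB measurableT hf hg). Qed.

Lemma L1_cst k : L1 (fun=> k).
Proof. exact: finite_measure_integrable_cst. Qed.

Lemma L1_abs f : L1 f -> L1 (fun x => `|f x|).
Proof. by move=> hf; exact: (integrable_norm hf). Qed.

Lemma L1_sum (I : Type) (s : seq I) (Q : pred I) (f : I -> T -> R) :
  (forall i, Q i -> L1 (f i)) -> L1 (fun x => \sum_(i <- s | Q i) f i x).
Proof.
move=> hf; elim: s => [|i s IH].
  rewrite (_ : (fun x => _) = cst 0); first exact: L1_cst.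
  by apply/funext => x; rewrite big_nil.
have [Qi|Qi] := boolP (Q i); last first.
  by congr (L1 _): IH; apply/funext => x; rewrite big_cons (negPf Qi).
rewrite (_ : (fun x => _) = fun x => f i x + \sum_(j <- s | Q j) f j x).
  by apply: L1D => //; exact: hf.
by apply/funext => x; rewrite big_cons Qi.
Qed.

Lemma Rintegral_sum (I : Type) (s : seq I) (Q : pred I) (f : I -> T -> R) :
  (forall i, Q i -> L1 (f i)) ->
  \int[P]_x (\sum_(i <- s | Q i) f i x) = \sum_(i <- s | Q i) \int[P]_x f i x.
Proof.
move=> hf; elim: s => [|i s IH].
  by rewrite big_nil; under eq_Rintegral do rewrite big_nil; rewrite Rintegral_cst// mul0r.
rewrite big_cons; under eq_Rintegral do rewrite big_cons.
case: ifPn => // Qi; rewrite RintegralD ?IH//; [exact: hf|exact: L1_sum].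
Qed.

Lemma Rintegral_prob_cst (k : R) : \int[P]_x k = k.
Proof. by rewrite Rintegral_cst//=; rewrite probability_setT mulr1. Qed.

Lemma L2_le f g : measurable_fun setT f -> (forall x, `|f x| <= `|g x|) ->
  L2 g -> L2 f.
Proof.
move=> mf fg [mg ig]; split => //; apply: L1_le ig; first exact: measurable_funX.
by move=> x; rewrite normrX -[leRHS]real_normK ?num_real// ler_sqr ?nnegrE.
Qed.

Lemma L2_cst k : L2 (fun=> k).
Proof. by split; [exact: measurable_cst|exact: L1_cst]. Qed.

Lemma L2M f g : L2 f -> L2 g -> L1 (fun x => f x * g x).
Proof.
move=> [mf hf] [mg hg].
apply: (@L1_le _ (fun x => f x ^+ 2 + g x ^+ 2)); last exact: L1D.
  exact: measurable_funM.
move=> x; rewrite normrM -[f x ^+ 2]real_normK ?num_real//.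
rewrite -[g x ^+ 2]real_normK ?num_real//.
have := sqr_ge0 (`|f x| - `|g x|); have := normr_ge0 (f x); have := normr_ge0 (g x).
nra.
Qed.

Lemma L2_L1 f : L2 f -> L1 f.
Proof. by move=> hf; have := L2M hf (L2_cst 1); under eq_fun do rewrite mulr1. Qed.

Lemma L2D f g : L2 f -> L2 g -> L2 (fun x => f x + g x).
Proof.
move=> hf hg; split; first exact: (measurable_funD hf.1 hg.1).
under eq_fun do rewrite sqrrD.
apply: L1D hg.2; apply: L1D hf.2 _.
have := L1Z 2 (L2M hf hg); congr L1; apply/funext => x; ring.
Qed.

Lemma L2Z k f : L2 f -> L2 (fun x => k * f x).
Proof.
move=> hf; split; first by apply: measurable_funM => //; exact: hf.1.
by under eq_fun do rewrite exprMn; exact: L1Z hf.2.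
Qed.

Lemma L2B f g : L2 f -> L2 g -> L2 (fun x => f x - g x).
Proof. by move=> hf hg; under eq_fun do rewrite -mulN1r; apply: L2D => //; exact: L2Z. Qed.

Lemma L2_abs f : L2 f -> L2 (fun x => `|f x|).
Proof.
move=> hf; apply: (L2_le _ _ hf) => [|x]; last by rewrite normr_id.
by apply: measurableT_comp => //; exact: hf.1.
Qed.

Lemma L2_sum (I : Type) (s : seq I) (Q : pred I) (f : I -> T -> R) :
  (forall i, Q i -> L2 (f i)) -> L2 (fun x => \sum_(i <- s | Q i) f i x).
Proof.
move=> hf; elim: s => [|i s IH].
  rewrite (_ : (fun x => _) = cst 0); first exact: L2_cst.
  by apply/funext => x; rewrite big_nil.
have [Qi|Qi] := boolP (Q i); last first.
  by congr (L2 _): IH; apply/funext => x; rewrite big_cons (negPf Qi).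
rewrite (_ : (fun x => _) = fun x => f i x + \sum_(j <- s | Q j) f j x).
  by apply: L2D => //; exact: hf.
by apply/funext => x; rewrite big_cons Qi.
Qed.

Lemma L2_restrict (A : set T) f : measurable A -> L2 f ->
  L2 (fun x => f x * \1_A x).
Proof.
move=> mA hf; apply: (L2_le _ _ hf) => [|x].
  by apply: measurable_funM => //; exact: hf.1.
by rewrite normrM indicE ler_piMr//; case: (x \in A); rewrite ?normr1 ?normr0.
Qed.

Lemma L2_indic (A : set T) : measurable A -> L2 (\1_A).
Proof.
move=> mA; have := L2_restrict mA (L2_cst 1).
by congr L2; apply/funext => x; rewrite mul1r.
Qed.

End square_integrable.

Section independence.
Context d (Omega : measurableType d) (R : realType) (P : probability Omega R).
Variable X : nat -> {RV P >-> R}.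
Hypothesis hX : mutually_independent X.

(** A pi-system that generates the sigma-algebra of the [X j] with [j \in J]. *)
Definition cylinders (J : seq nat) : set (set Omega) :=
  [set C | exists2 A : nat -> set R, forall k, measurable (A k) &
     C = \bigcap_(k in [set` J]) (X k @^-1` A k)].

Lemma measurable_RV i (B : set R) : measurable B -> measurable (X i @^-1` B).
Proof. by move=> mB; rewrite -[_ @^-1` _]setTI; exact: measurable_funP. Qed.

Lemma cylinders_measurable J : cylinders J `<=` measurable.
Proof.
move=> _ [A mA ->]; apply: fin_bigcap_measurable => // k _.
exact: measurable_RV.
Qed.

Lemma sigma_cylinders_measurable J : <<s cylinders J >> `<=` measurable.
Proof.
apply: smallest_sub; [exact: sigma_algebra_measurable|exact: cylinders_measurable].
Qed.

Lemma setI_closed_cylinders J : setI_closed (cylinders J).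
Proof.
move=> _ _ [A mA ->] [B mB ->]; exists (fun k => A k `&` B k).
  by move=> k; exact: measurableI.
apply/seteqP; split=> [w [hA hB] k kJ|w h]; first by split; [exact: hA|exact: hB].
by split=> k kJ; case: (h k kJ).
Qed.

Lemma cylinders_setT J : cylinders J setT.
Proof. by exists (fun=> setT) => //; apply/seteqP; split. Qed.

Lemma cylinders_preimage J j (A : set R) : j \in J -> measurable A ->
  cylinders J (X j @^-1` A).
Proof.
move=> jJ mA; exists (fun k => if k == j then A else setT).
  by move=> k; case: ifP.
apply/seteqP; split=> [w Aw k kJ /=|w h].
  by case: eqP => // ->.
by have := h j jJ; rewrite /= eqxx.
Qed.

(** Uniqueness of finite measures on a pi-system: as functions of [C] both sides are finite
    measures, and on cylinders they agree by independence of the family [i :: J]. *)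
Lemma indep_sigma_cylinders J i (B : set R) (C : set Omega) :
    uniq J -> i \notin J -> measurable B -> <<s cylinders J >> C ->
  P (C `&` X i @^-1` B) = (P C * P (X i @^-1` B))%E.
Proof.
move=> uJ iJ mB sC.
have mXB := measurable_RV i mB.
have r0 : 0 <= fine (P (X i @^-1` B)) by exact: fine_ge0.
pose m1 := mrestr P mXB; pose m2 := mscale (NngNum r0) P.
have E2 D : m2 D = (P D * P (X i @^-1` B))%E.
  by rewrite /m2 /mscale/= fineK ?fin_num_measure// muleC.
rewrite -E2.
apply: (g_sigma_algebra_measure_unique (cylinders J) (@cylinders_measurable J)
  (fun=> setT) (fun=> cylinders_setT J) _ m1 m2
  (@setI_closed_cylinders J)) => //.
- by rewrite bigcup_const.
- move=> _ [A mA ->]; apply: etrans (esym (E2 _)); rewrite /m1/= /mrestr.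
  (* One family of target sets for [i :: J]; [i \notin J] prevents a clash. *)
  pose A' k := if k == i then B else A k.
  have A'J k : k \in J -> A' k = A k.
    by rewrite /A'; case: eqP => // ->; rewrite (negPf iJ).
  have mA' k : measurable (A' k) by rewrite /A'; case: ifP.
  have := @hX (i :: J) A'; rewrite /= iJ uJ => /(_ isT mA').
  rewrite big_cons {2}/A' eqxx => E.
  transitivity (P (\bigcap_(k in [set` i :: J]) X k @^-1` A' k)).
    congr (P _); apply/seteqP; split=> [w [hA hB] k|w h].
      rewrite /= inE => /orP[/eqP ->|kJ]; first by rewrite /A' eqxx.
      by rewrite A'J//; exact: hA.
    split=> [k kJ|]; first by have := h k; rewrite /= inE kJ orbT A'J//; exact.
    by have := h i; rewrite /= inE eqxx /A' eqxx; exact.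
  rewrite E muleC; congr (_ * _)%E.
  have := @hX J A' uJ mA' => E'; transitivity (\prod_(k <- J) P (X k @^-1` A' k))%E => //.
  rewrite -E'; congr (P _); apply: eq_bigcapr => k kJ.
  by rewrite A'J.
- move=> k; rewrite /m1/= /mrestr setTI (le_lt_trans (probability_le1 _ _))//.
  exact: ltry.
Qed.

(** [U] may be any functional of the [X j], [j \in J], such as a running maximum. Omega with the
    coarser sigma-algebra is paired with [X i]; the joint law is a product, and Fubini applies. *)
Lemma indep_Rintegral J i (U : Omega -> R) (V : R -> R) :
    uniq J -> i \notin J ->
    measurable_fun setT (U : g_sigma_algebraType (cylinders J) -> R) ->
    measurable_fun setT V ->
    L1 P U -> L1 P (V \o X i) -> L1 P (fun w => U w * V (X i w)) ->
  \int[P]_w (U w * V (X i w)) = \int[P]_w U w * \int[P]_w V (X i w).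
Proof.
move=> uJ iJ mU mV iU iV iUV.
pose OG := g_sigma_algebraType (cylinders J).
have mY : measurable_fun setT (fun w : Omega => w : OG).
  by move=> _ A sA; rewrite setTI preimage_id; exact: sigma_cylinders_measurable sA.
have mZ : measurable_fun setT (fun w : Omega => (w : OG, X i w)).
  by apply/measurable_fun_pairP; split.
pose Y : {mfun Omega >-> OG} := mfun_Sub (mem_set mY).
pose Z : {mfun Omega >-> (OG * R)%type} := mfun_Sub (mem_set mZ).
pose l1 := distribution P (Y : {RV P >-> OG}).
pose l2 := distribution P (X i).
pose l := distribution P (Z : {RV P >-> (OG * R)%type}).
have lE S : measurable S -> (l1 \x l2)%E S = l S.
  apply: product_measure_unique => A B mA mB.
  exact: (indep_sigma_cylinders uJ iJ mB mA).
pose f (z : OG * R) := (U z.1 * V z.2)%:E.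
have mf : measurable_fun setT f.
  apply/measurable_EFinP; apply: measurable_funM.
    exact: (measurableT_comp mU measurable_fst).
  exact: (measurableT_comp mV measurable_snd).
have if1 : l.-integrable setT f.
  by apply: integrable_pushforward.
have if2 : (l1 \x l2)%E.-integrable setT f.
  apply/integrableP; split => //; move/integrableP: if1 => [_ lty].
  rewrite (eq_measure_integral l)// => S mS _; exact: lE.
have : (\int[P]_w (U w * V (X i w))%:E = \int[P]_w (U w)%:E * \int[P]_w (V (X i w))%:E)%E.
  transitivity (\int[l]_z f z)%E; first by rewrite integral_pushforward.
  transitivity (\int[l1 \x l2]_z f z)%E.
    by apply: eq_measure_integral => S mS _; exact/esym/lE.
  rewrite -integral12_prod_meas1// /fubini_F /f/=.
  have iV2 : l2.-integrable setT (EFin \o V).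
    by apply: integrable_pushforward => //; exact/measurable_EFinP.
  have -> : (\int[P]_w (V (X i w))%:E = \int[l2]_y (V y)%:E)%E.
    by rewrite integral_pushforward//; exact/measurable_EFinP.
  have -> : (\int[P]_w (U w)%:E = \int[l1]_x (U x)%:E)%E.
    by rewrite (@integral_pushforward _ _ _ _ _ Y)//; exact/measurable_EFinP.
  have iU1 : l1.-integrable setT (EFin \o U).
    by apply: integrable_pushforward => //; exact/measurable_EFinP.
  under eq_integral => x _.
    under eq_integral do rewrite EFinM.
    rewrite integralZl//=.
    over.
  rewrite -(fineK (integrable_fin_num measurableT iV2)).
  by rewrite integralZr.
rewrite /Rintegral => ->; rewrite fineM//; exact: integrable_fin_num.
Qed.

End independence.

(** * A maximal inequality for empirical processes *)

Section running_maximum.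
Context (R : realType).
Implicit Type S : nat -> R.

(** One-sided, with floor 0, which Doob's inequality needs; two-sided control comes from applying it
    to S and to -S. *)
Fixpoint runmax S k : R := if k is k'.+1 then Num.max (runmax S k') (S k) else 0.

Lemma runmax_ge0 S k : 0 <= runmax S k.
Proof. by elim: k => //= k IH; rewrite le_max IH. Qed.

Lemma runmax_ge S j k : (0 < j <= k)%N -> S j <= runmax S k.
Proof.
elim: k => [|k IH] /=; first by case: j.
move=> /andP[j0]; rewrite leq_eqVlt => /orP[/eqP ->|]; rewrite le_max ?lexx ?orbT//.
by rewrite ltnS => jk; rewrite IH// j0.
Qed.

Lemma eq_runmax S S' k : (forall j, (j <= k)%N -> S j = S' j) ->
  runmax S k = runmax S' k.
Proof.
elim: k => //= k IH SS'; rewrite SS'// IH// => j jk.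
by apply: SS'; exact: leqW.
Qed.

(* Pathwise form of Doob's L2 inequality: the sum on the right has zero mean
   when S is a martingale. *)
Lemma runmax_sqr S N : S 0%N = 0 ->
  runmax S N ^+ 2 <=
    4 * S N ^+ 2 - 4 * \sum_(k < N) runmax S k * (S k.+1 - S k).
Proof.
move=> S0.
(* While the maximum is not exceeded both sides stay put; when it is, the right-hand side gains an
   additional square. *)
have H : runmax S N ^+ 2 <= 2 * runmax S N * S N
    - 2 * \sum_(k < N) runmax S k * (S k.+1 - S k).
  elim: N => [|N IH]; first by rewrite big_ord0 S0 /= mulr0 expr0n/= mulr0 subr0.
  rewrite big_ord_recr/=; set s := \sum_(_ < _) _ in IH *.
  have [le|lt] := leP (runmax S N) (S N.+1).
    by have := sqr_ge0 (S N.+1 - runmax S N); nra.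
  by nra.
(* 2 m S <= m^2 / 2 + 2 S^2 absorbs half of the left-hand side, whence the constant 4. *)
have := sqr_ge0 (runmax S N - 2 * S N).
set s := \sum_(_ < _) _ in H *; nra.
Qed.

End running_maximum.

(** * Second moments of sums of independent, identically distributed terms *)

Section iid.
Context d (Omega : measurableType d) (R : realType) (P : probability Omega R).
Variable X : nat -> {RV P >-> R}.
Hypothesis hX : mutually_independent X.
Variable mu : probability R R.
Hypothesis hlaw : forall i (A : set R), measurable A -> P (X i @^-1` A) = mu A.
Implicit Types h : R -> R.

Lemma ge0_integral_law i (f : R -> \bar R) : measurable_fun setT f ->
  (forall x, (0 <= f x)%E) -> (\int[P]_w f (X i w) = \int[mu]_x f x)%E.
Proof.
move=> mf f0; rewrite -(@ge0_integral_distribution _ _ _ _ _ P (X i))//.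
by apply: eq_measure_integral => A mA _; exact: hlaw.
Qed.

Lemma L1_law i h : L1 mu h -> L1 P (h \o X i).
Proof.
move=> ih; have mh := L1_measurable ih.
apply/integrableP; split; first by apply/measurable_EFinP; exact: measurableT_comp.
move/integrableP: ih => [_].
rewrite -(@ge0_integral_law i (fun x => `|(h x)%:E|%E))//.
by apply: measurableT_comp => //; exact/measurable_EFinP.
Qed.

Lemma Rintegral_law i h : L1 mu h -> \int[P]_w h (X i w) = \int[mu]_x h x.
Proof.
move=> ih; have mh := L1_measurable ih; congr fine.
transitivity (\int[distribution P (X i)]_x (h x)%:E)%E.
  rewrite integral_distribution//; first exact/measurable_EFinP.
  exact: L1_law.
by apply: eq_measure_integral => A mA _; exact: hlaw.
Qed.

Lemma L2_law i h : L2 mu h -> L2 P (h \o X i).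
Proof. by move=> [mh ih]; split; [exact: measurableT_comp|exact: L1_law ih]. Qed.

Lemma measurable_cylinder_comp (J : seq nat) j h : j \in J ->
  measurable_fun setT h ->
  measurable_fun setT (h \o X j : g_sigma_algebraType (cylinders X J) -> R).
Proof.
move=> jJ mh; apply: measurableT_comp => // _ A mA.
by rewrite setTI; apply: sub_sigma_algebra; exact: cylinders_preimage.
Qed.

Lemma Rintegral_indep_mean0 (J : seq nat) i (U : Omega -> R) h :
    uniq J -> i \notin J ->
    measurable_fun setT (U : g_sigma_algebraType (cylinders X J) -> R) ->
    L2 P U -> L2 mu h -> \int[mu]_x h x = 0 ->
  \int[P]_w (U w * h (X i w)) = 0.
Proof.
move=> uJ iJ mU lU lh h0; have lhX := L2_law i lh.
rewrite (indep_Rintegral hX uJ iJ)//; last exact: L2M.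
- by rewrite Rintegral_law ?h0 ?mulr0//; exact: L2_L1.
- exact: lh.1.
- exact: L2_L1.
- exact: L2_L1.
Qed.

Lemma Rintegral_sum_sqr n h : L2 mu h -> \int[mu]_x h x = 0 ->
  \int[P]_w (\sum_(i < n) h (X i w)) ^+ 2 = n%:R * \int[mu]_x h x ^+ 2.
Proof.
move=> lh h0.
have lhX i := L2_law i lh.
under eq_Rintegral => w _ do rewrite expr2 mulr_suml.
rewrite Rintegral_sum; last first.
  move=> i _; apply: L2M; first exact: (lhX i).
  by apply: L2_sum => j _; exact: (lhX j).
rewrite (eq_bigr (fun=> \int[mu]_x h x ^+ 2)); last first.
  move=> i _; under eq_Rintegral => w _ do rewrite mulr_sumr.
  rewrite Rintegral_sum; last by move=> j _; apply: L2M; [exact: (lhX i)|exact: (lhX j)].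
  rewrite (bigD1 i)//= big1 ?addr0 => [|j ji].
    under eq_Rintegral => w _ do rewrite -expr2.
    by rewrite (Rintegral_law i (h := fun x => h x ^+ 2))//; exact: lh.2.
  apply: (@Rintegral_indep_mean0 [:: i : nat]) => //.
    by rewrite inE; apply: contra ji => /eqP ij; apply/eqP/val_inj.
    by apply: measurable_cylinder_comp; [rewrite inE|exact: lh.1].
  exact: (lhX i).
by rewrite sumr_const card_ord mulr_natl.
Qed.

End iid.

Lemma sqr_weighted_sum (R : realType) N (p x : 'I_N -> R) :
  (\sum_i p i * x i) ^+ 2 <= (\sum_i `|p i|) * \sum_i `|p i| * x i ^+ 2.
Proof.
elim: N => [|N IH] in p x *; first by rewrite !big_ord0 expr0n mul0r.
rewrite !big_ord_recr/=; set s := \sum_(_ < _) _; set A := \sum_(_ < _) `|_|.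
set B := \sum_(_ < _) _ * _.
have A0 : 0 <= A by apply: sumr_ge0.
have B0 : 0 <= B by apply: sumr_ge0 => i _; rewrite mulr_ge0// sqr_ge0.
have sAB : s ^+ 2 <= A * B by apply: (IH (p \o widen_ord (leqnSn N)) (x \o widen_ord (leqnSn N))).
move: (p _) (x _) => q y.
(* Compare squares: 4 s^2 y^2 <= 4 A B y^2 <= (A y^2 + B)^2. *)
have H : 2 * (`|s| * `|y|) <= A * y ^+ 2 + B.
  rewrite -ler_sqr ?nnegrE; last 2 first.
  - by rewrite mulr_ge0// mulr_ge0.
  - by rewrite addr_ge0// mulr_ge0// sqr_ge0.
  rewrite !exprMn !real_normK ?num_real//.
  have := sqr_ge0 (A * y ^+ 2 - B).
  have : s ^+ 2 * y ^+ 2 <= A * B * y ^+ 2 by rewrite ler_wpM2r ?sqr_ge0.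
  by nra.
have : `|q| * (2 * (`|s| * `|y|)) <= `|q| * (A * y ^+ 2 + B) by rewrite ler_wpM2l.
have : s * (q * y) <= `|s| * (`|q| * `|y|) by rewrite -!normrM ler_norm.
have : `|q| ^+ 2 = q ^+ 2 by rewrite real_normK ?num_real.
rewrite sqrrD; nra.
Qed.

Lemma sqr_sum (R : realType) N (x : 'I_N -> R) :
  (\sum_i x i) ^+ 2 <= N%:R * \sum_i x i ^+ 2.
Proof.
have := sqr_weighted_sum (fun=> 1) x; rewrite normr1 sumr_const card_ord.
by under eq_bigr do rewrite mul1r; under [X in _ * X]eq_bigr do rewrite mul1r.
Qed.

Lemma measurable_runmax d (T : measurableType d) (R : realType)
    (S : nat -> T -> R) k : (forall j, measurable_fun setT (S j)) ->
  measurable_fun setT (fun w => runmax (S ^~ w) k).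
Proof.
move=> mS; elim: k => /= [|k IH]; first exact: measurable_cst.
exact: measurable_maxr.
Qed.

Lemma measurable_bigmaxr d (T : measurableType d) (R : realType) (I : Type)
    (s : seq I) (f : I -> T -> R) : (forall i, measurable_fun setT (f i)) ->
  measurable_fun setT (fun x => \big[Num.max/0]_(i <- s) f i x).
Proof.
move=> mf; elim: s => [|i s IH].
  by rewrite (_ : (fun _ => _) = cst 0)//; apply/funext => x; rewrite big_nil.
rewrite (_ : (fun _ => _) = fun x => Num.max (f i x) (\big[Num.max/0]_(j <- s) f j x)).
  exact: measurable_maxr.
by apply/funext => x; rewrite big_cons.
Qed.

Lemma L2_max d (T : measurableType d) (R : realType) (P : probability T R)
  (f g : T -> R) : L2 P f -> L2 P g -> L2 P (fun x => Num.max (f x) (g x)).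
Proof.
move=> lf lg; apply: (L2_le _ _ (L2D (L2_abs lf) (L2_abs lg))).
  by apply: measurable_maxr; [exact: lf.1|exact: lg.1].
move=> x; rewrite [leRHS]ger0_norm ?addr_ge0//.
by case: (leP (f x) (g x)) => _; rewrite ?lerDr ?lerDl.
Qed.

Lemma L2_runmax d (T : measurableType d) (R : realType) (P : probability T R)
    (S : nat -> T -> R) k : (forall j, L2 P (S j)) ->
  L2 P (fun w => runmax (S ^~ w) k).
Proof.
by move=> lS; elim: k => /= [|k IH]; [exact: L2_cst|exact: L2_max].
Qed.

Lemma Rintegral_indicT d (T : measurableType d) (R : realType)
    (P : probability T R) (A : set T) : measurable A ->
  \int[P]_x \1_A x = fine (P A).
Proof. by move=> mA; rewrite /Rintegral integral_indic// setIT. Qed.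

(** * A martingale along a decreasing chain of sets *)

Section chain.
Context d (Omega : measurableType d) (R : realType) (P : probability Omega R).
Variable X : nat -> {RV P >-> R}.
Hypothesis hX : mutually_independent X.
Variable mu : probability R R.
Hypothesis hlaw : forall i (A : set R), measurable A -> P (X i @^-1` A) = mu A.
Variables (h : R -> R) (B : nat -> set R) (b : R).
Hypothesis lh : L2 mu h.
Hypothesis mB : forall r, measurable (B r).
Hypothesis B0 : B 0%N = setT.
Hypothesis BS : forall r, B r.+1 `<=` B r.
Hypothesis b0 : 0 < b.
Hypothesis bB : forall r, b <= fine (mu (B r)).

Let shell r := B r `\` B r.+1.
(** Conditional mean of the part of h(X) revealed at time r, given that X is still in [B r]: the
    compensator increment of one observation. *)
Let p r := (\int[mu]_x (h x * \1_(shell r) x)) / fine (mu (B r)).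
(* The innovation at time r of h(X) for the filtration that reveals X as soon
   as X leaves B r. *)
Let inn r x := h x * \1_(shell r) x - p r * \1_(B r) x.
Let D k x := \sum_(r < k) inn r x.
Let a := \int[mu]_x `|h x|.
Let A := a / b.

Let m_shell r : measurable (shell r).
Proof. exact: measurableD. Qed.

Let indic_shell k x :
  (\1_(~` B k) x : R) = \sum_(r < k) \1_(shell r) x.
Proof.
elim: k => [|k IH]; first by rewrite big_ord0 B0 setCT indic0.
rewrite big_ord_recr/= -IH !indicE in_setD !in_setC.
have [/set_mem/BS/mem_set ->//|] := boolP (x \in B k.+1).
  by rewrite addr0.
by case: (x \in B k); rewrite ?addr0 ?add0r.
Qed.

Let a_ge0 : 0 <= a. Proof. exact: Rintegral_ge0. Qed.
Let A_ge0 : 0 <= A. Proof. by rewrite divr_ge0// ltW. Qed.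

Let L1_shell r : L1 mu (fun x => h x * \1_(shell r) x).
Proof. exact/L2_L1/L2_restrict. Qed.

(** The shells are disjoint, so the numerators add up to at most E|h|, and each denominator is at
    least [b]: [A] bounds the total variation of the compensator. *)
Let sum_p k : \sum_(r < k) `|p r| <= A.
Proof.
have L1s r : L1 mu (fun x => `|h x| * \1_(shell r) x).
  by apply/L2_L1/L2_restrict => //; exact: L2_abs.
apply: (@le_trans _ _ (\sum_(r < k) (\int[mu]_x (`|h x| * \1_(shell r) x)) / b)).
  apply: ler_sum => r _.
  have m0 : 0 < fine (mu (B r)) by exact: lt_le_trans b0 (bB r).
  rewrite normrM normfV (gtr0_norm m0).
  apply: ler_pM; rewrite ?invr_ge0 ?lef_pV2 ?posrE ?(ltW m0)//.
  apply: le_trans (le_normr_Rintegral measurableT (L1_shell r)) _.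
  apply: le_Rintegral => //; [exact: L1_abs|exact: L1s|].
  by move=> x _; rewrite normrM [X in _ * X]ger0_norm.
rewrite -mulr_suml /A ler_wpM2r ?invr_ge0 ?(ltW b0)//.
rewrite -Rintegral_sum//. apply: le_Rintegral => //.
- exact: (L1_sum _ (fun (r : 'I_k) _ => L1s r)).
- exact/L2_L1/L2_abs.
- move=> x _; rewrite -mulr_sumr -indic_shell.
  by rewrite ler_piMr// indicE; case: (_ \in _).
Qed.

Let L2_inn r : L2 mu (inn r).
Proof.
apply: L2B; first exact: L2_restrict.
by apply: L2Z; exact: L2_indic.
Qed.

Let inn0 r : \int[mu]_x inn r x = 0.
Proof.
rewrite RintegralB//; [|exact: L1_shell|by apply: L1Z; apply/L2_L1/L2_indic].
rewrite RintegralZl//; last exact/L2_L1/L2_indic.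
rewrite Rintegral_indicT// /p divfK ?subrr//.
by rewrite gt_eqF// (lt_le_trans b0).
Qed.

Let inn_out r x : x \notin B r -> inn r x = 0.
Proof.
move=> /negPf xB; rewrite /inn !indicE in_setD xB/=.
by rewrite !mulr0 subrr.
Qed.

Let B_le j k : (j <= k)%N -> B k `<=` B j.
Proof.
move=> /subnK <-; elim: (k - j)%N => //= i IH.
by rewrite addSn; apply: subset_trans IH; exact: BS.
Qed.

(** As long as [x] is in the chain nothing of [h] is revealed, and the path of [D] is minus the
    compensator, the same for all such [x]. *)
Let D_in k j x : x \in B k -> (j <= k)%N -> D j x = - \sum_(r < j) p r.
Proof.
move=> /set_mem xB jk; rewrite -sumrN; apply: eq_bigr => r _; rewrite /inn !indicE.
have rk : (r < k)%N by exact: leq_trans jk.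
have x1 : x \in B r.+1 by apply/mem_set; exact: (B_le rk).
have x2 : x \in B r by apply/mem_set; exact: (B_le (ltnW rk)).
by rewrite in_setD x1 x2 /= mulr0 mulr1 sub0r.
Qed.

Let L2_D k : L2 mu (D k).
Proof. exact: (L2_sum _ (fun (r : 'I_k) _ => L2_inn r)). Qed.

Let D0 k : \int[mu]_x D k x = 0.
Proof.
rewrite Rintegral_sum => [|r _]; last exact: L2_L1.
by rewrite big1.
Qed.

Let D_abs k x : `|D k x| <= `|h x| + A.
Proof.
rewrite /D /inn sumrB -mulr_sumr -indic_shell (le_trans (ler_normB _ _))//.
apply: lerD.
  by rewrite normrM ler_piMr// indicE; case: (_ \in _); rewrite ?normr1 ?normr0.
apply: le_trans (sum_p k); apply: le_trans (ler_norm_sum _ _ _) _.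
apply: ler_sum => r _; rewrite normrM ler_piMr// indicE.
by case: (_ \in _); rewrite ?normr1 ?normr0.
Qed.

Variable n : nat.
Let S (c : R) k w := c * \sum_(i < n) D k (X i w).

Let L2_S c k : L2 P (S c k).
Proof.
apply: L2Z.
exact: (L2_sum _ (fun (i : 'I_n) _ => L2_law hlaw i (L2_D k))).
Qed.

(** [inn k (X i)] vanishes unless [X i] is still in [B k], and there [D_in] makes the past
    contribution of [X i] to the sums deterministic. Replacing it by that constant leaves a running
    maximum of the other observations alone, so independence does the work of conditional
    expectations. *)
Let runmax_inn c k (i : 'I_n) :
  \int[P]_w (runmax (S c ^~ w) k * inn k (X i w)) = 0.
Proof.
pose U w := runmax (fun j => c * (\sum_(i' < n | i' != i) D j (X i' w) - \sum_(r < j) p r)) k.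
rewrite (_ : \int[P]_w _ = \int[P]_w (U w * inn k (X i w))); last first.
  apply: eq_Rintegral => w _.
  have [Bi|Bi] := boolP (X i w \in B k); last by rewrite inn_out// !mulr0.
  congr (_ * _); apply: eq_runmax => j jk; rewrite /S; congr (_ * _).
  by rewrite (bigD1 i)//= (D_in Bi jk) addrC.
pose J := [seq j <- iota 0 n | j != i :> nat].
have iJ : (i : nat) \notin J by rewrite mem_filter eqxx.
have uJ : uniq J by rewrite filter_uniq// iota_uniq.
apply: (Rintegral_indep_mean0 hX hlaw uJ iJ) => //.
  apply: measurable_runmax => j; apply: measurable_funM => //.
  apply: measurable_funB => //; rewrite [X in measurable_fun _ X](_ : _ =
    fun w => \sum_(i' < n) (if i' != i then D j (X i' w) else 0)); last first.
    by apply/funext => w; exact: big_mkcond.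
  apply: measurable_sum => i'; have [i'i|_] := boolP (i' != i); last exact: measurable_cst.
  apply: (measurable_cylinder_comp _ (L2_D j).1).
  by rewrite mem_filter mem_iota ltn_ord/= andbT.
apply: L2_runmax => j; apply: L2Z; apply: L2B; last exact: L2_cst.
exact: (L2_sum _ (fun (i' : 'I_n) _ => L2_law hlaw i' (L2_D j))).
Qed.

(** The sum in [runmax_sqr] has zero mean by [runmax_inn]. The constant 8 is 4 times the 2 in D^2 <=
    2 (h^2 + A^2). *)
Let E_runmax c k :
  \int[P]_w runmax (S c ^~ w) k ^+ 2 <=
  c ^+ 2 * (n%:R * (8 * (\int[mu]_x h x ^+ 2 + A ^+ 2))).
Proof.
have lm j : L2 P (fun w => runmax (S c ^~ w) j) by exact: L2_runmax.
have L1t (j : 'I_k) : L1 P (fun w => runmax (S c ^~ w) j * (S c j.+1 w - S c j w)).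
  by apply: L2M => //; exact: L2B.
have L1sum : L1 P (fun w => \sum_(j < k) runmax (S c ^~ w) j * (S c j.+1 w - S c j w)).
  exact: (L1_sum _ (fun (j : 'I_k) _ => L1t j)).
apply: (@le_trans _ _ (\int[P]_w (4 * S c k w ^+ 2 - 4 *
    \sum_(j < k) runmax (S c ^~ w) j * (S c j.+1 w - S c j w)))).
  apply: le_Rintegral => //.
  - exact: (lm k).2.
  - by apply: L1B; apply: L1Z => //; exact: (L2_S c k).2.
  - move=> w _; apply: runmax_sqr.
    by rewrite /S big1 ?mulr0// => i _; rewrite /D big_ord0.
rewrite RintegralB//; last 2 first.
- by apply: L1Z; exact: (L2_S c k).2.
- exact: L1Z.
rewrite RintegralZl//; last exact: (L2_S c k).2.
rewrite RintegralZl// Rintegral_sum// [X in _ - 4 * X]big1 => [|j _]; last first.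
  rewrite (_ : \int[P]_w _ =
    \int[P]_w (\sum_(i < n) c * (runmax (S c ^~ w) j * inn j (X i w)))); last first.
    apply: eq_Rintegral => w _; rewrite /S -mulrBr -sumrB mulrCA mulr_sumr mulr_sumr.
    by apply: eq_bigr => i _; rewrite /D big_ord_recr/= [_ + inn _ _]addrC addrK.
  rewrite Rintegral_sum => [|i _]; last first.
    by apply: L1Z; apply: L2M => //; exact: (L2_law hlaw i (L2_inn j)).
  rewrite big1// => i _; rewrite RintegralZl ?runmax_inn ?mulr0//.
  by apply: L2M => //; exact: (L2_law hlaw i (L2_inn j)).
rewrite mulr0 subr0 /S; under eq_Rintegral => w _ do rewrite exprMn.
rewrite RintegralZl//; last first.
  by have := (L2_sum (index_enum _) (fun (i : 'I_n) (_ : true) => L2_law hlaw i (L2_D k))).2.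
rewrite (Rintegral_sum_sqr hX hlaw)//.
rewrite mulrCA ler_wpM2l ?sqr_ge0// mulrCA ler_wpM2l//.
rewrite (_ : 8 = 4 * 2)//; last by rewrite -natrM.
rewrite -[leRHS]mulrA ler_wpM2l//.
have l2h := lh.2; have L1c : L1 mu (fun=> A ^+ 2) by exact: L1_cst.
rewrite -(Rintegral_prob_cst mu (A ^+ 2)) -RintegralD// -RintegralZl//; last exact: L1D.
apply: le_Rintegral => //.
- exact: (L2_D k).2.
- by apply: L1Z; exact: L1D.
- move=> x _; rewrite -[D k x ^+ 2]real_normK ?num_real//.
  have := D_abs k x; rewrite -ler_sqr ?nnegrE ?addr_ge0// => /le_trans; apply.
  rewrite -[h x ^+ 2]real_normK ?num_real//.
  by have := sqr_ge0 (`|h x| - A); nra.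
Qed.

Let Z k w := \sum_(i < n)
  (h (X i w) * \1_(~` B k) (X i w) - \int[mu]_x (h x * \1_(~` B k) x)).
Let C r w := \sum_(i < n) (\1_(B r) (X i w) - fine (mu (B r))).

(** Doob decomposition: [S 1] is the martingale part, and the centred compensator is linear in the
    centred counts [C r], each of second moment at most n. *)
Let Z_split k w : Z k w = S 1 k w + \sum_(r < k) p r * C r w.
Proof.
rewrite /S mul1r; under [X in _ + X]eq_bigr => r _ do rewrite mulr_sumr.
rewrite [X in _ + X]exchange_big -big_split/=; apply: eq_bigr => i _.
rewrite /D -big_split/= indic_shell mulr_sumr.
under eq_Rintegral => x _ do rewrite indic_shell mulr_sumr.
rewrite Rintegral_sum// -sumrB; apply: eq_bigr => r _.
rewrite /inn mulrBr addrA subrK; congr (_ - _).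
by rewrite /p divfK// gt_eqF// (lt_le_trans b0).
Qed.

Let L2_C r : L2 P (C r).
Proof.
apply: (L2_sum _ (fun (i : 'I_n) _ => _)) => i _.
by apply: L2B; [exact: (L2_law hlaw i (L2_indic _ (mB r)))|exact: L2_cst].
Qed.

Let E_C r : \int[P]_w C r w ^+ 2 <= n%:R.
Proof.
have lI : L2 mu (fun x => \1_(B r) x - fine (mu (B r))).
  by apply: L2B; [exact: L2_indic|exact: L2_cst].
rewrite (Rintegral_sum_sqr hX hlaw n lI); last first.
  rewrite RintegralB//; [|exact/L2_L1/L2_indic|exact: L1_cst].
  by rewrite Rintegral_indicT// Rintegral_prob_cst subrr.
rewrite -[leRHS]mulr1 ler_wpM2l// -[leRHS](Rintegral_prob_cst mu).
apply: le_Rintegral => //; [exact: lI.2|exact: L1_cst|].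
move=> x _; have m0 : 0 <= fine (mu (B r)) by exact: fine_ge0.
have m1 : fine (mu (B r)) <= 1.
  by rewrite -lee_fin fineK ?fin_num_measure// probability_le1.
by rewrite indicE; case: (_ \in _) => /=; nra.
Qed.

(** 32 is 2 (8 + 8): the square of a sum costs 2, and the running maxima of S and of -S cost 8 each.
    The last 2 A^2 comes from [sqr_weighted_sum] with weights [p r]. Nothing depends on the length
    of the chain. *)
Lemma chain_maximal_inequality N :
  (\int[P]_w (\big[Num.max/0]_(k < N.+1) Z k w ^+ 2)%:E <=
   (n%:R * (32 * (\int[mu]_x h x ^+ 2 + A ^+ 2) + 2 * A ^+ 2))%:E)%E.
Proof.
pose F w := 2 * (runmax (S 1 ^~ w) N ^+ 2 + runmax (S (-1) ^~ w) N ^+ 2)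
  + 2 * A * \sum_(r < N) `|p r| * C r w ^+ 2.
have lm c : L1 P (fun w => runmax (S c ^~ w) N ^+ 2).
  by apply: (L2_runmax _ _).2.
have lC (r : 'I_N) : L1 P (fun w => `|p r| * C r w ^+ 2).
  by apply: L1Z; exact: (L2_C r).2.
have lsC : L1 P (fun w => \sum_(r < N) `|p r| * C r w ^+ 2).
  exact: (L1_sum _ (fun (r : 'I_N) _ => lC r)).
have LF : L1 P F by apply: L1D; apply: L1Z => //; exact: L1D.
have ZF k w : (k <= N)%N -> Z k w ^+ 2 <= F w.
  move=> kN; rewrite Z_split; set s := \sum_(_ < _) _.
  have S2 : S 1 k w ^+ 2 <= runmax (S 1 ^~ w) N ^+ 2 + runmax (S (-1) ^~ w) N ^+ 2.
    case: k kN => [_|k kN] in s *.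
      rewrite /S big1 ?mulr0 ?expr0n/= ?addr_ge0 ?sqr_ge0// => i _.
      by rewrite /D big_ord0.
    have h1 : S 1 k.+1 w <= runmax (S 1 ^~ w) N by exact: (@runmax_ge _ (S 1 ^~ w)).
    have h2 : S (-1) k.+1 w <= runmax (S (-1) ^~ w) N by exact: (@runmax_ge _ (S (-1) ^~ w)).
    have h3 := runmax_ge0 (S 1 ^~ w) N; have h4 := runmax_ge0 (S (-1) ^~ w) N.
    have : S (-1) k.+1 w = - S 1 k.+1 w by rewrite /S mulN1r mul1r.
    by case: (leP 0 (S 1 k.+1 w)) => ?; nra.
  have s2 : s ^+ 2 <= A * \sum_(r < N) `|p r| * C r w ^+ 2.
    apply: le_trans (sqr_weighted_sum _ _) _; apply: ler_pM => //.
    - exact: sumr_ge0.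
    - by apply: sumr_ge0 => r _; rewrite mulr_ge0// sqr_ge0.
    - rewrite (big_ord_widen _ (fun r : nat => `|p r| * C r w ^+ 2) kN) big_mkcond/=.
      apply: ler_sum => r _; case: ifP => // _.
      by rewrite mulr_ge0// sqr_ge0.
  rewrite /F; set t := \sum_(_ < N) _ in s2 *.
  by have := sqr_ge0 (S 1 k w - s); nra.
have FZ w : \big[Num.max/0]_(k < N.+1) Z k w ^+ 2 <= F w.
  apply: bigmax_le => [|k _]; last by apply: ZF; rewrite -ltnS.
  by apply: le_trans (ZF 0%N w (leq0n _)); exact: sqr_ge0.
have mZ k : measurable_fun setT (Z k).
  rewrite (_ : Z k = fun w => S 1 k w + \sum_(r < k) p r * C r w); last exact/funext/Z_split.
  apply: measurable_funD; first exact: (L2_S 1 k).1.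
  by apply: measurable_sum => r; apply: measurable_funM => //; exact: (L2_C r).1.
apply: (@le_trans _ _ (\int[P]_w (F w)%:E)%E).
  apply: ge0_le_integral => //.
  - by move=> w _; rewrite lee_fin; exact: bigmax_ge_id.
  - apply/measurable_EFinP; apply: measurable_bigmaxr => k.
    by apply: measurable_funX.
  - by apply/measurable_EFinP; exact: L1_measurable LF.
  - by move=> w _; rewrite lee_fin.
rewrite -[leLHS]fineK; last exact: integrable_fin_num LF.
rewrite lee_fin -/(Rintegral P setT F).
rewrite RintegralD//; last 2 first.
- by apply: L1Z; exact: L1D.
- exact: L1Z.
rewrite !RintegralZl//; last exact: L1D.
rewrite RintegralD//; [|exact: lm|exact: lm].
rewrite (Rintegral_sum _ (fun (r : 'I_N) (_ : true) => lC r)).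
have e1 := E_runmax 1 N; have e2 := E_runmax (-1) N.
have e3 : \sum_(r < N) \int[P]_w (`|p r| * C r w ^+ 2) <= n%:R * A.
  apply: (@le_trans _ _ (\sum_(r < N) `|p r| * n%:R)).
    apply: ler_sum => r _; rewrite RintegralZl; [|by []|exact: (L2_C r).2].
    by rewrite ler_wpM2l.
  by rewrite -mulr_suml mulrC ler_wpM2l.
rewrite sqrrN expr1n !mul1r in e1 e2.
have : 2 * A * (\sum_(r < N) \int[P]_w (`|p r| * C r w ^+ 2)) <= 2 * A * (n%:R * A).
  by rewrite ler_wpM2l// mulr_ge0.
by rewrite mulrDr; nra.
Qed.

End chain.

(** * From chains to countable families of rays *)

Section rays.
Context d (Omega : measurableType d) (R : realType) (P : probability Omega R).
Variable X : nat -> {RV P >-> R}.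
Hypothesis hX : mutually_independent X.
Variable mu : probability R R.
Hypothesis hlaw : forall i (A : set R), measurable A -> P (X i @^-1` A) = mu A.
Variables (h sigma : R -> R) (c b : R).
Hypothesis lh : L2 mu h.
Hypothesis msigma : measurable_fun setT sigma.
Hypothesis b0 : 0 < b.
Hypothesis bc : b <= fine (mu [set x | c <= sigma x]).

Definition dev (f : R -> R) (n : nat) (w : Omega) : R :=
  \sum_(i < n) (f (X i w) - \int[mu]_x f x).

(** [sigma] is the identity for rays to the left and the opposite for rays to the right, so that one
    argument serves both sides of the mode. *)
Definition ray t : set R := [set x | sigma x <= t].

Definition ray_const : R :=
  let A := (\int[mu]_x `|h x|) / b in
  32 * (\int[mu]_x h x ^+ 2 + A ^+ 2) + 2 * A ^+ 2.

Lemma measurable_ray t : measurable (ray t).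
Proof.
rewrite (_ : ray t = sigma @^-1` `]-oo, t]); last first.
  by apply/seteqP; split=> x /=; rewrite in_itv.
by rewrite -[_ @^-1` _]setTI; exact: msigma.
Qed.

Lemma measurable_dev f n : measurable_fun setT f -> measurable_fun setT (dev f n).
Proof.
move=> mf; apply: measurable_sum => i; apply: measurable_funB => //.
exact: measurableT_comp.
Qed.

Let hray t x := h x * \1_(ray t) x.

Let measurable_hray t : measurable_fun setT (hray t).
Proof. by case: (L2_restrict (measurable_ray t) lh). Qed.

(** The default [last 0 l] continues the list as a constant, so that a chain indexed by all of [nat]
    remains nested. *)
Let nth_sorted_le (l : seq R) r : sorted <=%O l ->
  nth (last 0 l) l r <= nth (last 0 l) l r.+1.
Proof.
move=> sl; have [lr|rl] := leqP (size l) r.+1; last first.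
  by apply: (sorted_leq_nth le_trans le_refl) => //; rewrite inE// ltnW.
rewrite [leRHS]nth_default//; have [rl|lr'] := leqP (size l) r.
  by rewrite nth_default.
have -> : r = (size l).-1 by rewrite (_ : size l = r.+1)//; apply/eqP; rewrite eqn_leq lr.
by rewrite nth_last; case: l sl lr lr'.
Qed.

Lemma finite_ray_maximal (l : seq R) n : (forall t, t \in l -> t < c) ->
  (\int[P]_w (\big[Num.max/0]_(t <- l) dev (hray t) n w ^+ 2)%:E <=
   (n%:R * ray_const)%:E)%E.
Proof.
move=> lc; pose l' := sort <=%O l.
have sl' : sorted <=%O l' by exact: (sort_sorted le_total).
have l'c t : t \in l' -> t < c by rewrite mem_sort; exact: lc.
(* The empty list is treated apart: its default threshold 0 need not be below [c]. *)
case: (posnP (size l')) => [/size0nil l'0|l'0].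
  have l0 : l = [::] by apply/nilP; rewrite /nilp -(size_sort <=%O) -/l' l'0.
  rewrite (eq_integral (fun=> 0%E)); last by move=> w _; rewrite l0 big_nil.
  rewrite integral0 lee_fin mulr_ge0// /ray_const.
  by rewrite addr_ge0// mulr_ge0// ?addr_ge0// ?sqr_ge0// Rintegral_ge0// => x _; exact: sqr_ge0.
pose q := nth (last 0 l') l'.
have qc r : q r < c.
  apply: l'c; have [h1|h1] := ltnP r (size l'); first exact: mem_nth.
  by rewrite /q nth_default//; case: (l') l'0 => //= x s _; exact: mem_last.
(* The chain inequality concerns complements of the [B k], so the rays are those complements.
   Thresholds below [c] leave the set where c <= sigma x inside every [B r], which gives the mass
   [b]. *)
pose B r := if r is r'.+1 then ~` ray (q r') else setT.
have mB r : measurable (B r).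
  by case: r => [|r] //=; apply: measurableC; exact: measurable_ray.
have BS r : B r.+1 `<=` B r.
  case: r => [|r] //= x; apply: contra_not => /= /le_trans; apply.
  exact: nth_sorted_le.
have bB r : b <= fine (mu (B r)).
  apply: le_trans bc _; apply: fine_le; rewrite ?fin_num_measure//.
    rewrite (_ : [set x | _] = sigma @^-1` `[c, +oo[); last first.
      by apply/seteqP; split=> x /=; rewrite in_itv/= andbT.
    by rewrite -[_ @^-1` _]setTI; exact: msigma.
  apply: le_measure; rewrite ?inE//.
    rewrite (_ : [set x | _] = sigma @^-1` `[c, +oo[); last first.
      by apply/seteqP; split=> x /=; rewrite in_itv/= andbT.
    by rewrite -[_ @^-1` _]setTI; exact: msigma.
  move=> x /=; case: r => [|r] //= cx; rewrite /ray /=.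
  by apply/negP; rewrite -ltNge (lt_le_trans (qc r)).
apply: le_trans (chain_maximal_inequality hX hlaw lh mB erefl BS b0 bB n (size l')).
apply: ge0_le_integral => //.
- by move=> w _; rewrite lee_fin; exact: bigmax_ge_id.
- apply/measurable_EFinP; apply: measurable_bigmaxr => t.
  by apply: measurable_funX; exact: measurable_dev.
- apply/measurable_EFinP; apply: measurable_bigmaxr => k.
  apply: measurable_funX; apply: measurable_sum => i; apply: measurable_funB => //.
  apply: (@measurableT_comp _ _ _ _ _ _ (fun x => h x * \1_(~` B k) x)) => //.
  by apply: measurable_funM; [exact: lh.1|apply: measurable_indic; exact: measurableC].
move=> w _; rewrite lee_fin -(perm_big _ (permEl (perm_sort <=%O l)))/= -/l'.
rewrite (big_nth (last 0 l')) big_mkord; apply: bigmax_le; first exact: bigmax_ge_id.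
move=> k _.
pose F (j : nat) := (\sum_(i < n) (h (X i w) * \1_(~` B j) (X i w) -
  \int[mu]_x (h x * \1_(~` B j) x))) ^+ 2.
rewrite (_ : dev _ _ _ ^+ 2 = F (lift ord0 k)); last by rewrite /F lift0/= setCK.
exact: (le_bigmax _ (fun j : 'I_(size l').+1 => F j)).
Qed.

(** Monotone convergence from [finite_ray_maximal], whose bound does not depend on the list; the
    limit [D] may a priori be infinite at some points. *)
Lemma ray_maximal (s : nat -> R) n : (forall k, s k < c) ->
  exists D : Omega -> \bar R,
    [/\ measurable_fun setT D, forall w, (0 <= D w)%E,
        forall k w, ((dev (hray (s k)) n w ^+ 2)%:E <= D w)%E &
        (\int[P]_w D w <= (n%:R * ray_const)%:E)%E].
Proof.
move=> sc.
pose G N w := (\big[Num.max/0]_(t <- mkseq s N) dev (hray t) n w ^+ 2)%:E.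
have G0 N w : (0 <= G N w)%E by rewrite lee_fin; exact: bigmax_ge_id.
have mG N : measurable_fun setT (G N).
  apply/measurable_EFinP; apply: measurable_bigmaxr => t.
  by apply: measurable_funX; exact: measurable_dev.
have GS N w : (G N w <= G N.+1 w)%E.
  rewrite lee_fin /mkseq -[N.+1]addn1 iotaD map_cat.
  by apply: sub_bigmax_seq => t; rewrite mem_cat => ->.
have Gnd w : {homo G ^~ w : x y / (x <= y)%N >-> (x <= y)%E}.
  by apply/nondecreasing_seqP => N; exact: GS.
have Gcvg w : cvgn (G ^~ w) by exact: ereal_nondecreasing_is_cvgn.
exists (fun w => limn (G ^~ w)); split.
- rewrite (_ : (fun w => _) = fun w => limn_esup (G ^~ w)).
    exact: measurable_fun_limn_esup.
  by apply/funext => w; rewrite is_cvg_limn_esupE.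
- by move=> w; apply: lime_ge => //; exact: nearW.
- move=> k w; apply: lime_ge => //; near=> N.
  rewrite lee_fin; apply: (@bigmax_sup_seq _ _ _ _ _ (s k)) => //.
  apply/map_f; rewrite mem_iota/= add0n.
  by near: N; exact: nbhs_infty_gt.
- rewrite monotone_convergence//.
  apply: lime_le.
    apply: ereal_nondecreasing_is_cvgn => N N' NN'; apply: ge0_le_integral => //.
    by move=> w _; exact: Gnd.
  apply: nearW => N; apply: finite_ray_maximal => t /mapP[k _ ->].
  exact: sc.
Unshelve. all: by end_near. Qed.

End rays.

(** * Unimodal functions and likelihood ratios *)

Section unimodal.
Context (R : realType).
Variables (c : R) (u : R -> R).
Hypothesis hu : unimodal c u.

Lemma unimodal_le x : u x <= u c.
Proof.
by case: hu => hl hr; have [xc|cx] := leP x c; [exact: hl|apply: hr => //; exact: ltW].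
Qed.

Lemma unimodal_superlevel_interval t : is_interval [set x | t <= u x].
Proof.
case: hu => hl hr x y /= tx ty z /andP[xz zy].
have [zc|cz] := leP z c; first exact: le_trans tx (hl _ _ xz zc).
exact: le_trans ty (hr _ _ (ltW cz) zy).
Qed.

Lemma measurable_unimodal : measurable_fun setT u.
Proof.
apply: (measurability (@RGenCInfty.G R)) => [|/= _ [_] [r] -> <-].
  exact: RGenCInfty.measurableE.
rewrite setTI; apply: is_interval_measurable.
rewrite (_ : _ @^-1` _ = [set x | r <= u x]); first exact: unimodal_superlevel_interval.
by apply/seteqP; split=> x /=; rewrite in_itv/= andbT.
Qed.

Lemma measurable_superlevel t : measurable [set x | t <= u x].
Proof. by apply: is_interval_measurable; exact: unimodal_superlevel_interval. Qed.

End unimodal.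

(** Discrete layer-cake formula: the sum rounds [y] down to a multiple of [e]. *)
Lemma step_approx (R : realType) (e y : R) N : 0 <= e -> 0 <= y -> y <= N%:R * e ->
  0 <= y - \sum_(k < N) e * (k.+1%:R * e <= y)%R%:R <= e.
Proof.
move=> e0 y0 yN.
suff : (N%:R * e <= y -> \sum_(k < N) e * (k.+1%:R * e <= y)%R%:R = N%:R * e) /\
    (y <= N%:R * e -> 0 <= y - \sum_(k < N) e * (k.+1%:R * e <= y)%R%:R <= e).
  by move=> [_]; exact.
elim: N {yN} => [|N [IH1 IH2]].
  rewrite big_ord0 mul0r; split=> // y0'; have -> : y = 0 by apply/le_anti/andP.
  by rewrite subr0 lexx.
have NS : N.+1%:R * e = N%:R * e + e by rewrite -natr1 mulrDl mul1r.
rewrite big_ord_recr /=; set s := \sum_(_ < _) _ in IH1 IH2 *.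
split=> [Ny|yN].
  by rewrite Ny mulr1 IH1 ?NS// (le_trans _ Ny)// NS lerDl.
have [Ny|Ny] := leP (N.+1%:R * e) y.
  have -> : y = N.+1%:R * e by apply/le_anti/andP.
  rewrite mulr1 IH1; last by rewrite NS in Ny; lra.
  by rewrite NS subrr lexx.
rewrite mulr0 addr0; have [yN'|Ny'] := leP y (N%:R * e); first exact: IH2.
by rewrite (IH1 (ltW Ny')); rewrite NS in Ny; lra.
Qed.

(** * From rays to unimodal functions *)

Section deviations.
Context d (Omega : measurableType d) (R : realType) (P : probability Omega R).
Variables (X : nat -> {RV P >-> R}) (mu : probability R R).
Implicit Types f g h sigma : R -> R.
Local Notation dev := (dev X mu).

Lemma devD f g n w : L1 mu f -> L1 mu g ->
  dev (fun x => f x + g x) n w = dev f n w + dev g n w.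
Proof.
move=> lf lg; rewrite /dev -big_split/=; apply: eq_bigr => i _.
by rewrite RintegralD// opprD addrACA.
Qed.

Lemma devZ k f n w : L1 mu f -> dev (fun x => k * f x) n w = k * dev f n w.
Proof.
move=> lf; rewrite /dev mulr_sumr; apply: eq_bigr => i _.
by rewrite RintegralZl// mulrBr.
Qed.

Lemma devB f g n w : L1 mu f -> L1 mu g ->
  dev (fun x => f x - g x) n w = dev f n w - dev g n w.
Proof.
move=> lf lg; rewrite /dev -sumrB; apply: eq_bigr => i _.
by rewrite RintegralB//; ring.
Qed.

Lemma dev_sum (I : Type) (s : seq I) (f : I -> R -> R) n w :
  (forall i, L1 mu (f i)) ->
  dev (fun x => \sum_(i <- s) f i x) n w = \sum_(i <- s) dev (f i) n w.
Proof.
move=> lf; rewrite /dev exchange_big/=; apply: eq_bigr => i _.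
by rewrite Rintegral_sum// sumrB.
Qed.

Lemma dev_le f g n w : L1 mu f -> L1 mu g -> (forall x, `|f x| <= g x) ->
  `|dev f n w| <= \sum_(i < n) (g (X i w) + \int[mu]_x g x).
Proof.
move=> lf lg fg; apply: le_trans (ler_norm_sum _ _ _) _; apply: ler_sum => i _.
apply: le_trans (ler_normB _ _) _; apply: lerD => //.
apply: le_trans (le_normr_Rintegral measurableT lf) _.
by apply: le_Rintegral => //; exact: L1_abs.
Qed.

Lemma dev_cvg (f : nat -> R -> R) g h n w :
    (forall k, measurable_fun setT (f k)) -> L1 mu h ->
    (forall k x, `|f k x| <= h x) -> (forall x, f ^~ x @ \oo --> g x) ->
  (fun k => dev (f k) n w) @ \oo --> dev g n w.
Proof.
move=> mf lh fh fg; apply: cvg_big => [|i _]; first exact: add_continuous.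
apply: cvgB; first exact: fg.
have mg : measurable_fun setT g.
  by apply: (measurable_fun_cvg (h := f)) => // x _; exact: fg.
have lg : L1 mu g.
  apply: (L1_le mg _ lh) => x.
  by apply: (cvgr_to_le (cvg_norm (fg x))); exact: nearW.
apply: fine_cvg; rewrite fineK; last exact: integrable_fin_num lg.
apply: (dominated_cvg measurableT _ _ _ (g := EFin \o h)) => //.
- by move=> k; exact/measurable_EFinP.
- by move=> x _; apply: cvg_EFin; [exact: nearW|exact: fg].
- by move=> k x _; rewrite /= lee_fin.
Qed.

Definition dense_below (s : nat -> R) (c : R) :=
  forall x y, x < y -> y <= c -> exists k, x < s k < y.

(** [Q] is a ray that contains its supremum or not. Thresholds tend to the supremum strictly from
    above in the first case and strictly from below in the second, so membership is eventually exact
    at every point, the supremum included. *)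
Lemma down_set_rays s c (Q : set R) : dense_below s c ->
    (forall x y, x <= y -> Q y -> Q x) -> (forall x, Q x -> x < c) -> Q !=set0 ->
  exists q : nat -> nat, forall x, \forall k \near \oo, (x <= s (q k)) = `[< Q x >].
Proof.
move=> hs Qd Qc Q0.
have Qub : has_ubound Q by exists c => x /Qc/ltW.
have Qle x : Q x -> x <= sup Q by move=> Qx; exact: (ub_le_sup Qub).
have supc : sup Q <= c by apply: ge_sup => // x /Qc/ltW.
have inv0 (k : nat) : 0 < k.+1%:R^-1 :> R by rewrite invr_gt0.
have [Qs|Qs] := pselect (Q (sup Q)).
  (* Here [sup Q] lies in [Q], hence below [c], which leaves room above it. *)
  have H k : exists j, sup Q < s j < Num.min c (sup Q + k.+1%:R^-1).
    by apply: hs; rewrite ?lt_min ?ge_min ?lexx//; rewrite (Qc _ Qs) ltrDl/=.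
  have [q hq] := choice H; exists q => x.
  have [xs|sx] := leP x (sup Q).
    apply: nearW => k; rewrite asboolT; last exact: Qd Qs.
    by apply: le_trans xs _; case/andP: (hq k) => /ltW.
  have := ltr_add_invr sx => -[k0 hk0]; near=> k.
  rewrite asboolF; last by move/Qle; rewrite leNgt sx.
  apply/negbTE; rewrite -ltNge; case/andP: (hq k) => _; rewrite lt_min => /andP[_].
  move/lt_le_trans; apply; apply: le_trans (ltW hk0); rewrite lerD2l lef_pV2 ?posrE//.
  by rewrite ler_nat ltnS; near: k; exact: nbhs_infty_ge.
have H k : exists j, sup Q - k.+1%:R^-1 < s j < sup Q.
  by apply: hs => //; rewrite ltrBlDr ltrDl.
have [q hq] := choice H; exists q => x.
have [sx|xs] := leP (sup Q) x.
  apply: nearW => k; rewrite asboolF; last first.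
    move=> Qx; apply: Qs; rewrite (_ : sup Q = x)//.
    by apply/le_anti; rewrite sx Qle.
  by apply/negbTE; rewrite -ltNge; case/andP: (hq k) => _ /lt_le_trans; apply.
have := ltr_add_invr xs => -[k0 hk0]; near=> k.
rewrite asboolT; last first.
  have e0 : 0 < sup Q - x by rewrite subr_gt0.
  have [y Qy] := sup_adherent e0 (conj Q0 Qub).
  by rewrite opprB addrCA subrr addr0 => /ltW/Qd; apply.
case/andP: (hq k) => /ltW + _; apply: le_trans.
rewrite lerBrDr; apply: le_trans (ltW hk0); rewrite lerD2l lef_pV2 ?posrE//.
by rewrite ler_nat ltnS; near: k; exact: nbhs_infty_ge.
Unshelve. all: by end_near. Qed.

(** A bound on countably many rays extends to all down sets, since deviations pass to dominated
    pointwise limits. *)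
Lemma dev_down_set sigma h s c b n w (Q : set R) :
    measurable_fun setT sigma -> L1 mu h -> dense_below s c -> 0 <= b ->
    (forall k, `|dev (fun x => h x * \1_(ray sigma (s k)) x) n w| <= b) ->
    (forall x y, x <= y -> Q y -> Q x) -> (forall x, Q x -> x < c) ->
  `|dev (fun x => h x * \1_[set x | Q (sigma x)] x) n w| <= b.
Proof.
move=> msigma lh hs b0 hb Qd Qc.
have [Q0|/set0P Q0] := eqVneq Q set0.
  rewrite /dev big1 ?normr0// => i _.
  have -> : [set x | Q (sigma x)] = set0 by rewrite Q0.
  rewrite indic0 mulr0 sub0r; under eq_Rintegral do rewrite mulr0.
  by rewrite Rintegral_prob_cst oppr0.
have [q hq] := down_set_rays hs Qd Qc Q0.
have cv : (fun k => dev (fun x => h x * \1_(ray sigma (s (q k))) x) n w) @ \oo -->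
    dev (fun x => h x * \1_[set x | Q (sigma x)] x) n w.
  apply: (dev_cvg (h := fun x => `|h x|)).
  - move=> k; apply: measurable_funM; first exact: L1_measurable lh.
    by apply: measurable_indic; exact: measurable_ray.
  - exact: L1_abs.
  - by move=> k x; rewrite normrM ler_piMr// indicE; case: (_ \in _); rewrite ?normr1 ?normr0.
  - move=> x; apply: cvg_near_cst; near=> k; congr (_ * _); rewrite !indicE.
    have -> : (x \in ray sigma (s (q k))) = (sigma x <= s (q k)).
      by apply/idP/idP => [/set_mem//|?]; exact/mem_set.
    have -> : (x \in [set x | Q (sigma x)]) = `[< Q (sigma x) >].
      by apply/idP/asboolP => [/set_mem//|?]; exact/mem_set.
    by congr (nat_of_bool _)%:R; near: k; exact: hq.
by apply: (cvgr_to_le (cvg_norm cv)); apply: nearW => k; exact: hb.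
Unshelve. all: by end_near. Qed.

(** The 3 counts the pieces of a superlevel set: the whole line, minus a piece on the left of [c],
    minus one on the right. Summing over levels in [0, K] contributes [K]. *)
Lemma dev_unimodal h u (c K b : R) sl sr n w :
    L1 mu h -> unimodal c u -> (forall x, 0 <= u x <= K) ->
    dense_below sl c -> dense_below sr (- c) ->
    `|dev h n w| <= b ->
    (forall k, `|dev (fun x => h x * \1_(ray id (sl k)) x) n w| <= b) ->
    (forall k, `|dev (fun x => h x * \1_(ray -%R (sr k)) x) n w| <= b) ->
  `|dev (fun x => h x * u x) n w| <= 3 * K * b.
Proof.
move=> lh hu uK hsl hsr h0 hl hr.
have b0 : 0 <= b by exact: le_trans h0.
have K0 : 0 <= K by case/andP: (uK c) => /le_trans; apply.
have mh := L1_measurable lh.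
have L1i (A : set R) : measurable A -> L1 mu (fun x => h x * \1_A x).
  move=> mA; apply: (L1_le _ _ (L1_abs lh)).
    by apply: measurable_funM => //; exact: measurable_indic.
  by move=> x; rewrite normrM ler_piMr// indicE; case: (_ \in _); rewrite ?normr1 ?normr0.
have devS t : `|dev (fun x => h x * \1_[set x | t <= u x] x) n w| <= 3 * b.
  have [tc|ct] := leP t (u c); last first.
    have -> : [set x | t <= u x] = set0.
      rewrite -subset0 => x /= tx; have := lt_le_trans ct tx.
      by rewrite ltNge (unimodal_le hu).
    rewrite /dev big1 ?normr0 ?mulr_ge0// => i _.
    rewrite indic0 mulr0 sub0r; under eq_Rintegral do rewrite mulr0.
    by rewrite Rintegral_prob_cst oppr0.
  (* Both pieces omit [c], which belongs to the superlevel set as t <= u c; so the down sets stay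
     strictly below the mode, as [dev_down_set] asks. *)
  pose A := [set x | x < c /\ u x < t]; pose B := [set x | c < x /\ u x < t].
  have mS : measurable [set x | u x < t].
    rewrite (_ : [set x | _] = ~` [set x | t <= u x]).
      by apply: measurableC; exact: measurable_superlevel hu _.
    by apply/seteqP; split=> x /=; [rewrite ltNge => /negP|move=> /negP; rewrite -ltNge].
  have mA : measurable A.
    apply: (measurableI [set x | x < c] [set x | u x < t]) => //.
    by rewrite -set_itvNyo; exact: measurable_itv.
  have mB : measurable B.
    apply: (measurableI [set x | c < x] [set x | u x < t]) => //.
    by rewrite -set_itvoy; exact: measurable_itv.
  rewrite (_ : (fun x => _) = fun x => h x - h x * \1_A x - h x * \1_B x); last first.
    apply/funext => x; rewrite -{2}[h x]mulr1 -!mulrBr; congr (_ * _); rewrite !indicE.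
    have [xc|cx|xc] := ltgtP x c.
    - have -> : (x \in B) = false by apply/negbTE/negP => /set_mem[]; rewrite ltNge (ltW xc).
      rewrite subr0; have [tx|xt] := leP t (u x).
        rewrite (mem_set (tx : [set x | t <= u x] x)).
        have -> : (x \in A) = false by apply/negbTE/negP => /set_mem[_]; rewrite ltNge tx.
        by rewrite subr0.
      rewrite (mem_set (conj xc xt : A x)) subrr.
      by have -> : (x \in [set x | t <= u x]) = false
        by apply/negbTE/negP => /set_mem/=; rewrite leNgt xt.
    - have -> : (x \in A) = false by apply/negbTE/negP => /set_mem[]; rewrite ltNge (ltW cx).
      rewrite subr0; have [tx|xt] := leP t (u x).
        rewrite (mem_set (tx : [set x | t <= u x] x)).
        have -> : (x \in B) = false by apply/negbTE/negP => /set_mem[_]; rewrite ltNge tx.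
        by rewrite subr0.
      rewrite (mem_set (conj cx xt : B x)) subrr.
      by have -> : (x \in [set x | t <= u x]) = false
        by apply/negbTE/negP => /set_mem/=; rewrite leNgt xt.
    - rewrite xc; have -> : (c \in A) = false by apply/negbTE/negP => /set_mem[]; rewrite ltxx.
      have -> : (c \in B) = false by apply/negbTE/negP => /set_mem[]; rewrite ltxx.
      by rewrite (mem_set (tc : [set x | t <= u x] c)) !subr0.
  rewrite devB; [|exact: L1B lh (L1i _ mA)|exact: L1i].
  rewrite devB//; last exact: L1i.
  have hA : `|dev (fun x => h x * \1_A x) n w| <= b.
    apply: (@dev_down_set id h sl c b n w [set x | x < c /\ u x < t]) => //.
      move=> x y xy [yc yt]; split; first exact: le_lt_trans yc.
      by apply: le_lt_trans yt; apply: hu.1 => //; exact: ltW.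
    by move=> x [].
  have hB : `|dev (fun x => h x * \1_B x) n w| <= b.
    (* Reflection turns the right piece into a down set below -c. *)
    rewrite (_ : B = [set x | [set y | y < - c /\ u (- y) < t] (- x)]); last first.
      by apply/seteqP; split=> x /=; rewrite ltrN2 opprK.
    apply: (@dev_down_set -%R h sr (- c) b n w) => //.
      move=> x y xy [/= yc yt]; split; first exact: le_lt_trans yc.
      apply: le_lt_trans yt; apply: hu.2; rewrite ?lerN2//.
      by rewrite lerNr ltW.
    by move=> x [].
  apply: le_trans (ler_normB _ _) _.
  by have := ler_normB (dev h n w) (dev (fun x => h x * \1_A x) n w); lra.
have mu' := measurable_unimodal hu.
have L1u : L1 mu (fun x => h x * u x).
  apply: (L1_le _ _ (L1Z K (L1_abs lh))); first exact: measurable_funM.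
  move=> x; rewrite normrM mulrC ler_wpM2r//.
  by case/andP: (uK x) => ? ?; rewrite ger0_norm.
apply/ler_addgt0Pr => e e0.
pose T := \sum_(i < n) (`|h (X i w)| + \int[mu]_x `|h x|).
have T0 : 0 <= T.
  by apply: sumr_ge0 => i _; rewrite addr_ge0// Rintegral_ge0.
(* The number of levels may depend on the sample: rounding [u] down costs at most K T / N. *)
pose N := (Num.truncn (K * T / e)).+1.
have N0 : 0 < N%:R :> R by rewrite ltr0n.
have NKT : K * T / N%:R <= e.
  rewrite ler_pdivrMr// -ler_pdivrMl// [e^-1 * _]mulrC.
  exact/ltW/(truncnS_gt (K * T / e)).
pose v x := \sum_(k < N) (K / N%:R) * (k.+1%:R * (K / N%:R) <= u x)%R%:R.
have KN0 : 0 <= K / N%:R by rewrite divr_ge0// ltW.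
have vu x : 0 <= u x - v x <= K / N%:R.
  case/andP: (uK x) => ux0 uxK; apply: step_approx => //.
  by rewrite mulrC divfK// gt_eqF.
have hvE : (fun x => h x * v x) = fun x => \sum_(k < N) (K / N%:R) *
    (h x * \1_[set x | k.+1%:R * (K / N%:R) <= u x] x).
  apply/funext => x; rewrite mulr_sumr; apply: eq_bigr => k _; rewrite mulrCA indicE.
  congr (_ * (_ * _%:R)); congr nat_of_bool.
  by apply/idP/idP => [?|/set_mem//]; exact/mem_set.
have L1k t : L1 mu (fun x => h x * \1_[set x | t <= u x] x).
  by apply: L1i; exact: measurable_superlevel hu _.
have L1v : L1 mu (fun x => h x * v x).
  by rewrite hvE; apply: L1_sum => k _; apply: L1Z.
have -> : (fun x => h x * u x) = fun x => h x * v x + h x * (u x - v x).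
  by apply/funext => x; rewrite -mulrDr addrC subrK.
have L1uv : L1 mu (fun x => h x * (u x - v x)).
  by have := L1B L1u L1v; congr (L1 _ _); apply/funext => x; rewrite mulrBr.
rewrite devD//; apply: le_trans (ler_normD _ _) _; apply: lerD.
  rewrite hvE dev_sum; last by move=> k; apply: L1Z.
  apply: le_trans (ler_norm_sum _ _ _) _.
  apply: (@le_trans _ _ (\sum_(k < N) (K / N%:R * (3 * b)))).
    apply: ler_sum => k _; rewrite devZ// normrM ger0_norm// ler_wpM2l//.
  rewrite sumr_const card_ord -[leLHS]mulr_natl mulrA [N%:R * _]mulrC divfK ?gt_eqF//.
  by rewrite mulrA [K * 3]mulrC.
apply: le_trans (dev_le n w L1uv (L1Z (K / N%:R) (L1_abs lh)) _) _.
  move=> x; rewrite normrM mulrC ler_wpM2r//.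
  by case/andP: (vu x) => ? ?; rewrite ger0_norm.
apply: le_trans NKT; rewrite mulrAC mulr_sumr le_eqVlt; apply/orP; left; apply/eqP.
apply: eq_bigr => i _; rewrite RintegralZl//; last exact: L1_abs.
by rewrite mulrDr.
Qed.

End deviations.

(** From exp t >= 1 + t and ln q >= 1 - 1/q. With q a ratio of values of g0, 1 - 1/q is the growth
    of 1/g0 relative to its larger value. *)
Lemma powR_ge_onem_inv (R : realType) (p q : R) : 0 <= p -> 1 <= q ->
  1 + p * (1 - q^-1) <= q `^ p.
Proof.
move=> p0 q1; have q0 : 0 < q by exact: lt_le_trans q1.
rewrite /powR gt_eqF//; apply: le_trans (expR_ge1Dx _); rewrite lerD2l.
apply: ler_wpM2l => //.
have : ln (1 + (q^-1 - 1)) <= q^-1 - 1.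
  by apply: le_ln1Dx; rewrite ltrBrDr addNr invr_gt0.
rewrite addrC subrK lnV ?posrE//; lra.
Qed.

(** * Likelihood ratios as differences of unimodal functions *)

Section likelihood_class.
Context (R : realType) (M gamma c : R) (g0 : R -> R).
Hypothesis hM : 0 < M.
Hypothesis hgamma : 0 < gamma < 1.
Hypothesis g0_gt0 : forall x, 0 < g0 x.
Hypothesis hg0 : unimodal c g0.

Let a := (1 - gamma)^-1.
Let p := a - 1.

Let p_gt0 : 0 < p.
Proof.
case/andP: hgamma => ? ?; rewrite subr_gt0 invf_gt1; lra.
Qed.

(** The pointwise bound on the class, equal to M^(1/(1-gamma)) g0^p. *)
Definition envelope x := (M * g0 x) `^ (1 - gamma)^-1 / g0 x.

Lemma envelope_ge0 x : 0 <= envelope x.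
Proof. by rewrite divr_ge0// ?powR_ge0// ltW. Qed.

Let envelope_scale x y : envelope y = envelope x * (g0 y / g0 x) `^ p.
Proof.
have x0 := g0_gt0 x; have y0 := g0_gt0 y; rewrite /envelope -/a.
have q0 : 0 < g0 y / g0 x by rewrite divr_gt0.
have -> : M * g0 y = (M * g0 x) * (g0 y / g0 x) by field; rewrite gt_eqF.
rewrite powRM ?(ltW q0)//; last by rewrite mulr_ge0// ltW.
have -> : (g0 y / g0 x) `^ a = (g0 y / g0 x) * (g0 y / g0 x) `^ p.
  by rewrite mulr_powRB1// ?(ltW q0)// -[a](subrK 1) addr_gt0.
field; by rewrite !gt_eqF.
Qed.

(* A step away from the mode can increase L only through 1/g0, and the envelope
   pays for it: hence L + envelope/p is again unimodal. *)
Let step_bound x y fy : g0 y <= g0 x -> 0 <= fy <= (M * g0 y) `^ a ->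
  fy / g0 y - fy / g0 x <= p^-1 * (envelope x - envelope y).
Proof.
move=> yx /andP[fy0 fyM].
have x0 := g0_gt0 x; have y0 := g0_gt0 y.
have q1 : 1 <= g0 x / g0 y by rewrite ler_pdivlMr// mul1r.
have E0 := envelope_ge0 y.
rewrite (envelope_scale y x) ler_pdivlMl//.
rewrite -[X in _ <= _ - X]mulr1 -[leRHS]mulrBr.
apply: (@le_trans _ _ (envelope y * (p * (1 - (g0 x / g0 y)^-1)))); last first.
  apply: ler_wpM2l => //; have := powR_ge_onem_inv (ltW p_gt0) q1; lra.
rewrite mulrCA ler_wpM2l ?(ltW p_gt0)//.
have -> : fy / g0 y - fy / g0 x = fy / g0 y * (1 - (g0 x / g0 y)^-1).
  by field; rewrite !gt_eqF.
apply: ler_wpM2r.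
  by rewrite subr_ge0 invf_le1// (lt_le_trans _ q1).
by rewrite /envelope ler_wpM2r// invr_ge0 ltW.
Qed.

Lemma envelope_unimodal : unimodal c envelope.
Proof.
have H x y : g0 y <= g0 x -> envelope y <= envelope x.
  (* For the value 0, [step_bound] says that the envelope does not decrease towards the mode. *)
  move=> yx; have := @step_bound x y 0 yx; rewrite lexx powR_ge0 !mul0r subrr => /(_ isT).
  by rewrite pmulr_rge0 ?invr_gt0// subr_ge0.
by split=> x y h1 h2; apply: H; [exact: hg0.1|exact: hg0.2].
Qed.

Lemma likelihood_shift_unimodal L : likelihood_class M gamma c g0 L ->
  unimodal c (fun x => L x + p^-1 * envelope x).
Proof.
move=> [f [fM [fl fr]] <-].
have H x y : g0 y <= g0 x -> f y <= f x ->
    f y / g0 y + p^-1 * envelope y <= f x / g0 x + p^-1 * envelope x.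
  move=> gyx fyx; have := step_bound gyx (fM y); rewrite mulrBr.
  have : f y / g0 x <= f x / g0 x by rewrite ler_wpM2r// invr_ge0 ltW.
  by lra.
by split=> x y h1 h2; apply: H; [exact: hg0.1|exact: fl|exact: hg0.2|exact: fr].
Qed.

Lemma likelihood_bound L x : likelihood_class M gamma c g0 L ->
  0 <= L x <= envelope c.
Proof.
move=> [f [fM _] <-]; case/andP: (fM x) => f0 f1.
rewrite divr_ge0 ?(ltW (g0_gt0 x))//=.
apply: le_trans (unimodal_le envelope_unimodal x).
by rewrite /envelope ler_wpM2r// invr_ge0 ltW.
Qed.

(** The class imposes no measurability, but L is a difference of two unimodal functions, whose
    superlevel sets are intervals. *)
Lemma measurable_likelihood L : likelihood_class M gamma c g0 L ->
  measurable_fun setT L.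
Proof.
move=> LL; have mE := measurable_unimodal envelope_unimodal.
have := measurable_funB (measurable_unimodal (likelihood_shift_unimodal LL))
  (measurable_funM (measurable_cst p^-1) mE).
by congr (measurable_fun _ _); apply/funext => x /=; rewrite addrK.
Qed.

Lemma likelihood_L1 (mu : probability R R) (h L : R -> R) :
  L1 mu h -> likelihood_class M gamma c g0 L -> L1 mu (fun x => h x * L x).
Proof.
move=> lh LL; apply: (L1_le _ _ (L1Z (envelope c) (L1_abs lh))).
  by apply: measurable_funM; [exact: L1_measurable lh|exact: measurable_likelihood].
move=> x; rewrite normrM mulrC ler_wpM2r//.
by case/andP: (likelihood_bound x LL) => ? ?; rewrite ger0_norm.
Qed.

Lemma likelihood_convex (I : finType) (w : I -> R) (L : I -> R -> R) :
    (forall i, 0 <= w i) -> \sum_i w i = 1 ->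
    (forall i, likelihood_class M gamma c g0 (L i)) ->
  likelihood_class M gamma c g0 (fun x => \sum_i w i * L i x).
Proof.
move=> w0 w1 LL.
have /choice[f hf] : forall i, exists f,
  shape_class M gamma c g0 f /\ (fun x => f x / g0 x) = L i.
  by move=> i; case: (LL i) => f h1 h2; exists f.
exists (fun x => \sum_i w i * f i x); last first.
  apply/funext => x; rewrite mulr_suml; apply: eq_bigr => i _.
  by rewrite -(hf i).2 mulrA.
split=> [x|].
  apply/andP; split.
    by apply: sumr_ge0 => i _; rewrite mulr_ge0//; case/andP: ((hf i).1.1 x).
  rewrite (_ : _ `^ _ = \sum_i w i * (M * g0 x) `^ (1 - gamma)^-1).
    apply: ler_sum => i _; apply: ler_wpM2l => //.
    by case/andP: ((hf i).1.1 x).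
  by rewrite -mulr_suml w1 mul1r.
split=> x y h1 h2; apply: ler_sum => i _; apply: ler_wpM2l => //.
  exact: (hf i).1.2.1.
exact: (hf i).1.2.2.
Qed.

Section deviation.
Context d (Omega : measurableType d) (P : probability Omega R).
Variables (X : nat -> {RV P >-> R}) (mu : probability R R).

(** 3 envelope(c) (1 + 1/p) for the shifted function plus 3 envelope(c) / p for the shift. *)
Definition dev_const : R := 3 * envelope c * (1 + 2 * p^-1).

Lemma dev_const_ge0 : 0 <= dev_const.
Proof.
have p1 : 0 <= p^-1 by rewrite invr_ge0 ltW.
by have := envelope_ge0 c; rewrite /dev_const; nra.
Qed.

Lemma dev_likelihood (h L : R -> R) b sl sr n w :
    L1 mu h -> likelihood_class M gamma c g0 L ->
    dense_below sl c -> dense_below sr (- c) ->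
    `|dev X mu h n w| <= b ->
    (forall k, `|dev X mu (fun x => h x * \1_(ray id (sl k)) x) n w| <= b) ->
    (forall k, `|dev X mu (fun x => h x * \1_(ray -%R (sr k)) x) n w| <= b) ->
  `|dev X mu (fun x => h x * L x) n w| <= dev_const * b.
Proof.
move=> lh LL hsl hsr h0 hl hr.
have E0 := envelope_ge0; have EK := unimodal_le envelope_unimodal.
have p1 : 0 <= p^-1 by rewrite invr_ge0 ltW.
pose u x := L x + p^-1 * envelope x.
have d1 : `|dev X mu (fun x => h x * u x) n w| <= 3 * (envelope c * (1 + p^-1)) * b.
  apply: (@dev_unimodal _ _ _ P X mu h u c _ b sl sr) => //.
    exact: likelihood_shift_unimodal.
  move=> x; case/andP: (likelihood_bound x LL) => l0 lK.
  apply/andP; split; first by rewrite addr_ge0// mulr_ge0.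
  by rewrite mulrDr mulr1 lerD// [leRHS]mulrC ler_wpM2l.
have d2 : `|dev X mu (fun x => h x * envelope x) n w| <= 3 * envelope c * b.
  apply: (@dev_unimodal _ _ _ P X mu h _ c _ b sl sr) => //.
    exact: envelope_unimodal.
  by move=> x; rewrite E0 EK.
have lE : L1 mu (fun x => h x * envelope x).
  apply: (L1_le _ _ (L1Z (envelope c) (L1_abs lh))).
    apply: measurable_funM; first exact: L1_measurable lh.
    exact: measurable_unimodal envelope_unimodal.
  by move=> x; rewrite normrM mulrC ler_wpM2r// ger0_norm.
have lu : L1 mu (fun x => h x * u x).
  apply: (L1_le _ _ (L1Z (envelope c * (1 + p^-1)) (L1_abs lh))).
    apply: measurable_funM; first exact: L1_measurable lh.
    exact: measurable_unimodal (likelihood_shift_unimodal LL).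
  move=> x; case/andP: (likelihood_bound x LL) => l0 lK.
  have pE : 0 <= p^-1 * envelope x by exact: mulr_ge0.
  rewrite normrM mulrC ler_wpM2r// ger0_norm ?addr_ge0//.
  by rewrite mulrDr mulr1 lerD// [leRHS]mulrC ler_wpM2l.
rewrite (_ : (fun x => _) = fun x => h x * u x - p^-1 * (h x * envelope x)); last first.
  by apply/funext => x; rewrite /u; ring.
rewrite devB//; last exact: L1Z.
rewrite devZ//; apply: le_trans (ler_normB _ _) _; rewrite normrM (ger0_norm p1).
apply: le_trans (lerD d1 (ler_wpM2l p1 d2)) _.
by rewrite le_eqVlt; apply/orP; left; apply/eqP; rewrite /dev_const; ring.
Qed.

End deviation.

End likelihood_class.

(** * Perturbation of the moment problem *)

(** Dominance is used at a coordinate where |u| is largest: there |u| is at most |u A| / kappa. So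
    the kernel of [A] is trivial and solutions are bounded in sup norm. *)
Lemma diag_dominant_solve (R : realFieldType) q (A : 'M[R]_q) (kappa b : R)
    (z : 'rV[R]_q) : 0 < kappa ->
    (forall (u : 'rV[R]_q) k, (forall k', `|u 0 k'| <= `|u 0 k|) ->
       kappa * `|u 0 k| <= `|(u *m A) 0 k|) ->
    (forall k, `|z 0 k| <= b) ->
  exists2 u : 'rV[R]_q, u *m A = z & forall k, `|u 0 k| <= b / kappa.
Proof.
move=> k0 dd zb.
have argmax (u : 'rV[R]_q) (k : 'I_q) : exists k1, forall k', `|u 0 k'| <= `|u 0 k1|.
  by exists [arg max_(i > k) `|u 0 i|]%O; case: arg_maxP => // i _ h k'; exact: h.
have uA : A \in unitmx.
  rewrite -row_free_unit -kermx_eq0; apply/eqP/row_matrixP => i; rewrite row0.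
  set u := row i _.
  have u0 : u *m A = 0 by rewrite -row_mul mulmx_ker row0.
  apply/rowP => k; rewrite [RHS]mxE; have [k1 hk1] := argmax u k.
  have := dd u k1 hk1; rewrite u0 [X in _ <= `|X|]mxE normr0 pmulr_rle0// => h.
  by apply/normr0_eq0/le_anti; rewrite normr_ge0 (le_trans (hk1 k)).
exists (z *m invmx A); first by rewrite mulmxKV.
move=> k; set u := z *m _; have [k1 hk1] := argmax u k.
apply: le_trans (hk1 k) _; rewrite ler_pdivlMr// mulrC.
by apply: le_trans (dd u k1 hk1) _; rewrite mulmxKV.
Qed.

(** The index type of 2q+1 points: a centre, then those displaced by +r and by -r along each
    equality moment. *)
Lemma big_sum3 (V : nmodType) q (F : unit + ('I_q + 'I_q) -> V) :
  \sum_i F i = F (inl tt) + (\sum_k F (inr (inl k)) + \sum_k F (inr (inr k))).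
Proof.
rewrite !big_sumType/=; congr (_ + _).
by rewrite (bigD1 tt)//= big1 ?addr0// => -[].
Qed.

Lemma sum_delta (R : nzRingType) q (k : 'I_q) (x y : R) :
  \sum_(k1 < q) (x + y *+ (k1 == k)) = q%:R * x + y.
Proof.
rewrite big_split/= sumr_const card_ord mulr_natl; congr (_ + _).
by rewrite (bigD1 k)//= eqxx big1 ?addr0// => k1 /negPf ->.
Qed.

Section perturbation.
Context (R : realType) (E : Type) (Cl : set E) (m l : nat) (mu : nat -> R).
Hypothesis hml : (m <= l)%N.
Implicit Types S T V : E -> nat -> R.

(** [E] carries no linear structure: a mixture need only exist with the right moments. Finite
    families are allowed because [interior_point] averages 2q+1 points at once. *)
Definition affine_moments V :=
  forall (I : finType) (w : I -> R) (L : I -> E),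
    (forall i, 0 <= w i) -> \sum_i w i = 1 -> (forall i, Cl (L i)) ->
  exists2 L', Cl L' & forall j, (j <= l)%N -> V L' j = \sum_i w i * V (L i) j.

Definition feasible V : set E := [set L | [/\ Cl L,
  forall j, (1 <= j <= m)%N -> V L j <= mu j &
  forall j, (m < j <= l)%N -> V L j = mu j]].

Definition optimum V : \bar R := ereal_sup [set (V L 0%N)%:E | L in feasible V].

Lemma affine2 V (lam : R) (L1 L2 : E) : affine_moments V -> 0 <= lam <= 1 ->
  Cl L1 -> Cl L2 -> exists2 L', Cl L' &
    forall j, (j <= l)%N -> V L' j = (1 - lam) * V L1 j + lam * V L2 j.
Proof.
move=> aV /andP[l0 l1] h1 h2.
have [] := aV bool (fun b => if b then lam else 1 - lam)
  (fun b => if b then L2 else L1).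
- by case; rewrite // subr_ge0.
- by rewrite big_bool/= addrC subrK.
- by case.
by move=> L' CL' H; exists L' => // j /H ->; rewrite big_bool/= addrC.
Qed.

Let q := (l - m)%N.
Let e (k : 'I_q) : nat := (m + k.+1)%N.

Let e_bound k : (m < e k <= l)%N.
Proof.
rewrite /e addnS ltnS leq_addr/=; have := ltn_ord k; by rewrite /q ltn_subRL.
Qed.

Let e_le k : (e k <= l)%N. Proof. by case/andP: (e_bound k). Qed.

Let e_surj j : (m < j <= l)%N -> exists k, j = e k.
Proof.
move=> /andP[mj jl]; have h : (j - m.+1 < q)%N.
  by rewrite /q ltn_subLR// addSn subnKC// (leq_trans (ltnW mj)).
by exists (Ordinal h); rewrite /e/= addnS -addSn subnKC.
Qed.

Section nondegenerate.
Variable V : E -> nat -> R.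
Variables (pts : unit + ('I_q + 'I_q) -> E) (s r bnd : R).
Hypothesis s0 : 0 < s.
Hypothesis r0 : 0 < r.
Hypothesis bnd0 : 0 <= bnd.
Hypothesis Vbnd : forall L, Cl L -> `|V L 0%N| <= bnd.
Hypothesis Cpts : forall i, Cl (pts i).
Hypothesis Vslack : forall i j, (1 <= j <= m)%N -> V (pts i) j <= mu j - s.
Hypothesis V0 : forall k, V (pts (inl tt)) (e k) = mu (e k).
Hypothesis Vp : forall k k',
  V (pts (inr (inl k))) (e k') = mu (e k') + r *+ (k == k').
Hypothesis Vn : forall k k',
  V (pts (inr (inr k))) (e k') = mu (e k') - r *+ (k == k').

Let N : R := (q.*2.+1)%:R.
(** Half of r / N: the right-hand side of the linear system adds the target z to the shift of the
    averaged moments, each at most [rho]. Then |u| <= 1 and the tilted weights are nonnegative. *)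
Let rho := r / (2 * N).

Let N_gt0 : 0 < N. Proof. by rewrite ltr0n. Qed.
Let NE : N = 1 + 2 * q%:R. Proof. by rewrite /N -addn1 natrD -mul2n natrM addrC. Qed.
Let rho_gt0 : 0 < rho. Proof. by rewrite divr_gt0// mulr_gt0. Qed.

(* Average the 2q+1 points, tilting the weights of the k-th pair to
   (1 + u_k)/N and (1 - u_k)/N: the moments are then affine in u, with a linear
   part diagonally dominant for small Delta, so that u can be solved for. *)
Lemma interior_point T (Delta : R) (z : 'I_q -> R) :
    affine_moments T -> Delta <= rho ->
    (forall L j, Cl L -> (j <= l)%N -> `|T L j - V L j| <= Delta) ->
    (forall k, `|z k| <= rho) ->
  exists L', [/\ Cl L', forall k, T L' (e k) = mu (e k) + z k &
    forall j, (1 <= j <= m)%N -> T L' j <= mu j - s + Delta].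
Proof.
move=> aT Dr TV zr.
pose t i k := T (pts i) (e k).
have tE i k : `|t i k - V (pts i) (e k)| <= Delta by exact: TV.
pose tbar k := (t (inl tt) k + (\sum_k1 t (inr (inl k1)) k + \sum_k1 t (inr (inr k1)) k)) / N.
pose A : 'M[R]_q := \matrix_(k, k') ((t (inr (inl k)) k' - t (inr (inr k)) k') / N).
have tbarE k : `|tbar k - mu (e k)| <= Delta.
  have -> : tbar k - mu (e k) = (\sum_i (t i k - V (pts i) (e k))) / N.
    rewrite big_sum3 V0 !sumrB.
    have -> : \sum_(k1 < q) V (pts (inr (inl k1))) (e k) = q%:R * mu (e k) + r.
      by under eq_bigr do rewrite Vp; rewrite sum_delta.
    have -> : \sum_(k1 < q) V (pts (inr (inr k1))) (e k) = q%:R * mu (e k) - r.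
      by under eq_bigr do rewrite Vn -mulNrn; rewrite sum_delta.
    have N0 : N != 0 by rewrite gt_eqF.
    rewrite /tbar; apply: (mulIf N0); rewrite mulrBl !divfK//.
    by rewrite NE; ring.
  rewrite normrM normfV (gtr0_norm N_gt0) ler_pdivrMr//.
  apply: le_trans (ler_norm_sum _ _ _) _.
  apply: (@le_trans _ _ (\sum_(i : unit + ('I_q + 'I_q)) Delta)); first exact: ler_sum.
  rewrite sumr_const card_sum card_unit card_sum card_ord -mulr_natl mulrC.
  by rewrite addnn add1n.
(* [A] is 2 r / N times the identity up to entries 2 Delta / N. Over q entries these cost at most r
   / (2 N) times |u_k|, so more than r / N remains. *)
have dom (u : 'rV[R]_q) k : (forall k', `|u 0 k'| <= `|u 0 k|) ->
    (r / N) * `|u 0 k| <= `|(u *m A) 0 k|.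
  move=> uk; pose eta k1 := A k1 k - (2 * r *+ (k1 == k)) / N.
  have etaE k1 : `|eta k1| <= 2 * Delta / N.
    rewrite /eta mxE -mulrBl normrM normfV (gtr0_norm N_gt0) ler_wpM2r ?invr_ge0 ?(ltW N_gt0)//.
    have h1 := tE (inr (inl k1)) k; have h2 := tE (inr (inr k1)) k.
    rewrite Vp in h1; rewrite Vn in h2.
    rewrite -(mulrnAr 2); set d := r *+ _ in h1 h2 *.
    by move: h1 h2; rewrite !ler_norml => /andP[? ?] /andP[? ?]; apply/andP; split; lra.
  have -> : (u *m A) 0 k = u 0 k * (2 * r / N) + \sum_k1 u 0 k1 * eta k1.
    rewrite mxE; transitivity (\sum_k1 (u 0 k1 * ((2 * r *+ (k1 == k)) / N) + u 0 k1 * eta k1)).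
      by apply: eq_bigr => k1 _; rewrite -mulrDr /eta addrC subrK.
    rewrite big_split/=; congr (_ + _); rewrite (bigD1 k)//= eqxx big1 ?addr0//.
    by move=> k1 /negPf ->; rewrite mul0r mulr0.
  have h : `|\sum_k1 u 0 k1 * eta k1| <= q%:R * (`|u 0 k| * (2 * Delta / N)).
    apply: le_trans (ler_norm_sum _ _ _) _.
    rewrite mulr_natl -[X in _ *+ X]card_ord -sumr_const; apply: ler_sum => k1 _.
    by rewrite normrM ler_pM.
  have h2 : `|u 0 k * (2 * r / N)| = `|u 0 k| * (2 * r / N).
    by rewrite normrM [X in _ * X]ger0_norm// divr_ge0 ?mulr_ge0 ?ltW.
  have := lerB_normD (u 0 k * (2 * r / N)) (\sum_k1 u 0 k1 * eta k1).
  rewrite h2; apply: le_trans.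
  apply: (@le_trans _ _ (`|u 0 k| * (2 * r / N) - q%:R * (`|u 0 k| * (2 * Delta / N)))).
    have -> : `|u 0 k| * (2 * r / N) - q%:R * (`|u 0 k| * (2 * Delta / N)) =
      (2 * r - 2 * q%:R * Delta) / N * `|u 0 k| by ring.
    apply: ler_wpM2r => //; apply: ler_wpM2r; first by rewrite invr_ge0 ltW.
    have : 2 * q%:R * Delta <= N * rho.
      apply: ler_pM => //; rewrite ?mulr_ge0//; last by rewrite NE; lra.
      exact: le_trans (tE (inl tt) k).
    have -> : N * rho = r / 2 by rewrite /rho; field; rewrite gt_eqF.
    by move: r0; set y := 2 * q%:R * Delta; lra.
  by rewrite lerD2l lerN2.
(* The displacement still missing after the uniform average of the points. *)
pose z' : 'rV[R]_q := \row_k (z k + mu (e k) - tbar k).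
have zb k : `|z' 0 k| <= r / N.
  rewrite mxE; have -> : r / N = rho + rho by rewrite /rho; field; rewrite gt_eqF.
  rewrite -addrA; apply: le_trans (ler_normD _ _) _; apply: lerD => //.
  by rewrite distrC (le_trans (tbarE k)).
have [u uA ub] := diag_dominant_solve (divr_gt0 r0 N_gt0) dom zb.
have ub1 k : `|u 0 k| <= 1.
  by apply: le_trans (ub k) _; rewrite divff// mulf_neq0 ?invr_neq0 ?gt_eqF.
pose w (i : unit + ('I_q + 'I_q)) := match i with
  | inl _ => N^-1 | inr (inl k) => (1 + u 0 k) / N | inr (inr k) => (1 - u 0 k) / N end.
have w0 i : 0 <= w i.
  case: i => [[]|[k|k]]; rewrite /w ?divr_ge0 ?invr_ge0 ?(ltW N_gt0)//.
    by have := ub1 k; rewrite ler_norml => /andP[? ?]; lra.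
  by have := ub1 k; rewrite ler_norml => /andP[? ?]; lra.
have w1 : \sum_i w i = 1.
  rewrite big_sum3/= -big_split/=.
  under eq_bigr => k _.
    rewrite -mulrDl addrACA subrr addr0.
    over.
  rewrite sumr_const card_ord -mulr_natl NE; field.
  by rewrite -NE gt_eqF.
have [L' CL' HL'] := aT _ w pts w0 w1 Cpts.
exists L'; split=> // [k|j /andP[j1 jm]].
  rewrite HL'// big_sum3/= -big_split/=.
  transitivity (tbar k + (u *m A) 0 k); last by rewrite uA mxE; ring.
  rewrite /tbar mxE -big_split/= mulrDl mulr_suml -addrA -big_split/=; congr (_ + _).
    by rewrite mulrC.
  by apply: eq_bigr => k1 _; rewrite mxE /t; ring.
have jl : (j <= l)%N := leq_trans jm hml.
rewrite HL'//; apply: (@le_trans _ _ (\sum_i w i * (mu j - s + Delta))).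
  apply: ler_sum => i _; apply: ler_wpM2l => //.
  have := TV (pts i) j (Cpts i) jl; rewrite ler_norml => /andP[_].
  by have := Vslack i; move=> /(_ j); rewrite j1 jm => /(_ isT); lra.
by rewrite -mulr_suml w1 mul1r.
Qed.

(** [rho] limits the displacements that [interior_point] can produce; s / 2 leaves slack for the
    inequalities to absorb an error Delta. *)
Let kap := Num.min rho (s / 2).
Let kap_gt0 : 0 < kap. Proof. by rewrite lt_min rho_gt0 divr_gt0. Qed.

(** The cap 1 keeps perturbed objectives below bnd + 1. *)
Definition perturbation_radius : R := Num.min 1 kap.
(** The 1 pays for evaluating the objective under T instead of S at the same point; the rest is the
    oscillation 2 (bnd + 1) times the mixing weight Delta / kap. *)
Definition perturbation_const : R := 1 + 2 * (bnd + 1) / kap.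

Lemma perturbation_radius_gt0 : 0 < perturbation_radius.
Proof. by rewrite lt_min ltr01. Qed.

Lemma perturbation_const_ge0 : 0 <= perturbation_const.
Proof. by rewrite addr_ge0// divr_ge0 ?(ltW kap_gt0)// mulr_ge0// addr_ge0. Qed.

(* Mix the feasible point of S with weight of order Delta into an interior point.
   S stands for the moments at which L is feasible, T for those at which a
   nearby feasible point is sought; one of them is V. *)
Lemma feasible_transfer S T (Delta : R) L :
    affine_moments T -> 0 <= Delta <= perturbation_radius ->
    (forall L j, Cl L -> (j <= l)%N -> `|S L j - T L j| <= Delta) ->
    (forall L j, Cl L -> (j <= l)%N -> `|T L j - V L j| <= Delta) ->
    feasible S L ->
  exists2 L', feasible T L' & S L 0%N - perturbation_const * Delta <= T L' 0%N.
Proof.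
move=> aT /andP[D0]; rewrite !le_min => /and3P[D1 Dr Ds] ST TV [CL Sle Seq].
pose lam := Delta / kap.
have l0 : 0 <= lam by rewrite divr_ge0// ltW.
have l1 : lam <= 1 by rewrite ler_pdivrMr// mul1r le_min Dr.
have lk : lam * kap = Delta by rewrite divfK// gt_eqF.
(* The displacement that makes the mixture meet the equalities exactly. If lam = 0 the division
   yields 0, and the moments already agree. *)
pose z k := (1 - lam) * (mu (e k) - T L (e k)) / lam.
have dT k : `|mu (e k) - T L (e k)| <= Delta.
  by rewrite -(Seq _ (e_bound k)); exact: ST.
have lz k : lam * z k = (1 - lam) * (mu (e k) - T L (e k)).
  have [lam0|lam0] := eqVneq lam 0; last by rewrite /z mulrC divfK.
  have D00 : Delta = 0 by rewrite -lk lam0 mul0r.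
  have := dT k; rewrite D00 normr_le0 => /eqP ->.
  by rewrite lam0 mul0r mulr0.
have zr k : `|z k| <= rho.
  have [lam0|lam0] := eqVneq lam 0.
    by rewrite /z lam0 invr0 mulr0 normr0 ltW.
  have lp : 0 < lam by rewrite lt_neqAle eq_sym lam0.
  rewrite /z normrM normfV (gtr0_norm lp) ler_pdivrMr// [leRHS]mulrC.
  apply: (@le_trans _ _ Delta).
    have l2 : 0 <= 1 - lam by rewrite subr_ge0.
    rewrite normrM (ger0_norm l2); apply: le_trans (dT k).
    by rewrite ler_piMl// gerBl.
  by rewrite -lk ler_wpM2l// ge_min lexx.
have [L1 [CL1 L1eq L1le]] := interior_point aT Dr TV zr.
have lamI : 0 <= lam <= 1 by rewrite l0.
have [L' CL' HL'] := affine2 aT lamI CL CL1.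
exists L'; first split=> // j jb.
- case/andP: (jb) => j1 jm; have jl : (j <= l)%N := leq_trans jm hml.
  rewrite HL'//.
  have h1 := Sle j jb; have h2 := L1le j jb.
  have h3 : T L j <= mu j + Delta.
    by have := ST L j CL jl; rewrite ler_norml => /andP[+ _]; lra.
  have h4 : (1 - lam) * T L j <= (1 - lam) * (mu j + Delta) by rewrite ler_wpM2l// subr_ge0.
  have h5 : lam * T L1 j <= lam * (mu j - s + Delta) by rewrite ler_wpM2l.
  (* The mixture satisfies the inequalities up to Delta - lam s, which must not be positive. *)
  have h6 : Delta <= lam * s.
    rewrite -lk ler_wpM2l//; apply: (@le_trans _ _ (s / 2)); first by rewrite ge_min lexx orbT.
    by move: s0; lra.
  by nra.
- have [k ->] := e_surj jb.
  by rewrite HL'// L1eq mulrDr lz; ring.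
rewrite HL'//.
have h1 : S L 0%N - T L 0%N <= Delta by exact: le_trans (ler_norm _) (ST L 0%N CL (leq0n l)).
have Tb L2 : Cl L2 -> `|T L2 0%N| <= bnd + 1.
  move=> C2; rewrite -[T L2 0%N](subrK (V L2 0%N)) addrC.
  apply: le_trans (ler_normD _ _) _; apply: lerD; first exact: Vbnd.
  by apply: le_trans (TV L2 0%N C2 (leq0n l)) _.
have := Tb L CL; have := Tb L1 CL1; rewrite !ler_norml => /andP[h2 h3] /andP[h4 h5].
have -> : perturbation_const * Delta = Delta + 2 * (bnd + 1) * lam.
  by rewrite /perturbation_const /lam; ring.
by nra.
Qed.

Lemma optimum_transfer S T (Delta : R) :
    affine_moments T -> 0 <= Delta <= perturbation_radius ->
    (forall L j, Cl L -> (j <= l)%N -> `|S L j - T L j| <= Delta) ->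
    (forall L j, Cl L -> (j <= l)%N -> `|T L j - V L j| <= Delta) ->
  (optimum S <= optimum T + (perturbation_const * Delta)%:E)%E.
Proof.
move=> aT D ST TV; apply: ge_ereal_sup => _ [L fL <-].
have [L' fL' h] := feasible_transfer aT D ST TV fL.
apply: (@le_trans _ _ ((T L' 0%N)%:E + (perturbation_const * Delta)%:E)%E).
  by rewrite -EFinD lee_fin -lerBlDr.
by rewrite leeD2r//; apply: ereal_sup_ubound; exists L'.
Qed.

Lemma optimum_fin_num : affine_moments V -> optimum V \is a fin_num.
Proof.
move=> aV.
have D : 0 <= (0 : R) <= perturbation_radius by rewrite lexx ltW// perturbation_radius_gt0.
have VV L j : Cl L -> (j <= l)%N -> `|V L j - V L j| <= 0 by rewrite subrr normr0.
have z0 (k : 'I_q) : `|(fun=> 0 : R) k| <= rho by rewrite normr0 ltW.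
have [L1 [CL1 L1eq L1le]] := interior_point aV (ltW rho_gt0) VV z0.
have fL1 : feasible V L1.
  split=> // [j jb|j /e_surj[k ->]]; last by rewrite L1eq addr0.
  by apply: le_trans (L1le j jb) _; rewrite addr0 gerBl ltW.
rewrite fin_numE; apply/andP; split.
  apply/eqP => h; have : ((V L1 0%N)%:E <= optimum V)%E by apply: ereal_sup_ubound; exists L1.
  by rewrite h leeNy_eq.
apply/eqP => h; have : (optimum V <= bnd%:E)%E.
  apply: ge_ereal_sup => _ [L [CL _ _] <-]; rewrite lee_fin.
  exact: le_trans (ler_norm _) (Vbnd CL).
by rewrite h leye_eq.
Qed.

(** The transfer is used in both directions; on the way back the target is V itself, at distance 0
    from V. *)
Lemma optimum_perturbation T (Delta : R) :
    affine_moments V -> affine_moments T -> 0 <= Delta <= perturbation_radius ->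
    (forall L j, Cl L -> (j <= l)%N -> `|T L j - V L j| <= Delta) ->
  (`|optimum T - optimum V| <= (perturbation_const * Delta)%:E)%E.
Proof.
move=> aV aT D TV; have := optimum_fin_num aV.
have h1 : (optimum V <= optimum T + (perturbation_const * Delta)%:E)%E.
  by apply: optimum_transfer => // L j CL jl; rewrite distrC; exact: TV.
have h2 : (optimum T <= optimum V + (perturbation_const * Delta)%:E)%E.
  apply: optimum_transfer => // L j CL jl.
  by rewrite subrr normr0; case/andP: D.
case: (optimum V) h1 h2 => // v; case: (optimum T) => // t.
rewrite -!EFinD !lee_fin => h1 h2 _.
by rewrite ler_norml; apply/andP; split; lra.
Qed.

End nondegenerate.

(** Points that witness interiority may violate the inequalities. Moving from [L0] only a fraction
    tau towards them keeps half of the Slater slack and shrinks the displacement r to tau r. *)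
Lemma slater_interior_perturbation V (L0 : E) (bnd r : R) :
    affine_moments V -> Cl L0 -> 0 < r ->
    (forall L j, Cl L -> (j <= l)%N -> `|V L j| <= bnd) ->
    (forall j, (1 <= j <= m)%N -> V L0 j < mu j) ->
    (forall j, (m < j <= l)%N -> V L0 j = mu j) ->
    (forall (k : 'I_q) (b : bool), exists2 L, Cl L & forall k' : 'I_q,
       V L (m + k'.+1)%N = mu (m + k'.+1)%N + (if b then r else - r) *+ (k == k')) ->
  exists C d : R, [/\ 0 <= C, 0 < d, optimum V \is a fin_num &
    forall T (Delta : R), affine_moments T -> 0 <= Delta <= d ->
      (forall L j, Cl L -> (j <= l)%N -> `|T L j - V L j| <= Delta) ->
    (`|optimum T - optimum V| <= (C * Delta)%:E)%E].
Proof.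
move=> aV CL0 r0 Vb Vlt Veq Vint.
have bnd0 : 0 <= bnd by exact: le_trans (Vb L0 0%N CL0 (leq0n l)).
have /choice[Lp HLp] : forall k : 'I_q, exists L, Cl L /\ forall k' : 'I_q,
    V L (e k') = mu (e k') + r *+ (k == k').
  by move=> k; case: (Vint k true) => L h1 h2; exists L.
have /choice[Ln HLn] : forall k : 'I_q, exists L, Cl L /\ forall k' : 'I_q,
    V L (e k') = mu (e k') - r *+ (k == k').
  by move=> k; case: (Vint k false) => L h1 h2; exists L; split=> // k'; rewrite h2 mulNrn.
(* The initial value 1 covers the case without inequalities. *)
pose s := \big[Num.min/1]_(j < m) (mu j.+1 - V L0 j.+1).
have s0 : 0 < s.
  apply: lt_bigmin => // j _; rewrite subr_gt0; apply: Vlt.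
  by rewrite /= ltn_ord.
have sle j : (1 <= j <= m)%N -> V L0 j <= mu j - s.
  case: j => // j /= jm; have := @bigmin_le _ _ _ 1 (Ordinal jm) (fun j : 'I_m => mu j.+1 - V L0 j.+1).
  by rewrite -/s/=; lra.
(* A moment moves by at most 2 tau bnd, and 4 tau bnd <= s keeps this below s / 2; the + 1 guards
   against bnd = 0. *)
pose tau := Num.min 1 (s / (4 * bnd + 1)).
have b4 : 0 < 4 * bnd + 1 by lra.
have tau0 : 0 < tau by rewrite lt_min ltr01 divr_gt0.
have tau1 : tau <= 1 by rewrite ge_min lexx.
have taus : tau * (4 * bnd + 1) <= s by rewrite -ler_pdivlMr// ge_min lexx orbT.
have tauI : 0 <= tau <= 1 by rewrite tau1 ltW.
have mix L : Cl L -> exists L', Cl L' /\ forall j, (j <= l)%N ->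
    V L' j = (1 - tau) * V L0 j + tau * V L j.
  by move=> CL; have [L' h1 h2] := affine2 aV tauI CL0 CL; exists L'.
have /choice[Mp HMp] k := mix _ (HLp k).1.
have /choice[Mn HMn] k := mix _ (HLn k).1.
have slack L L' j : Cl L -> (forall j, (j <= l)%N ->
    V L' j = (1 - tau) * V L0 j + tau * V L j) -> (1 <= j <= m)%N ->
    V L' j <= mu j - s / 2.
  move=> CL HL' jb; case/andP: (jb) => j1 jm; have jl := leq_trans jm hml.
  rewrite HL'//; have := Vb L j CL jl; have := Vb L0 j CL0 jl.
  rewrite !ler_norml => /andP[? ?] /andP[? ?]; have := sle j jb; nra.
pose pts (i : unit + ('I_q + 'I_q)) := match i with
  | inl _ => L0 | inr (inl k) => Mp k | inr (inr k) => Mn k end.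
have s20 : 0 < s / 2 by rewrite divr_gt0.
have tr0 : 0 < tau * r by rewrite mulr_gt0.
have Cpts i : Cl (pts i).
  by case: i => [[]|[k|k]] //=; [exact: (HMp k).1|exact: (HMn k).1].
have Pslack i j : (1 <= j <= m)%N -> V (pts i) j <= mu j - s / 2.
  move=> jb; case: i => [[]|[k|k]] /=; first by have := sle j jb; lra.
    by apply: (slack (Lp k)) => //; [exact: (HLp k).1|exact: (HMp k).2].
  by apply: (slack (Ln k)) => //; [exact: (HLn k).1|exact: (HMn k).2].
have P0 k : V (pts (inl tt)) (e k) = mu (e k) by exact: Veq.
have Pp k k' : V (pts (inr (inl k))) (e k') = mu (e k') + (tau * r) *+ (k == k').
  by rewrite /= (HMp k).2// (HLp k).2 Veq// -mulrnAr; ring.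
have Pn k k' : V (pts (inr (inr k))) (e k') = mu (e k') - (tau * r) *+ (k == k').
  by rewrite /= (HMn k).2// (HLn k).2 Veq// -mulrnAr; ring.
have Vb0 L : Cl L -> `|V L 0%N| <= bnd by move=> CL; exact: Vb.
exists (perturbation_const (s / 2) (tau * r) bnd), (perturbation_radius (s / 2) (tau * r)).
split.
- exact: perturbation_const_ge0.
- exact: perturbation_radius_gt0.
- exact: (@optimum_fin_num V pts (s / 2) (tau * r) bnd).
- by move=> T Delta aT D TV; exact: (@optimum_perturbation V pts (s / 2) (tau * r) bnd).
Qed.

End perturbation.
(** * Finite-dimensional reduction *)

Section reducibility.
Context (R : realType) (n : nat) (x : 'I_n -> R).

Let o := order_indices x.
Let le_x (i j : 'I_n) := x i <= x j.

Let size_o : size o = n.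
Proof. by rewrite size_sort size_enum_ord. Qed.

Let sorted_o : sorted le_x o.
Proof. by apply: sort_sorted => i j; exact: le_total. Qed.

Let mem_o i : i \in o.
Proof. by rewrite mem_sort mem_enum. Qed.

Let o_le i0 k k' : (k <= k')%N -> (k' < n)%N -> x (nth i0 o k) <= x (nth i0 o k').
Proof.
move=> kk' k'n; apply: (sorted_leq_nth (leT := le_x)) => //.
- by move=> j i k1; exact: le_trans.
- by move=> i; exact: lexx.
- by rewrite inE size_o (leq_ltn_trans kk').
- by rewrite inE size_o.
Qed.

Let order_statE i0 k : (k < n)%N -> order_stat x k.+1 = x (nth i0 o k).
Proof. by move=> kn; rewrite /order_stat (nth_map i0)// size_o. Qed.

Let order_weightE (g0 : R -> R) v i0 k : (k < n)%N ->
  order_weight g0 x v k.+1 = v (nth i0 o k) * g0 (x (nth i0 o k)).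
Proof. by move=> kn; rewrite /order_weight/= (nth_map i0)// size_o. Qed.

Variables (M gamma c : R) (g0 : R -> R).
Hypothesis hM : 0 < M.
Hypothesis hgamma : 0 < gamma < 1.
Hypothesis g0_gt0 : forall y, 0 < g0 y.
Hypothesis hg0 : unimodal c g0.

Lemma likelihood_discrete_shape L : likelihood_class M gamma c g0 L ->
  discrete_shape M gamma c g0 x (fun i => L (x i)).
Proof.
move=> [f [fM [fl fr]] <-]; split; last by move=> i; rewrite divfK ?gt_eqF.
have fg y : f y / g0 y * g0 y = f y by rewrite divfK ?gt_eqF.
have f0 y : 0 <= f y by case/andP: (fM y).
case=> [//|k] /= kn; have [i0 _] : exists i0 : 'I_n, true by exists (Ordinal kn).
rewrite (order_statE i0)// (order_weightE _ _ i0)// fg; split=> [kc|ck].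
  (* The first point is compared with the conventional weight 0. *)
  case: k kn kc => [|k] kn kc /=; first exact: f0.
  by rewrite (order_weightE _ _ i0) 1?ltnW// fg; apply: fl => //; exact: o_le.
(* Past the last point the weight is the default 0 of [nth]. *)
have [kn'|nk] := ltnP k.+1 n; last first.
  by rewrite /order_weight/= nth_default// size_map size_o.
by rewrite (order_weightE _ _ i0)// fg; apply: fr => //; exact: o_le.
Qed.

Hypothesis injx : injective x.

Lemma discrete_shape_likelihood (v : 'I_n -> R) : discrete_shape M gamma c g0 x v ->
  exists2 L, likelihood_class M gamma c g0 L & forall i, L (x i) = v i.
Proof.
move=> [shape bnd]; pose W i := v i * g0 (x i).
have W0 i : 0 <= W i by case/andP: (bnd i).
have Wmono_l i j : x i <= x j -> x j <= c -> W i <= W j.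
  move=> xij xjc.
  have step k k' : (k <= k')%N -> (k' < n)%N -> x (nth i o k') <= c ->
      W (nth i o k) <= W (nth i o k').
    elim: k' => [|k' IH]; first by rewrite leqn0 => /eqP ->.
    rewrite leq_eqVlt => /orP[/eqP -> //|]; rewrite ltnS => kk' k'n k'c.
    have k'n' : (k' < n)%N by exact: ltnW.
    apply: le_trans (IH kk' k'n' (le_trans (o_le i (leqnSn k') k'n) k'c)) _.
    have [//|+ _] := shape k'.+2.
    by rewrite (order_statE i)// (order_weightE _ _ i)// (order_weightE _ _ i)//; exact.
  have ii : nth i o (index i o) = i by rewrite nth_index.
  have jj : nth i o (index j o) = j by rewrite nth_index.
  have jn : (index j o < n)%N by rewrite -[X in (_ < X)%N]size_o index_mem.
  have [ij|ji] := leqP (index i o) (index j o).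
    by have := step _ _ ij jn; rewrite ii jj; exact.
  (* The indices can be in the opposite order only for tied points, which injectivity identifies. *)
  have iN : (index i o < n)%N by rewrite -[X in (_ < X)%N]size_o index_mem.
  have := o_le i (ltnW ji) iN; rewrite ii jj => xji.
  by rewrite (injx (le_anti (introT andP (conj xij xji)))).
have Wmono_r i j : c <= x i -> x i <= x j -> W j <= W i.
  move=> cxi xij.
  have step k k' : (k <= k')%N -> (k' < n)%N -> c <= x (nth i o k) ->
      W (nth i o k') <= W (nth i o k).
    elim: k' => [|k' IH]; first by rewrite leqn0 => /eqP ->.
    rewrite leq_eqVlt => /orP[/eqP -> //|]; rewrite ltnS => kk' k'n ck.
    have k'n' : (k' < n)%N by exact: ltnW.
    apply: le_trans _ (IH kk' k'n' ck).
    have [|_] := shape k'.+1; first by rewrite k'n'.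
    rewrite (order_statE i)// (order_weightE _ _ i)// (order_weightE _ _ i)//; apply.
    by apply: le_trans ck _; exact: o_le.
  have ii : nth i o (index i o) = i by rewrite nth_index.
  have jj : nth i o (index j o) = j by rewrite nth_index.
  have jn : (index j o < n)%N by rewrite -[X in (_ < X)%N]size_o index_mem.
  have [ij|ji] := leqP (index i o) (index j o).
    by have := step _ _ ij jn; rewrite ii jj; exact.
  have iN : (index i o < n)%N by rewrite -[X in (_ < X)%N]size_o index_mem.
  have := o_le i (ltnW ji) iN; rewrite ii jj => xji.
  by rewrite (injx (le_anti (introT andP (conj xij xji)))).
(* The smallest unimodal function with the prescribed values at the points. *)
pose Q y i := (x i <= y <= c) || (c <= y <= x i).
pose f y := \big[Num.max/0]_(i | Q y i) W i.
have fmono y z : (forall i, Q y i -> Q z i) -> f y <= f z.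
  move=> yz; apply: bigmax_le => [|i /yz zi]; first exact: bigmax_ge_id.
  exact: le_bigmax_cond.
have fx i : f (x i) = W i.
  apply/le_anti/andP; split.
    apply: bigmax_le => // j /orP[/andP[ji ic]|/andP[ci ij]].
      exact: Wmono_l.
    exact: Wmono_r.
  apply: le_bigmax_cond; rewrite /Q lexx /= andbT.
  by case: (leP (x i) c) => //= /ltW.
exists (fun y => f y / g0 y); last first.
  by move=> i; rewrite fx /W mulfK// gt_eqF.
exists f => //; split=> [y|].
  apply/andP; split; first exact: bigmax_ge_id.
  apply: bigmax_le => [|i Qi]; first exact: powR_ge0.
  (* A sample point that counts in [f y] lies on the same side of the mode and no closer to it than
     [y], so [g0], and with it the bound, is at least as large at [y]. *)
  case/andP: (bnd i) => _ /le_trans; apply.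
  have a0 : 0 <= (1 - gamma)^-1.
    by case/andP: hgamma => ? ?; rewrite invr_ge0; lra.
  apply: ge0_ler_powR => //; rewrite ?nnegrE ?mulr_ge0 ?(ltW hM) ?(ltW (g0_gt0 _))//.
  rewrite ler_wpM2l ?(ltW hM)//; case/orP: Qi => /andP[h1 h2].
    exact: hg0.1.
  exact: hg0.2.
(* In the two mixed cases y and z are squeezed onto [c]. *)
split=> y z yz h; apply: fmono => i /orP[/andP[h1 h2]|/andP[h1 h2]]; rewrite /Q.
- by rewrite (le_trans h1 yz) h.
- have cz := le_trans h1 yz; have zc : z = c by apply/le_anti; rewrite h cz.
  have yc : y = c by apply/le_anti; rewrite h1 -zc yz.
  by rewrite zc lexx -yc h2 orbT.
- have zc : z = c by apply/le_anti; rewrite h2 (le_trans yz h).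
  have yc : y = c by apply/le_anti; rewrite yz -{1}zc h.
  by rewrite yc lexx -{1}zc h1.
- by rewrite yz (le_trans h h2) orbT.
Qed.

Lemma finite_dim_reducibility m l phi mu :
  finite_dim_reducible M gamma c g0 m l phi mu x.
Proof.
split; [exact: likelihood_discrete_shape|exact: discrete_shape_likelihood|].
congr ereal_sup; apply/seteqP; split=> [_ [L [LL LC] <-]|_ [v [vS vC] <-]].
  by exists (fun i => L (x i)) => //; split => //; exact: likelihood_discrete_shape.
have [L LL Lv] := discrete_shape_likelihood vS.
have -> : v = fun i => L (x i) by apply/funext => i; rewrite Lv.
exists L => //; split=> //.
by have <- : v = fun i => L (x i) by apply/funext => i; rewrite Lv.
Qed.

End reducibility.

(** * Minimal measurable majorants *)

Section minimal_majorants.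
Context d (T : measurableType d) (R : realType) (P : probability T R).

(** Intersect covers whose probabilities approach the outer one. Cutting the result with another
    cover cannot go below the outer probability, so the part removed is null. *)
Lemma measurable_hull (B : set T) : exists A, [/\ measurable A, B `<=` A &
  forall A', measurable A' -> B `<=` A' -> P (A `\` A') = 0%E].
Proof.
pose F := [set A | measurable A /\ B `<=` A].
pose a := outer_prob P B.
have a0 : (0 <= a)%E by apply: le_ereal_inf_tmp => _ [A _ <-]; exact: measure_ge0.
have ale A : measurable A -> B `<=` A -> (a <= P A)%E.
  by move=> mA BA; apply: ereal_inf_lbound; exists A.
have afin : a \is a fin_num.
  rewrite ge0_fin_numE// (le_lt_trans (ale setT measurableT (@subsetT _ _)))//.
  by rewrite probability_setT ltry.
have /choice[A hA] : forall k : nat, exists A, [/\ measurable A, B `<=` A &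
    (P A < a + (k.+1%:R^-1)%:E)%E].
  move=> k; have e0 : 0 < k.+1%:R^-1 :> R by rewrite invr_gt0.
  have [_ [A [mA BA] <-] h] := lb_ereal_inf_adherent e0 afin.
  by exists A.
have mA k : measurable (A k) by case: (hA k).
have BA k : B `<=` A k by case: (hA k).
have mI : measurable (\bigcap_k A k) by exact: bigcapT_measurable.
exists (\bigcap_k A k); split=> // [w Bw k _|A' mA' BA']; first exact: BA.
have PI : (P (\bigcap_k A k) <= a)%E.
  apply/lee_addgt0Pr => e e0; have [k _ hk] := near_infty_natSinv_lt (PosNum e0).
  case: (hA k) => _ _ /ltW h; apply: le_trans (le_measure _ _ _ _) (le_trans h _).
  - by rewrite inE.
  - by rewrite inE.
  - by move=> w; exact.
  - by rewrite leeD2l// lee_fin ltW// hk/=.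
have fI : (P (\bigcap_k A k) < +oo)%E by rewrite (le_lt_trans (probability_le1 _ _))// ltry.
rewrite measureD//; apply/eqP; rewrite eq_le; apply/andP; split; last first.
  rewrite sube_ge0 ?fin_num_measure//; last exact: measurableI.
  by apply: le_measure; rewrite ?inE//; exact: measurableI.
rewrite sube_le0; apply: le_trans PI (ale _ _ _); first exact: measurableI.
by move=> w Bw; split; [move=> k _; exact: BA|exact: BA'].
Qed.

Definition rat_seq (k : nat) : R := ratr (odflt 0 (unpickle k)).

Lemma rat_seq_dense (x y : R) : x < y -> exists k, x < rat_seq k < y.
Proof.
move=> /rat_in_itvoo[q]; rewrite in_itv/= => qxy; exists (pickle q).
by rewrite /rat_seq pickleK.
Qed.

Lemma rat_seq_edense (x y : \bar R) : (x < y)%E ->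
  exists k, (x < (rat_seq k)%:E < y)%E.
Proof.
case: x y => [x| |] [y| |] //; rewrite ?lte_fin.
- by move=> /rat_seq_dense[k]; exists k; rewrite !lte_fin.
- move=> _; have [|k /andP[h _]] := @rat_seq_dense x (x + 1); first by rewrite ltrDl.
  by exists k; rewrite lte_fin h ltry.
- move=> _; have [|k /andP[_ h]] := @rat_seq_dense (y - 1) y; first by rewrite gtrBl.
  by exists k; rewrite lte_fin h ltNyr.
- by move=> _; exists 0%N; rewrite ltry ltNyr.
Qed.

(** Z is the supremum of the rationals below it; the majorant replaces each set where q < Z by its
    measurable hull. *)
Lemma minimal_majorant_exists (Z : T -> \bar R) : exists U, minimal_majorant P Z U.
Proof.
have /choice[A hA] k := measurable_hull [set w | ((rat_seq k)%:E < Z w)%E].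
have mA k : measurable (A k) by case: (hA k).
pose h k w : \bar R := if w \in A k then (rat_seq k)%:E else -oo%E.
have mh k : measurable_fun setT (h k).
  apply: measurable_fun_ifT => //; apply: (measurable_fun_bool true).
  rewrite setTI (_ : _ @^-1` _ = A k)//.
  by apply/seteqP; split=> w /= => [/set_mem|/mem_set].
exists (fun w => esups (h ^~ w) 0%N); split.
- exact: measurable_fun_esups.
- move=> w; rewrite leNgt; apply/negP => /rat_seq_edense[k /andP[h1 h2]].
  case: (hA k) => _ /(_ w h2) Aw _.
  have : (h k w <= esups (h ^~ w) 0%N)%E by apply: ereal_sup_ubound; exists k.
  by rewrite /h mem_set// leNgt h1.
- move=> V mV [N [mN PN ZV]].
  (* Adding the null set [N] makes this a cover everywhere and not just almost everywhere. *)
  pose A' k := [set w | ((rat_seq k)%:E < V w)%E] `|` N.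
  have mA' k : measurable (A' k).
    apply: measurableU => //; rewrite -[X in measurable X]setTI.
    exact: emeasurable_fun_o_infty.
  have ZA' k : [set w | ((rat_seq k)%:E < Z w)%E] `<=` A' k.
    move=> w /= hw; have [ZVw|nZV] := pselect (Z w <= V w)%E.
      by left => /=; exact: lt_le_trans ZVw.
    by right; apply: ZV.
  have : P.-negligible (N `|` \bigcup_k (A k `\` A' k)).
    apply: negligibleU; first exact/negligibleP.
    apply: negligible_bigcup => k; apply/negligibleP; first exact: measurableD.
    by case: (hA k) => _ _; exact.
  apply: negligibleS => w /= UV; apply: contrapT => /not_orP[nN nA].
  apply: UV; apply: ge_ereal_sup => _ [k _ <-].
  rewrite /h; case: ifPn => [/set_mem Aw|_]; last exact: leNye.
  have [Vw|//] : A' k w.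
    by apply: contrapT => nA'; apply: nA; exists k.
  exact: ltW.
Qed.

End minimal_majorants.

(** * Densities *)

(* Lebesgue measure lives on measurableTypeR R, the random variables on R with
   its default display: nu is mu read on the former. *)
Section density_measurableTypeR.
Context (R : realType) (g : R -> R) (nu : probability (measurableTypeR R) R).
Hypothesis hg : positive_density g.
Hypothesis mug : forall A : set (measurableTypeR R), measurable A ->
  nu A = (\int[lebesgue_measure]_(x in A) (g x)%:E)%E.

Local Notation leb := (@lebesgue_measure R).

Let mg : measurable_fun setT (EFin \o g).
Proof. by case: hg => mg _ _; exact/measurable_EFinP. Qed.

Let g_gt0 x : 0 < g x. Proof. by case: hg. Qed.

Let dominated : nu `<< leb.
Proof.
apply/null_content_dominatesP => A mA A0; rewrite mug//.
by apply: null_set_integral => //; exact: measurable_funTS.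
Qed.

Let f := Radon_Nikodym_SigmaFinite.f nu leb.

Let f_ae : ae_eq leb setT f (EFin \o g).
Proof.
apply: integral_ae_eq => //; first exact: Radon_Nikodym_SigmaFinite.f_integrable.
move=> A _ mA; rewrite -Radon_Nikodym_SigmaFinite.f_integral//.
exact: mug.
Qed.

(** Change of variables with the Radon-Nikodym derivative, which [f_ae] identifies with [g]. *)
Lemma ge0_integral_densityR (h : measurableTypeR R -> R) : measurable_fun setT h ->
  (forall x, 0 <= h x) ->
  (\int[leb]_x (h x * g x)%:E = \int[nu]_x (h x)%:E)%E.
Proof.
move=> mh h0.
have mhE : measurable_fun setT (EFin \o h) by exact/measurable_EFinP.
have h0E x : (0 <= (EFin \o h) x)%E by rewrite lee_fin.
rewrite -(Radon_Nikodym_SigmaFinite.change_of_variables dominated h0E measurableT mhE).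
transitivity (\int[leb]_x ((h x)%:E * (g x)%:E))%E => //.
apply: ae_eq_integral => //.
- by apply: emeasurable_funM => //; exact/measurable_EFinP.
- apply: emeasurable_funM; first exact/measurable_EFinP.
  exact: measurable_int (Radon_Nikodym_SigmaFinite.f_integrable dominated).
- by apply: ae_eqe_mul2l; apply: ae_eq_sym.
Qed.

Lemma integral_densityR (h : measurableTypeR R -> R) : measurable_fun setT h ->
  (\int[leb]_x (h x * g x)%:E = \int[nu]_x (h x)%:E)%E.
Proof.
move=> mh; rewrite integralE [RHS]integralE; congr (_ - _)%E.
  rewrite (_ : _^\+%E = fun x => (Num.max (h x) 0 * g x)%:E); last first.
    apply/funext => x; rewrite funeposE -EFin_max; congr (_%:E).
    by rewrite maxr_pMl ?mul0r// ltW.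
  rewrite (ge0_integral_densityR (h := fun x => Num.max (h x) 0)).
  - by apply: eq_integral => x _; rewrite funeposE -EFin_max.
  - by apply: measurable_maxr => //; exact: measurable_cst.
  - by move=> x; rewrite le_max lexx orbT.
rewrite (_ : _^\-%E = fun x => (Num.max (- h x) 0 * g x)%:E); last first.
  apply/funext => x; rewrite funenegE -EFinN -EFin_max; congr (_%:E).
  by rewrite maxr_pMl ?mul0r ?mulNr// ltW.
rewrite (ge0_integral_densityR (h := fun x => Num.max (- h x) 0)).
- by apply: eq_integral => x _; rewrite funenegE -EFinN -EFin_max.
- by apply: measurable_maxr; [exact: measurableT_comp|exact: measurable_cst].
- by move=> x; rewrite le_max lexx orbT.
Qed.

End density_measurableTypeR.

Section density.
Context (R : realType) (g : R -> R) (mu : probability R R).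
Hypothesis hg : positive_density g.
Hypothesis mug : forall A : set R, measurable A ->
  mu A = (\int[lebesgue_measure]_(x in A) (g x)%:E)%E.

Local Notation leb := (@lebesgue_measure R).

Let g_gt0 x : 0 < g x. Proof. by case: hg. Qed.

Let measurable_idR : measurable_fun setT (fun x : R => x : measurableTypeR R).
Proof. by move=> _ A mA; rewrite setTI. Qed.

Let idR : {mfun R >-> measurableTypeR R} := mfun_Sub (mem_set measurable_idR).

Let nu := distribution mu (idR : {RV mu >-> measurableTypeR R}).

Let nug (A : set (measurableTypeR R)) : measurable A ->
  nu A = (\int[lebesgue_measure]_(x in A) (g x)%:E)%E.
Proof. by move=> mA; exact: mug. Qed.

Lemma ge0_integral_density (h : R -> R) : measurable_fun setT h ->
  (forall x, 0 <= h x) ->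
  (\int[leb]_x (h x * g x)%:E = \int[mu]_x (h x)%:E)%E.
Proof.
move=> mh h0; rewrite (ge0_integral_densityR hg nug mh h0).
by rewrite ge0_integral_distribution//; exact/measurable_EFinP.
Qed.

Lemma integral_density (h : R -> R) : L1 mu h ->
  (\int[leb]_x (h x * g x)%:E = \int[mu]_x (h x)%:E)%E.
Proof.
move=> lh; have mh := L1_measurable lh.
rewrite (integral_densityR hg nug mh).
by rewrite integral_distribution//; exact/measurable_EFinP.
Qed.

Lemma density_set1 y : mu [set y] = 0%E.
Proof. by rewrite mug// integral_set1. Qed.

Lemma density_gt0 (A : set R) : measurable A -> (0 < leb A)%E -> 0 < fine (mu A).
Proof.
move=> mA A0; rewrite lt_neqAle fine_ge0// andbT eq_sym; apply/negP => /eqP m0.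
have {m0} : (\int[leb]_(x in A) `|(g x)%:E| = 0)%E.
  transitivity (\int[leb]_(x in A) (g x)%:E)%E.
    by apply: eq_integral => x _; apply: gee0_abs; rewrite lee_fin ltW.
  by rewrite -mug// -[LHS]fineK ?fin_num_measure// m0.
have mgA : measurable_fun A (EFin \o g) by case: hg => mg _ _; exact/measurable_funTS/measurable_EFinP.
move=> /(ae_eq_integral_abs leb mA mgA)[N [mN N0 AN]].
have : (leb A <= leb N)%E.
  apply: le_measure; rewrite ?inE// => x Ax; apply: AN => /= /(_ Ax) [gx].
  by have := g_gt0 x; rewrite gx ltxx.
by rewrite N0 leNgt A0.
Qed.

Lemma density_right_gt0 c : 0 < fine (mu [set x | c <= x]).
Proof.
rewrite -set_itvcy; apply: density_gt0 => //.
by rewrite lebesgue_measure_itv/= ltry addye.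
Qed.

Lemma density_left_gt0 c : 0 < fine (mu [set x | - c <= - x]).
Proof.
rewrite (_ : [set x | _] = `]-oo, c]%classic); last first.
  by apply/seteqP; split=> x /=; rewrite in_itv/= lerN2.
apply: density_gt0 => //.
by rewrite lebesgue_measure_itv/= ltNyr addey.
Qed.

(** h^2 <= 1 + |h|^(2 + delta), splitting at |h| = 1. *)
Lemma density_L2 (h : R -> R) (delta : R) : measurable_fun setT h -> 0 < delta ->
  (norm_dens g (2 + delta) h < +oo)%E -> L2 mu h.
Proof.
move=> mh d0 hN.
have p0 : 0 < 2 + delta by rewrite addr_gt0.
have mp : measurable_fun setT (fun x => `|h x| `^ (2 + delta)).
  apply: (measurableT_comp (f := @powR R ^~ (2 + delta))); first exact: measurable_powR.
  exact: measurableT_comp.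
have E : (expect_dens g (fun x => `|h x| `^ (2 + delta))%R < +oo)%E.
  have := hN; rewrite /norm_dens => /lty_poweRy; apply.
  by rewrite invr_eq0 gt_eqF.
have L1p : L1 mu (fun x => `|h x| `^ (2 + delta)).
  apply/integrableP; split; first exact/measurable_EFinP.
  rewrite (eq_integral (fun x => (`|h x| `^ (2 + delta))%R%:E)); last first.
    by move=> x _; rewrite gee0_abs// lee_fin powR_ge0.
  by rewrite -ge0_integral_density// => x; exact: powR_ge0.
split=> //; apply: (L1_le _ _ (L1D (L1_cst mu 1) L1p)); first exact: measurable_funX.
move=> x; rewrite normrX; have [h1|h1] := leP `|h x| 1.
  apply: (@le_trans _ _ 1); first by rewrite expr_le1.
  by rewrite lerDl powR_ge0.
apply: (@le_trans _ _ (`|h x| `^ (2 + delta))); last by rewrite lerDr.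
rewrite -powR_mulrn//; apply: ler_powR; first exact: ltW.
by rewrite lerDl ltW.
Qed.

End density.

(** * Uniform deviations over the likelihood class *)

(** Induction on the sharper bound 2 - 1/(N+1); the term k = 0 is 0, as the inverse of 0 is 0. *)
Lemma sum_inv_sqr_le2 (R : realFieldType) N :
  \sum_(0 <= k < N) k%:R ^- 2 <= 2 :> R.
Proof.
case: N => [|N]; first by rewrite big_geq.
case: N => [|N]; first by rewrite big_nat1 expr0n/= invr0.
suff : \sum_(0 <= k < N.+2) k%:R ^- 2 <= 2 - N.+1%:R^-1 :> R.
  by move=> /le_trans; apply; rewrite gerBl invr_ge0.
elim: N => [|N IH].
  by rewrite big_nat_recr//= big_nat1 expr0n/= invr0 expr1n invr1; lra.
rewrite big_nat_recr//=; apply: le_trans (lerD IH (lexx _)) _.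
set x := N.+1%:R; have x1 : 1 <= x :> R by rewrite /x ler1n.
have -> : N.+2%:R = x + 1 :> R by rewrite /x -natr1.
have x0 : 0 < x by lra.
have y0 : 0 < x + 1 by lra.
rewrite -subr_ge0.
have -> : 2 - (x + 1)^-1 - (2 - x^-1 + (x + 1) ^- 2) = x^-1 * (x + 1) ^- 2.
  by field; rewrite !gt_eqF.
by rewrite mulr_ge0 ?invr_ge0 ?exprn_ge0 ?(ltW x0) ?(ltW y0).
Qed.

Section empirical_process.
Context d (Omega : measurableType d) (R : realType) (P : probability Omega R).
Variable X : nat -> {RV P >-> R}.
Hypothesis hX : mutually_independent X.
Variable mu : probability R R.
Hypothesis hlaw : forall i (A : set R), measurable A -> P (X i @^-1` A) = mu A.
Variables (M gamma c : R) (g0 : R -> R).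
Hypothesis hM : 0 < M.
Hypothesis hgamma : 0 < gamma < 1.
Hypothesis g0_gt0 : forall x, 0 < g0 x.
Hypothesis hg0 : unimodal c g0.
Hypothesis mu_right : 0 < fine (mu [set x | c <= x]).
Hypothesis mu_left : 0 < fine (mu [set x | - c <= - x]).

Local Notation Cl := (likelihood_class M gamma c g0).
Local Notation dc := (dev_const M gamma c g0).

Lemma dense_below_rat (c' : R) :
  exists s : nat -> R, (forall k, s k < c') /\ dense_below s c'.
Proof.
exists (fun k => if rat_seq R k < c' then rat_seq R k else c' - 1); split.
  by move=> k; case: ifP => // _; rewrite gtrBl.
move=> x y xy yc; have [k /andP[xk ky]] := rat_seq_dense xy.
by exists k; rewrite (lt_le_trans ky yc) xk.
Qed.

(** [Q] is a measurable substitute for the squared supremum over the class, chosen before [L]: the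
    sum of the squared deviations for the whole line, the left rays and the right rays, each of
    which it therefore dominates. *)
Lemma dev_majorant (h : R -> R) : L2 mu h ->
  exists2 C : R, 0 <= C & forall n, exists Q : Omega -> \bar R,
    [/\ measurable_fun setT Q, forall w, (0 <= Q w)%E,
      (\int[P]_w Q w <= (n%:R * C)%:E)%E &
      forall w L, Cl L -> (Q w < +oo)%E ->
        `|dev X mu (fun x => h x * L x) n w| <= dc * Num.sqrt (fine (Q w))].
Proof.
move=> lh; pose h0 x := h x - \int[mu]_y h y.
have lh0 : L2 mu h0 by apply: L2B => //; exact: L2_cst.
have h00 : \int[mu]_x h0 x = 0.
  by rewrite RintegralB ?Rintegral_prob_cst ?subrr//; [exact: L2_L1|exact: L1_cst].
have [sl [slc dsl]] := dense_below_rat c.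
have [sr [src dsr]] := dense_below_rat (- c).
pose C1 := \int[mu]_x h0 x ^+ 2.
pose C2 := ray_const mu h (fine (mu [set x | c <= id x])).
pose C3 := ray_const mu h (fine (mu [set x | - c <= - x])).
have ray_const_ge0 b : 0 <= ray_const mu h b.
  rewrite /ray_const addr_ge0// mulr_ge0// ?sqr_ge0// addr_ge0 ?sqr_ge0//.
  by apply: Rintegral_ge0 => x _; exact: sqr_ge0.
have C10 : 0 <= C1 by apply: Rintegral_ge0 => x _; exact: sqr_ge0.
exists (C1 + C2 + C3); first exact: addr_ge0 (addr_ge0 C10 (ray_const_ge0 _)) (ray_const_ge0 _).
move=> n.
have [D2 [mD2 D20 HD2 ED2]] := ray_maximal hX hlaw lh (@measurable_id _ _ setT)
  mu_right (lexx _) n slc.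
have mopp : measurable_fun setT (-%R : R -> R) by exact: oppr_measurable.
have [D3 [mD3 D30 HD3 ED3]] := ray_maximal hX hlaw lh mopp mu_left (lexx _) n src.
pose D1 w := ((dev X mu h n w) ^+ 2)%:E.
have mD1 : measurable_fun setT D1.
  by apply/measurable_EFinP; apply: measurable_funX; apply: measurable_dev; exact: lh.1.
have D10 w : (0 <= D1 w)%E by rewrite lee_fin sqr_ge0.
have devE w : dev X mu h n w = \sum_(i < n) h0 (X i w) by [].
have ED1 : (\int[P]_w D1 w <= (n%:R * C1)%:E)%E.
  have i1 : L1 P (fun w => (\sum_(i < n) h0 (X i w)) ^+ 2).
    exact: (L2_sum (index_enum 'I_n) (fun (i : 'I_n) (_ : true) => L2_law hlaw i lh0)).2.
  rewrite -[leLHS]fineK; last exact: integrable_fin_num i1.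
  by rewrite lee_fin -(Rintegral_sum_sqr hX hlaw n lh0 h00).
exists (fun w => D1 w + D2 w + D3 w)%E; split.
- by apply: emeasurable_funD => //; exact: emeasurable_funD.
- by move=> w; rewrite !adde_ge0.
- rewrite ge0_integralD//; last 2 first.
  + by move=> w _; rewrite adde_ge0.
  + exact: emeasurable_funD.
  rewrite ge0_integralD// [n%:R * _]mulrDr [n%:R * (C1 + C2)]mulrDr 2!EFinD.
  apply: leeD ED3; exact: leeD.
- move=> w L LL Qoo; set Q := (D1 w + D2 w + D3 w)%E in Qoo *.
  have Qfin : Q \is a fin_num by rewrite ge0_fin_numE// !adde_ge0.
  have le_b y : ((y ^+ 2)%:E <= Q)%E -> `|y| <= Num.sqrt (fine Q).
    move=> yQ; rewrite -sqrtr_sqr ler_wsqrtr//.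
    by rewrite -lee_fin fineK.
  apply: (dev_likelihood hM hgamma g0_gt0 hg0 (L2_L1 lh) LL dsl dsr).
  + by apply: le_b; rewrite /Q -addeA leeDl ?adde_ge0.
  + by move=> k; apply: le_b; apply: le_trans (HD2 k w) _; rewrite /Q addeAC leeDr ?adde_ge0.
  + by move=> k; apply: le_b; apply: le_trans (HD3 k w) _; rewrite /Q leeDr ?adde_ge0.
Qed.

Lemma dev_majorants (phi : nat -> R -> R) l : (forall j, (j <= l)%N -> L2 mu (phi j)) ->
  exists2 C : R, 0 <= C & exists Q : nat -> Omega -> \bar R, forall n,
    [/\ measurable_fun setT (Q n), forall w, (0 <= Q n w)%E,
      (\int[P]_w Q n w <= (n%:R * C)%:E)%E &
      forall w L j, Cl L -> (j <= l)%N -> (Q n w < +oo)%E ->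
        `|dev X mu (fun x => phi j x * L x) n w| <= dc * Num.sqrt (fine (Q n w))].
Proof.
elim: l => [|l IH] lphi.
  have [C C0 H] := dev_majorant (lphi 0%N (leqnn _)).
  exists C => //; have [Q HQ] := choice H; exists Q => n.
  have [h1 h2 h3 h4] := HQ n; split=> // w L j LL; rewrite leqn0 => /eqP ->.
  exact: h4.
have [C C0 [Q HQ]] := IH (fun j jl => lphi j (leqW jl)).
have [C' C'0 H] := dev_majorant (lphi l.+1 (leqnn _)).
have [Q' HQ'] := choice H.
exists (C + C'); first exact: addr_ge0.
exists (fun n w => Q n w + Q' n w)%E => n.
have [m1 p1 e1 b1] := HQ n; have [m2 p2 e2 b2] := HQ' n; split.
- exact: emeasurable_funD.
- by move=> w; rewrite adde_ge0.
- by rewrite ge0_integralD// mulrDr EFinD leeD.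
- move=> w L j LL jl Qoo.
  have dc0 := dev_const_ge0 M c hgamma g0_gt0.
  have Q1 : (Q n w < +oo)%E by apply: le_lt_trans Qoo; rewrite leeDl.
  have Q2 : (Q' n w < +oo)%E by apply: le_lt_trans Qoo; rewrite leeDr.
  have f1 : Q n w \is a fin_num by rewrite ge0_fin_numE.
  have f2 : Q' n w \is a fin_num by rewrite ge0_fin_numE.
  move: jl; rewrite leq_eqVlt => /orP[/eqP ->|jl].
    apply: le_trans (b2 w L LL Q2) _; apply: ler_wpM2l => //; apply: ler_wsqrtr.
    by rewrite fineD// lerDr fine_ge0.
  apply: le_trans (b1 w L j LL jl Q1) _; apply: ler_wpM2l => //; apply: ler_wsqrtr.
  by rewrite fineD// lerDl fine_ge0.
Qed.

Section subsequence.
Variables (phi : nat -> R -> R) (l : nat).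
Hypothesis lphi : forall j, (j <= l)%N -> L2 mu (phi j).

(** Times the envelope at [c], a square-integrable bound on every centred term, uniform over the
    class and the moments. *)
Let B x := \sum_(j < l.+1) (`|phi j x| + \int[mu]_y `|phi j y|).

Let lB : L2 mu B.
Proof.
apply: (@L2_sum _ _ _ mu _ _ _ (fun (j : 'I_l.+1) x => `|phi j x| + \int[mu]_y `|phi j y|)) => j _.
by apply: L2D; [apply/L2_abs/lphi; rewrite -ltnS|exact: L2_cst].
Qed.

Let B0 x : 0 <= B x.
Proof. by apply: sumr_ge0 => j _; rewrite addr_ge0// Rintegral_ge0. Qed.

Let L1phi L j : Cl L -> (j <= l)%N -> L1 mu (fun x => phi j x * L x).
Proof.
by move=> LL jl; exact: (likelihood_L1 hM hgamma g0_gt0 hg0 (L2_L1 (lphi jl)) LL).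
Qed.

Let term_bound L j x : Cl L -> (j <= l)%N ->
  `|phi j x * L x - \int[mu]_y (phi j y * L y)| <= envelope M gamma g0 c * B x.
Proof.
move=> LL jl; have Lb y := likelihood_bound hM hgamma g0_gt0 hg0 y LL.
have E0 := envelope_ge0 M gamma g0_gt0 c.
apply: (@le_trans _ _ (envelope M gamma g0 c * (`|phi j x| + \int[mu]_y `|phi j y|))).
  rewrite mulrDr; apply: le_trans (ler_normB _ _) _; apply: lerD.
    rewrite normrM mulrC ler_wpM2r//.
    by case/andP: (Lb x) => ? ?; rewrite ger0_norm.
  apply: le_trans (le_normr_Rintegral measurableT (L1phi LL jl)) _.
  have l1 := L1_abs (L2_L1 (lphi jl)).
  rewrite -RintegralZl//; apply: le_Rintegral => //.
  - exact: L1_abs (L1phi LL jl).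
  - exact: L1Z.
  - move=> y _; rewrite normrM mulrC ler_wpM2r//.
    by case/andP: (Lb y) => ? ?; rewrite ger0_norm.
apply: ler_wpM2l => //; rewrite /B.
rewrite (bigD1 (Ordinal (jl : (j < l.+1)%N)))//= lerDl.
by apply: sumr_ge0 => k _; rewrite addr_ge0// Rintegral_ge0.
Qed.

(* Up to the envelope bound, G k dominates the increments of the empirical sums
   for k^2 <= n < (k+1)^2. *)
Let G k w := \sum_(i < k.*2.+1) B (X (k ^ 2 + i) w).

Let L2_G k : L2 P (G k).
Proof.
exact: (@L2_sum _ _ _ P _ _ _ (fun (i : 'I_(k.*2.+1)) w => B (X (k ^ 2 + i) w))
  (fun i _ => L2_law hlaw _ lB)).
Qed.

(** No cancellation within the block is needed: (2k+1)^2 is already of order k^2. *)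
Let E_G k : \int[P]_w G k w ^+ 2 <= (k.*2.+1)%:R ^+ 2 * \int[mu]_x B x ^+ 2.
Proof.
have li (i : 'I_(k.*2.+1)) : L1 P (fun w => B (X (k ^ 2 + i) w) ^+ 2).
  exact: (L2_law hlaw _ lB).2.
apply: (@le_trans _ _ (\int[P]_w ((k.*2.+1)%:R * \sum_(i < k.*2.+1) B (X (k ^ 2 + i) w) ^+ 2))).
  apply: le_Rintegral => //.
  - exact: (L2_G k).2.
  - by apply: L1Z; exact: (L1_sum _ (fun i _ => li i)).
  - by move=> w _; exact: sqr_sum.
rewrite RintegralZl//; last exact: (L1_sum _ (fun i _ => li i)).
rewrite (Rintegral_sum _ (fun (i : 'I_(k.*2.+1)) (_ : true) => li i)) expr2 -mulrA ler_wpM2l//.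
rewrite (eq_bigr (fun=> \int[mu]_x B x ^+ 2)); last first.
  by move=> i _; rewrite (Rintegral_law hlaw _ (h := fun x => B x ^+ 2))//; exact: lB.2.
by rewrite sumr_const card_ord mulr_natl.
Qed.

Let dev_split L j k n w : Cl L -> (j <= l)%N -> (k ^ 2 <= n < k.+1 ^ 2)%N ->
  `|dev X mu (fun x => phi j x * L x) n w| <=
  `|dev X mu (fun x => phi j x * L x) (k ^ 2) w| + envelope M gamma g0 c * G k w.
Proof.
move=> LL jl /andP[kn nk]; have E0 := envelope_ge0 M gamma g0_gt0 c.
pose F i := phi j (X i w) * L (X i w) - \int[mu]_y (phi j y * L y).
rewrite /dev -!(big_mkord xpredT F) (big_cat_nat (leq0n (k ^ 2)) kn)//=.
apply: le_trans (ler_normD _ _) _; rewrite lerD2l.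
apply: le_trans (ler_norm_sum _ _ _) _.
rewrite -{1}[(k ^ 2)%N]add0n big_addn big_mkord mulr_sumr.
have nk2 : (n - k ^ 2 <= k.*2.+1)%N.
  rewrite leq_subLR -ltnS; apply: leq_trans nk _.
  by rewrite -mul2n -addn1 sqrnD muln1 exp1n; lia.
rewrite (big_ord_widen _ (fun i => `|F (i + k ^ 2)%N|) nk2) big_mkcond/=.
apply: ler_sum => i _; case: ifP => _; last by rewrite mulr_ge0.
by rewrite addnC; exact: term_bound.
Qed.

(** [Y k] collects the squared deviation at k^2 and the squared block bound, divided by k^4. Its
    mean is O(k^-2), so the series of the [Y k] converges almost surely. Since k^2 <= n, taking
    roots gives deviations of order n sqrt(Y k). *)
Lemma almost_sure_majorant : exists Y : nat -> Omega -> \bar R,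
  [/\ forall k, measurable_fun setT (Y k), forall k w, (0 <= Y k w)%E,
      {ae P, forall w, Y ^~ w @ \oo --> 0%E} &
      exists2 C : R, 0 <= C & forall k n w L j, (0 < k)%N ->
        (k ^ 2 <= n < k.+1 ^ 2)%N -> Cl L -> (j <= l)%N -> (Y k w < +oo)%E ->
        `|dev X mu (fun x => phi j x * L x) n w| <=
          n%:R * (C * Num.sqrt (fine (Y k w)))].
Proof.
have [C C0 [Q HQ]] := dev_majorants lphi.
have mQ n : measurable_fun setT (Q n) by case: (HQ n).
have Q0 n w : (0 <= Q n w)%E by case: (HQ n).
have mG k : measurable_fun setT (fun w => (G k w ^+ 2)%:E).
  by apply/measurable_EFinP; apply: measurable_funX; exact: (L2_G k).1.
have G0 k w : (0 <= (G k w ^+ 2)%:E)%E by rewrite lee_fin sqr_ge0.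
pose Y k w := ((k%:R ^- 4)%:E * (Q (k ^ 2)%N w + (G k w ^+ 2)%:E))%E.
have mY k : measurable_fun setT (Y k).
  by apply: measurable_funeM; exact: emeasurable_funD.
have k4 k : 0 <= k%:R ^- 4 :> R by rewrite invr_ge0 exprn_ge0.
have Y0 k w : (0 <= Y k w)%E by rewrite mule_ge0 ?lee_fin// adde_ge0.
(* 9 from (2k+1)^2 <= 9 k^2 for k >= 1. *)
pose D := C + 9 * \int[mu]_x B x ^+ 2.
have D0 : 0 <= D.
  rewrite addr_ge0// mulr_ge0//; apply: Rintegral_ge0 => x _; exact: sqr_ge0.
have EY k : (\int[P]_w Y k w <= (D * k%:R ^- 2)%:E)%E.
  have mS : measurable_fun setT (fun w => Q (k ^ 2)%N w + (G k w ^+ 2)%:E)%E.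
    exact: emeasurable_funD.
  have S0 w : setT w -> (0 <= Q (k ^ 2)%N w + (G k w ^+ 2)%:E)%E by rewrite adde_ge0.
  have k4E : (0 <= (k%:R ^- 4 : R)%:E)%E by rewrite lee_fin.
  rewrite ge0_integralZl//.
  rewrite ge0_integralD//.
  have e1 : (\int[P]_w Q (k ^ 2)%N w <= ((k ^ 2)%:R * C)%:E)%E by case: (HQ (k ^ 2)%N).
  have e2 : (\int[P]_w (G k w ^+ 2)%:E <= ((k.*2.+1)%:R ^+ 2 * \int[mu]_x B x ^+ 2)%:E)%E.
    rewrite -[leLHS]fineK; last exact: integrable_fin_num (L2_G k).2.
    by rewrite lee_fin; exact: E_G.
  apply: le_trans (lee_wpmul2l _ (leeD e1 e2)) _; first by rewrite lee_fin.
  rewrite -EFinD -EFinM lee_fin; case: k {e1 e2 mS S0 k4E} => [|k].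
    by rewrite !expr0n/= !invr0 mul0r mulr0.
  have k1 : 1 <= k.+1%:R :> R by rewrite ler1n.
  have k0 : 0 < k.+1%:R :> R by rewrite ltr0n.
  have b2 : 0 <= \int[mu]_x B x ^+ 2 by apply: Rintegral_ge0 => x _; exact: sqr_ge0.
  have -> : (k.+1.*2.+1)%:R = 2 * k.+1%:R + 1 :> R by rewrite -mul2n -addn1 natrD natrM.
  rewrite natrX ler_pdivrMl ?exprn_gt0//.
  set x := k.+1%:R in k1 k0 *.
  have -> : x ^+ 4 * (D * x ^- 2) = D * x ^+ 2 by field; rewrite gt_eqF.
  have h9 : (2 * x + 1) ^+ 2 <= 9 * x ^+ 2 by nra.
  have := ler_wpM2l b2 h9; rewrite /D; set b := \int[mu]_x _; lra.
have sum2 : (\sum_(0 <= k <oo) (D * k%:R ^- 2)%:E <= (2 * D)%:E)%E.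
  apply: lime_le; first by apply: is_cvg_nneseries => k _ _; rewrite lee_fin mulr_ge0// invr_ge0 exprn_ge0.
  apply: nearW => N; rewrite sumEFin lee_fin -mulr_sumr mulrC ler_wpM2r//.
  exact: sum_inv_sqr_le2.
exists Y; split=> //.
  have : P.-integrable setT (fun w => \sum_(0 <= k <oo) Y k w)%E.
    apply/integrableP; split; first exact: ge0_emeasurable_sum.
    under eq_integral => w _ do rewrite gee0_abs ?nneseries_ge0//.
    rewrite integral_nneseries//; apply: le_lt_trans (_ : ((2 * D)%:E < +oo)%E); last exact: ltry.
    apply: le_trans sum2; apply: lee_nneseries => [k _ _|k _ //].
    exact: integral_ge0.
  move=> /(integrable_ae measurableT); apply: filterS => w /(_ I) fin.
  have tail := nneseries_tail_cvg (P := xpredT) (f := Y ^~ w).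
  have {}tail := tail (_ : _ < +oo)%E (fun k _ => Y0 k w).
  apply: (squeeze_cvge (f := fun=> 0%E) (h := fun N => (\sum_(N <= k <oo) Y k w)%E)).
  - apply: nearW => N; rewrite Y0/=.
    have := @nneseries_lim_ge R (Y ^~ w) xpredT N N.+1 (fun k _ _ => Y0 k w).
    by rewrite big_nat1.
  - exact: cvg_cst.
  - by apply: tail; rewrite -ge0_fin_numE// nneseries_ge0.
have dc0 := dev_const_ge0 M c hgamma g0_gt0.
have E0 := envelope_ge0 M gamma g0_gt0 c.
exists (dc + envelope M gamma g0 c); first exact: addr_ge0.
move=> k n w L j k0 kn LL jl Yoo.
have kR : 0 < k%:R :> R by rewrite ltr0n.
have Yfin : Y k w \is a fin_num by rewrite ge0_fin_numE.
have Qoo : (Q (k ^ 2)%N w < +oo)%E.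
  rewrite ltey; apply/eqP => Qy; move: Yoo; rewrite /Y Qy addye// gt0_muley ?ltxx//.
  by rewrite lte_fin invr_gt0 exprn_gt0.
have Qfin : Q (k ^ 2)%N w \is a fin_num by rewrite ge0_fin_numE.
have YE : k%:R ^+ 4 * fine (Y k w) = fine (Q (k ^ 2)%N w) + G k w ^+ 2.
  rewrite /Y -(fineK Qfin) -EFinD -EFinM/= mulrA divff ?mul1r//.
  by rewrite expf_eq0/= gt_eqF.
have sq : Num.sqrt (k%:R ^+ 4 * fine (Y k w)) = (k ^ 2)%:R * Num.sqrt (fine (Y k w)).
  rewrite sqrtrM ?exprn_ge0// natrX; congr (_ * _).
  by rewrite (_ : 4 = 2 * 2)%N// exprM sqrtr_sqr ger0_norm// sqr_ge0.
have b1 : `|dev X mu (fun x => phi j x * L x) (k ^ 2)%N w| <=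
    dc * ((k ^ 2)%:R * Num.sqrt (fine (Y k w))).
  case: (HQ (k ^ 2)%N) => _ _ _ /(_ w L j LL jl Qoo) /le_trans; apply.
  by rewrite ler_wpM2l// -sq ler_wsqrtr// YE lerDl sqr_ge0.
have b2 : G k w <= (k ^ 2)%:R * Num.sqrt (fine (Y k w)).
  rewrite -sq YE; apply: (@le_trans _ _ (Num.sqrt (G k w ^+ 2))).
    by rewrite sqrtr_sqr ler_norm.
  by rewrite ler_wsqrtr// lerDr fine_ge0.
apply: le_trans (dev_split w LL jl kn) _.
apply: le_trans (lerD b1 (ler_wpM2l E0 b2)) _.
rewrite -mulrDl mulrCA ler_wpM2r ?mulr_ge0 ?addr_ge0 ?sqrtr_ge0//.
by rewrite ler_nat; case/andP: kn.
Qed.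

End subsequence.

End empirical_process.

Section ae_distinct.
Context d (Omega : measurableType d) (R : realType) (P : probability Omega R).
Variable X : nat -> {RV P >-> R}.
Hypothesis hX : mutually_independent X.
Hypothesis atomless : forall i y, P (X i @^-1` [set y]) = 0%E.

(** Fubini for the product law: the sections of the diagonal are singletons, of probability 0. *)
Lemma ae_injective : {ae P, forall w, injective (fun i => X i w)}.
Proof.
have H i j : {ae P, forall w, i != j -> X i w != X j w}.
  have [ij|ij] := eqVneq i j; first by apply: nearW.
  pose D : set (R * R) := [set z | z.1 = z.2].
  have mD : measurable D.
    rewrite (_ : D = (fun z => z.1 - z.2) @^-1` [set 0]).
      rewrite -[_ @^-1` _]setTI; apply: measurable_funB => //.
    by apply/seteqP; split=> z /= => [->|/eqP]; rewrite ?subrr// subr_eq0 => /eqP.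
  have mZ : measurable_fun setT (fun w : Omega => (X i w, X j w)).
    by apply/measurable_fun_pairP; split; exact: measurable_funP.
  pose Z : {mfun Omega >-> (R * R)%type} := mfun_Sub (mem_set mZ).
  have lE : (distribution P (X i) \x distribution P (X j))%E D =
      distribution P (Z : {RV P >-> (R * R)%type}) D.
    apply: product_measure_unique => // A B mA mB.
    have ji : j \notin [:: i] by rewrite inE eq_sym.
    apply: (@indep_sigma_cylinders _ _ _ _ X hX [:: i] j B _ _ ji mB) => //.
    by apply: sub_sigma_algebra; apply: cylinders_preimage => //; rewrite inE.
  have P0 : P [set w | X i w = X j w] = 0%E.
    transitivity (distribution P (Z : {RV P >-> (R * R)%type}) D) => //.
    rewrite -lE /product_measure1/=; apply: integral0_eq => x _.
    rewrite (_ : xsection D x = [set x]); first exact: atomless.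
    by apply/seteqP; split=> y; rewrite /xsection/= inE /D/= => ->.
  exists [set w | X i w = X j w]; split => //.
    rewrite (_ : [set w | _] = (fun w => (X i w, X j w)) @^-1` D)//.
    by rewrite -[_ @^-1` _]setTI; exact: (mZ measurableT).
  move=> w /= h; apply: contrapT => /eqP h'; apply: h => _; exact: h'.
have := ae_foralln (fun i => ae_foralln (H i)).
apply: filterS => w Hw i j /= Xij; apply/eqP; apply/negP => /negP ij.
by have := Hw i j ij; rewrite Xij eqxx.
Qed.

End ae_distinct.

Lemma ball_row_perturb (R : realType) q (A : set 'rV[R]_q) (z : 'rV[R]_q) :
  interior A z -> exists2 r : R, 0 < r & forall (k : 'I_q) (b : bool),
    A (\row_k' (z 0 k' + (if b then r else - r) *+ (k == k'))).
Proof.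
move=> /nbhs_ballP[r /= r0 rA]; exists (r / 2) => [|k b]; first by rewrite divr_gt0.
apply: rA; split=> // i k'; rewrite mxE !ord1 /ball/= opprD addrA subrr sub0r normrN.
have r2 : `|if b then r / 2 else - (r / 2)| < r.
  by case: b; rewrite ?normrN gtr0_norm ?divr_gt0//; lra.
by case: (k == k'); rewrite ?mulr1n// mulr0n normr0.
Qed.

(** * The sampled problem as a perturbation of the true one *)

Section sample_optimum.
Context d (Omega : measurableType d) (R : realType) (P : probability Omega R).
Variable X : nat -> {RV P >-> R}.
Variable mu : probability R R.
Variables (M gamma c : R) (g0 : R -> R) (m l : nat).
Variables (phi : nat -> R -> R) (nu : nat -> R).
Hypothesis hM : 0 < M.
Hypothesis hgamma : 0 < gamma < 1.
Hypothesis hml : (m <= l)%N.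
Hypothesis hg0 : positive_density g0.
Hypothesis hg0_unimodal : unimodal c g0.
Hypothesis mug : forall A : set R, measurable A ->
  mu A = (\int[lebesgue_measure]_(x in A) (g0 x)%:E)%E.
Hypothesis lphi : forall j, (j <= l)%N -> L2 mu (phi j).
Hypothesis hslater : exists2 L0, likelihood_class M gamma c g0 L0 &
  (forall j, (1 <= j <= m)%N ->
     (expect_dens g0 (fun x => phi j x * L0 x)%R < (nu j)%:E)%E) /\
  (forall j, (m < j <= l)%N ->
     expect_dens g0 (fun x => phi j x * L0 x) = (nu j)%:E).
Hypothesis hinterior :
  interior (equality_moment_range M gamma c g0 m l phi)
    (\row_(k < l - m) nu (m + k.+1)%N).

Local Notation Cl := (likelihood_class M gamma c g0).
Local Notation vP := (val_P M gamma c g0 m l phi nu).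
Local Notation vPn n w := (val_Pn M gamma c g0 m l phi nu (sample X n w)).

Let g0_gt0 x : 0 < g0 x. Proof. by case: hg0. Qed.

Let V (L : R -> R) j := \int[mu]_x (phi j x * L x).
Let W n w (L : R -> R) j := n%:R^-1 * \sum_(i < n) phi j (X i w) * L (X i w).

Let L1phi L j : Cl L -> (j <= l)%N -> L1 mu (fun x => phi j x * L x).
Proof.
by move=> LL jl; exact: (likelihood_L1 hM hgamma g0_gt0 hg0_unimodal (L2_L1 (lphi jl)) LL).
Qed.

Let expectE L j : Cl L -> (j <= l)%N ->
  expect_dens g0 (fun x => phi j x * L x) = (V L j)%:E.
Proof.
move=> LL jl; rewrite /expect_dens (integral_density hg0 mug (L1phi LL jl)).
by rewrite /V /Rintegral fineK//; exact: integrable_fin_num (L1phi LL jl).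
Qed.

Let val_PE : vP = optimum Cl m l nu V.
Proof.
congr ereal_sup; apply/seteqP; split=> [_ [L [LL [h1 h2]] <-]|_ [L [LL h1 h2] <-]].
  exists L; last by rewrite expectE.
  split=> // j jb; case/andP: (jb) => j1 jl.
    by rewrite -lee_fin -expectE ?(leq_trans jl)//; exact: h1.
  by apply: EFin_inj; rewrite -expectE//; exact: h2.
exists L; last by rewrite expectE.
split=> //; split=> j jb; case/andP: (jb) => j1 jl.
  by rewrite expectE ?(leq_trans jl)// lee_fin; exact: h1.
by rewrite expectE// h2.
Qed.

Let val_PnE n w : vPn n w = optimum Cl m l nu (W n w).
Proof.
congr ereal_sup; apply/seteqP; split=> [_ [L [LL [h1 h2]] <-]|_ [L [LL h1 h2] <-]].
  exists L => //; split; [by []|by move=> j /h1|by move=> j /h2[]].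
exists L => //; split=> //; split=> j jb; first by rewrite lee_fin; exact: h1.
by rewrite /sample_moment -[X in X%:E]/(W n w L j) h2.
Qed.

Let affine_V : affine_moments Cl l V.
Proof.
move=> I w L w0 w1 CL; exists (fun x => \sum_i w i * L i x).
  exact: likelihood_convex.
move=> j jl; rewrite /V.
have Li i : L1 mu (fun x => w i * (phi j x * L i x)) by apply: L1Z; exact: L1phi.
rewrite (_ : \int[mu]_x _ = \int[mu]_x \sum_i (w i * (phi j x * L i x))); last first.
  by apply: eq_Rintegral => x _; rewrite mulr_sumr; apply: eq_bigr => i _; rewrite mulrCA.
rewrite (Rintegral_sum _ (fun i (_ : true) => Li i)); apply: eq_bigr => i _.
by rewrite RintegralZl//; exact: L1phi.
Qed.

Let affine_W n w : affine_moments Cl l (W n w).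
Proof.
move=> I t L t0 t1 CL; exists (fun x => \sum_i t i * L i x).
  exact: likelihood_convex.
move=> j jl; rewrite /W.
under [RHS]eq_bigr do rewrite mulrCA mulr_sumr.
rewrite -mulr_sumr exchange_big/=; congr (_ * _); apply: eq_bigr => i _.
by rewrite mulr_sumr; apply: eq_bigr => k _; rewrite mulrCA.
Qed.

(** Deterministic in the sample: empirical moments are again affine on the class, so a small uniform
    deviation is a perturbation of size Delta. *)
Lemma val_Pn_deviation : exists C e : R, [/\ 0 <= C, 0 < e, vP \is a fin_num &
  forall n w (Delta : R), (0 < n)%N -> 0 <= Delta <= e ->
    (forall L j, Cl L -> (j <= l)%N ->
       `|dev X mu (fun x => phi j x * L x) n w| <= n%:R * Delta) ->
  (`|vPn n w - vP| <= (C * Delta)%:E)%E].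
Proof.
have [L0 CL0 [L0lt L0eq]] := hslater.
have [r r0 hr] := ball_row_perturb hinterior.
pose bnd := envelope M gamma g0 c * \sum_(j < l.+1) \int[mu]_x `|phi j x|.
have Vb L j : Cl L -> (j <= l)%N -> `|V L j| <= bnd.
  move=> LL jl; have l1 := L1_abs (L2_L1 (lphi jl)).
  apply: (@le_trans _ _ (envelope M gamma g0 c * \int[mu]_x `|phi j x|)).
    apply: le_trans (le_normr_Rintegral measurableT (L1phi LL jl)) _.
    rewrite -RintegralZl//; apply: le_Rintegral => //.
    - exact: L1_abs (L1phi LL jl).
    - exact: L1Z.
    - move=> x _; rewrite normrM mulrC ler_wpM2r//.
      by case/andP: (likelihood_bound hM hgamma g0_gt0 hg0_unimodal x LL) => ? ?; rewrite ger0_norm.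
  apply: ler_wpM2l; first exact: envelope_ge0.
  rewrite (bigD1 (Ordinal (jl : (j < l.+1)%N)))//= lerDl.
  by apply: sumr_ge0 => k _; exact: Rintegral_ge0.
have Vlt j : (1 <= j <= m)%N -> V L0 j < nu j.
  move=> jb; case/andP: (jb) => j1 jl.
  by rewrite -lte_fin -expectE ?(leq_trans jl)//; exact: L0lt.
have Veq j : (m < j <= l)%N -> V L0 j = nu j.
  move=> jb; apply: EFin_inj; rewrite -expectE//; first exact: L0eq.
  by case/andP: jb.
have Vint (k : 'I_(l - m)) (b : bool) : exists2 L, Cl L & forall k' : 'I_(l - m),
    V L (m + k'.+1)%N = nu (m + k'.+1)%N + (if b then r else - r) *+ (k == k').
  have [L CL HL] := hr k b; exists L => // k'.
  have kl : (m + k'.+1 <= l)%N by have := ltn_ord k'; rewrite ltn_subRL addnS.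
  by apply: EFin_inj; rewrite -expectE// HL !mxE.
have [C [e [C0 e0 fin H]]] := slater_interior_perturbation hml affine_V CL0 r0 Vb Vlt Veq Vint.
exists C, e; rewrite val_PE; split=> // n w Delta n0 De hD.
rewrite val_PnE; apply: H => // L j CL jl.
have n0R : 0 < n%:R :> R by rewrite ltr0n.
rewrite -(ler_pM2l n0R); apply: le_trans (hD L j CL jl).
rewrite (_ : dev X mu _ n w = n%:R * (W n w L j - V L j)); last first.
  rewrite mulrBr /W mulrA divff ?gt_eqF// mul1r /dev sumrB; congr (_ - _).
  by rewrite sumr_const card_ord mulr_natl.
by rewrite normrM gtr0_norm.
Qed.

End sample_optimum.

(** * Outer convergence and the final assembly *)

Lemma nat_sqrt n : exists k, (k ^ 2 <= n < k.+1 ^ 2)%N.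
Proof.
elim: n => [|n [k /andP[h1 h2]]]; first by exists 0%N.
have [h|h] := leqP (k.+1 ^ 2) n.+1; last by exists k; rewrite h (leqW h1).
exists k.+1; rewrite h/=; apply: leq_ltn_trans h2 _.
by rewrite ltn_sqr.
Qed.

(** Almost surely, and for all large n at once, a minimal majorant lies below any measurable bound;
    so it suffices that such bounds tend to 0. *)
Lemma cvg_as_outer_le d (T : measurableType d) (R : realType)
    (P : probability T R) (Z V : nat -> T -> \bar R) (N : nat) :
    (forall n w, (0 <= Z n w)%E) ->
    (forall n, (N <= n)%N -> measurable_fun setT (V n)) ->
    (forall n w, (N <= n)%N -> (Z n w <= V n w)%E) ->
    {ae P, forall w, V ^~ w @ \oo --> 0%E} ->
  cvg_as_outer P Z (fun=> 0%E).
Proof.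
move=> Z0 mV ZV V0.
have /choice[U HU] n := minimal_majorant_exists P (fun w => `|Z n w - 0|%E).
exists U; split=> //.
have UV : {ae P, forall w, forall n, (N <= n)%N -> (U n w <= V n w)%E}.
  apply: ae_foralln => n; have [Nn|nN] := leqP N n; last exact: nearW.
  have [_ _ /(_ (V n) (mV n Nn))] := HU n.
  have ZVn : {ae P, forall w, (`|Z n w - 0| <= V n w)%E}.
    by apply: nearW => w; rewrite sube0 gee0_abs// ZV.
  by move=> /(_ ZVn); apply: filterS.
apply: filterS2 UV V0 => w UVw; apply: squeeze_cvge (cvg_cst _).
exists N => // n /= Nn; rewrite UVw// andbT.
by have [_ /(_ w) h _] := HU n; apply: le_trans h; exact: abse_ge0.
Qed.

Lemma markov_ge0 d (T : measurableType d) (R : realType)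
    (P : probability T R) (Q : T -> \bar R) (a b : R) :
    measurable_fun setT Q -> (forall w, (0 <= Q w)%E) -> 0 < a ->
    (\int[P]_w Q w <= b%:E)%E ->
  (P [set w | (a%:E <= Q w)%E] <= (b / a)%:E)%E.
Proof.
move=> mQ Q0 a0 Qb; pose A := [set w | (a%:E <= Q w)%E].
have mA : measurable A.
  by rewrite -[A]setTI; exact: emeasurable_fun_c_infty.
suff : (a%:E * P A <= b%:E)%E.
  rewrite -(@fineK _ (P A)) ?fin_num_measure// -EFinM !lee_fin.
  by rewrite ler_pdivlMr// mulrC.
apply: le_trans Qb; rewrite -integral_cst//.
apply: (@le_trans _ _ (\int[P]_(w in A) Q w)%E); last exact: ge0_subset_integral.
apply: ge0_le_integral => //.
- by move=> w _; rewrite lee_fin ltW.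
- exact: measurable_funTS.
Qed.

Lemma limn_esup_le_near (R : realType) (u : nat -> \bar R) (N : nat) (x : \bar R) :
  (forall n, (N <= n)%N -> (u n <= x)%E) -> (limn_esup u <= x)%E.
Proof.
move=> ux; rewrite limn_esup_lim; apply: lime_le; first exact: is_cvg_esups.
exists N => // n /= Nn; apply: ge_ereal_sup => _ [k /= nk <-].
by apply: ux; exact: leq_trans nk.
Qed.

Theorem corollary4 (d : measure_display) (Omega : measurableType d)
    (R : realType) (P : probability Omega R) (X : nat -> {RV P >-> R})
    (M gamma c delta : R) (g0 : R -> R) (m l : nat)
    (phi : nat -> R -> R) (mu : nat -> R)
    (hM : 0 < M) (hgamma : 0 < gamma < 1) (hml : (m <= l)%N)
    (hg0 : positive_density g0) (hg0_unimodal : unimodal c g0)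
    (hX_density : forall i, has_density (X i) g0)
    (hX_indep : mutually_independent X)
    (hmass : exists2 j, (1 <= j <= l)%N & phi j = \1_[set: R])
    (hphi_meas : forall j, (j <= l)%N -> measurable_fun setT (phi j))
    (hdelta : 0 < delta)
    (hphi_norm : forall j, (j <= l)%N ->
       (norm_dens g0 (2 + delta) (phi j) < +oo)%E)
    (hslater : exists2 L0, likelihood_class M gamma c g0 L0 &
       (forall j, (1 <= j <= m)%N ->
          (expect_dens g0 (fun x => phi j x * L0 x)%R < (mu j)%:E)%E) /\
       (forall j, (m < j <= l)%N ->
          expect_dens g0 (fun x => phi j x * L0 x) = (mu j)%:E))
    (hinterior :
       interior (equality_moment_range M gamma c g0 m l phi)
         (\row_(k < l - m) mu (m + k.+1)%N)) :
  let vP := val_P M gamma c g0 m l phi mu in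
  let vPn n w := val_Pn M gamma c g0 m l phi mu (sample X n w) in
  [/\ {ae P, forall w, injective (fun i => X i w)},
      forall (n : nat) (w : Omega), (0 < n)%N -> injective (sample X n w) ->
        finite_dim_reducible M gamma c g0 m l phi mu (sample X n w),
      cvg_as_outer P (fun n w => `|vPn n w - vP|%E) (fun=> 0%E)
    & bigO_outer_prob P
        (fun n w => ((Num.sqrt n%:R)%:E * (vPn n w - vP))%E)].
Proof.
move=> vP vPn.
have g0_gt0 x : 0 < g0 x by case: hg0.
pose law : probability R R := distribution P (X 0%N).
have mug (A : set R) : measurable A ->
  law A = (\int[lebesgue_measure]_(x in A) (g0 x)%:E)%E := hX_density 0%N A.
have hlaw i (A : set R) : measurable A -> P (X i @^-1` A) = law A.
  by move=> mA; rewrite mug//; exact: hX_density.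
have lphi j (jl : (j <= l)%N) : L2 law (phi j).
  exact: (density_L2 hg0 mug (hphi_meas j jl) hdelta (hphi_norm j jl)).
have right0 := density_right_gt0 hg0 mug c.
have left0 := density_left_gt0 hg0 mug c.
have [C2 [e [C20 e0 vPfin Hval]]] := val_Pn_deviation X hM hgamma hml hg0
  hg0_unimodal mug lphi hslater hinterior.
rewrite -/vP in vPfin Hval.
split.
- apply: ae_injective => // i y; rewrite hlaw//; exact: density_set1 mug y.
- by move=> n w n0 inj; exact: finite_dim_reducibility.
- have [Y [mY Y0 Ycvg [C1 C10 HY]]] := almost_sure_majorant hX_indep hlaw hM hgamma
    g0_gt0 hg0_unimodal right0 left0 lphi.
  have /choice[kap Hkap] := nat_sqrt.
  have kap_ge A n : (A ^ 2 <= n)%N -> (A <= kap n)%N.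
    move=> An; have /andP[_ h] := Hkap n.
    by rewrite -ltnS -ltn_sqr (leq_ltn_trans An).
  (* Y <= t forces C1 sqrt(Y) <= e, the range of the perturbation bound. *)
  pose t := (e / (C1 + 1)) ^+ 2.
  have C11 : 0 < C1 + 1 by rewrite ltr_wpDl.
  have t0 : 0 < t by rewrite exprn_gt0// divr_gt0.
  pose f n w := C2 * (C1 * Num.sqrt (fine (Y (kap n) w))).
  (* The value +oo keeps [V] a measurable majorant at every sample; almost surely it is eventually
     not taken, since Y tends to 0. *)
  pose V n w := if (Y (kap n) w <= t%:E)%E then (f n w)%:E else +oo%E.
  apply: (@cvg_as_outer_le _ _ _ _ _ V 1%N).
  + by move=> n w; exact: abse_ge0.
  + move=> n _; apply: measurable_fun_ifT => //.
      apply: (measurable_fun_bool true); rewrite setTI.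
      rewrite (_ : _ @^-1` _ = [set w | (Y (kap n) w <= t%:E)%E])//.
      by rewrite -[X in measurable X]setTI; exact: emeasurable_fun_infty_c.
    apply/measurable_EFinP; apply: measurable_funM => //; apply: measurable_funM => //.
    apply: (measurableT_comp (f := @Num.sqrt R)).
      exact: continuous_measurable_fun (@sqrt_continuous R).
    by apply: measurableT_comp => //; exact: fine_measurable.
  + move=> n w n0; rewrite /V; case: ifPn => [Yt|_]; last exact: leey.
    have Yoo : (Y (kap n) w < +oo)%E by apply: le_lt_trans Yt _; exact: ltry.
    have Yfin : Y (kap n) w \is a fin_num by rewrite ge0_fin_numE.
    apply: Hval => // [|L j LL jl].
      rewrite mulr_ge0 ?sqrtr_ge0//=.
      apply: (@le_trans _ _ ((C1 + 1) * (e / (C1 + 1)))); last first.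
        by rewrite mulrC divfK// gt_eqF.
      apply: ler_pM => //; rewrite ?lerDl ?sqrtr_ge0//.
      rewrite -(ger0_norm (_ : 0 <= e / (C1 + 1))) ?divr_ge0 ?(ltW e0) ?(ltW C11)//.
      by rewrite -sqrtr_sqr ler_wsqrtr// -lee_fin fineK.
    by apply: HY => //; exact: kap_ge.
  + move: Ycvg; apply: filterS => w Yw.
    have kcvg : kap @ \oo --> \oo.
      apply/cvgnyPge => A; exists (A ^ 2)%N => // n /=; exact: kap_ge.
    have Ykw : (fun n => Y (kap n) w) @ \oo --> 0%E := cvg_comp _ _ kcvg Yw.
    have [Yfin Yfine] := (fine_cvgP _ _).1 Ykw.
    have fcvg : f ^~ w @ \oo --> (0 : R).
      rewrite -(mulr0 C2) -(mulr0 C1); apply: cvgMr; apply: cvgMr.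
      by rewrite -(sqrtr0 R); apply: cvg_comp Yfine _; exact: sqrt_continuous.
    have fE : (fun n => (f n w)%:E) @ \oo --> 0%E.
      by apply: cvg_EFin; [exact: nearW|exact: fcvg].
    apply: cvg_trans fE; apply: near_eq_cvg; near=> n.
    rewrite /V ifT// -(fineK (_ : Y (kap n) w \is a fin_num)); last by near: n.
    rewrite lee_fin; near: n.
    exact: cvgr_le Yfine _ t0.
- move=> eps eps0.
  have [C C0 [Q HQ]] := dev_majorants hX_indep hlaw hM hgamma
    g0_gt0 hg0_unimodal right0 left0 lphi.
  pose dc := dev_const M gamma c g0.
  have dc0 : 0 <= dc by exact: dev_const_ge0.
  (* Markov's inequality will give C / t = eps C / (C + 1) <= eps. *)
  pose t := (C + 1) / eps.
  have t0 : 0 < t by rewrite divr_gt0// ltr_wpDl.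
  (* The + 1 makes the constant positive and the last inequality strict. *)
  exists (C2 * dc * Num.sqrt t + 1); first exact: ltr_wpDl (mulr_ge0 (mulr_ge0 C20 dc0) (sqrtr_ge0 t)) ltr01.
  (* From this rank on the deviation dc sqrt(t) / sqrt(n) is at most [e]. *)
  pose N := (Num.truncn ((dc * Num.sqrt t / e) ^+ 2)).+1.
  apply: (@limn_esup_le_near _ _ N) => n Nn.
  have n0 : (0 < n)%N by exact: leq_ltn_trans Nn.
  have n0R : 0 < n%:R :> R by rewrite ltr0n.
  have [mQ Q0 EQ bQ] := HQ n.
  have sn0 : 0 < Num.sqrt n%:R :> R by rewrite sqrtr_gt0.
  have snn : Num.sqrt n%:R * Num.sqrt n%:R = n%:R :> R by rewrite -expr2 sqr_sqrtr// ltW.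
  have dn : dc * Num.sqrt t <= e * Num.sqrt n%:R.
    have q0 : 0 <= dc * Num.sqrt t / e.
      exact: divr_ge0 (mulr_ge0 dc0 (sqrtr_ge0 t)) (ltW e0).
    rewrite [leRHS]mulrC -ler_pdivrMr// -(ger0_norm q0).
    rewrite -sqrtr_sqr ler_wsqrtr//.
    apply: le_trans (ltW (truncnS_gt _)) _.
    by rewrite ler_nat.
  apply: (@le_trans _ _ (P [set w | ((n%:R * t)%:E <= Q n w)%E])).
    apply: ereal_inf_lbound; exists [set w | ((n%:R * t)%:E <= Q n w)%E] => //; split.
      by rewrite -[X in measurable X]setTI; exact: emeasurable_fun_c_infty.
    move=> w /=; rewrite leNgt => /negP h; rewrite leNgt; apply/negP => Qlt; apply: h.
    have Qoo : (Q n w < +oo)%E by apply: lt_trans Qlt _; exact: ltry.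
    have Qfin : Q n w \is a fin_num by rewrite ge0_fin_numE.
    have sQ : Num.sqrt (fine (Q n w)) <= Num.sqrt n%:R * Num.sqrt t.
      by rewrite -sqrtrM ?(ltW n0R)// ler_wsqrtr// -lee_fin fineK// ltW.
    pose D := dc * Num.sqrt t / Num.sqrt n%:R.
    have De : 0 <= D <= e.
      apply/andP; split; last by rewrite ler_pdivrMr.
      exact: divr_ge0 (mulr_ge0 dc0 (sqrtr_ge0 t)) (ltW sn0).
    have nD : n%:R * D = dc * (Num.sqrt n%:R * Num.sqrt t).
      by rewrite /D -[X in X * _]snn; field; rewrite gt_eqF.
    have := Hval n w D n0 De; rewrite -/(vPn n w).
    have dvb L j : likelihood_class M gamma c g0 L -> (j <= l)%N ->
        `|dev X law (fun x => phi j x * L x) n w| <= n%:R * D.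
      by move=> LL jl; apply: le_trans (bQ w L j LL jl Qoo) _; rewrite nD ler_wpM2l.
    move=> /(_ dvb) hv; rewrite abseM gee0_abs ?lee_fin ?sqrtr_ge0//.
    apply: le_lt_trans (lee_wpmul2l _ hv) _; first by rewrite lee_fin sqrtr_ge0.
    rewrite -EFinM lte_fin.
    have -> : Num.sqrt n%:R * (C2 * D) = C2 * dc * Num.sqrt t.
      by rewrite /D; field; rewrite gt_eqF.
    by rewrite ltrDl.
  have nt0 : 0 < n%:R * t by rewrite mulr_gt0.
  apply: le_trans (markov_ge0 mQ Q0 nt0 EQ) _; rewrite lee_fin.
  rewrite -mulf_div divff ?gt_eqF// mul1r /t invf_div mulrA ler_pdivrMr ?ltr_wpDl//.
  by rewrite mulrC ler_wpM2l ?(ltW eps0)// lerDl.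
Unshelve. all: by end_near. Qed.
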